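(* Let $K$ be an infinite field, let $\mathbb{X}\subseteq\mathbb{P}^n_K$ be a $0$-dimensional locally Gorenstein scheme with no point of $\mathrm{Supp}(\mathbb{X})$ on the hyperplane $X_0=0$, and let $\sigma$ be a homogeneous trace map of degree zero of $Q^h(R)/L_0$. Suppose that $\mathbb{X}$ is a Cayley-Bacharach scheme. (a) We have $\mathrm{HF}_{\delta^\sigma_{\mathbb{X}}}(i)\le\mathrm{HF}_{\mathbb{X}}(i-r_{\mathbb{X}})$ for all $i\in\mathbb{Z}$. In particular, the scheme $\mathbb{X}$ is arithmetically Gorenstein if and only if $\mathrm{HF}_{\delta^\sigma_{\mathbb{X}}}(i)=\mathrm{HF}_{\mathbb{X}}(i-r_{\mathbb{X}})$ for all $i\in\mathbb{Z}$. (b) $\mathbb{X}$ is an almost Gorenstein scheme if and only if $\mathrm{HF}_{\delta^\sigma_{\mathbb{X}}}(r_{\mathbb{X}}+1)=\mathrm{HF}_{\mathbb{X}}(1)$.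
   Context: Setting. $P=K[X_0,\dots,X_n]$ has the standard grading, $I_{\mathbb{X}}\subseteq P$ is the (saturated) homogeneous vanishing ideal of $\mathbb{X}$, $R=P/I_{\mathbb{X}}$ with homogeneous maximal ideal $\mathfrak{m}$, and $\mathrm{Supp}(\mathbb{X})=\{p_1,\dots,p_s\}$ is the set of closed points. The residue class $x_0$ of $X_0$ in $R$ is a non-zerodivisor. $\mathcal{O}_{\mathbb{X},p_j}$ is the local ring at $p_j$, with residue field $\kappa(p_j)$; $\varkappa_j=\dim_K\kappa(p_j)$; $\deg(\mathbb{X})=\sum_j\dim_K\mathcal{O}_{\mathbb{X},p_j}$. For a graded module $M$, $\mathrm{HF}_M(i)=\dim_KM_i$; $\mathrm{HF}_{\mathbb{X}}=\mathrm{HF}_R$; $r_{\mathbb{X}}$ is the least integer such that $\mathrm{HF}_{\mathbb{X}}(i)=\deg(\mathbb{X})$ for all $i\ge r_{\mathbb{X}}$. $\mathbb{X}$ is locally Gorenstein if every $\mathcal{O}_{\mathbb{X},p_j}$ is a Gorenstein ring, and arithmetically Gorenstein if $R$ is a Gorenstein ring. $Q^h(R)$ is the localization of $R$ at all homogeneous non-zerodivisors; $Q^h(R)=R_{x_0}\cong\prod_{j=1}^s\mathcal{O}_{\mathbb{X},p_j}[T_j,T_j^{-1}]$ with $\deg T_j=1$, via the injection $\tilde\imath:R\to Q^h(R)$, $\tilde\imath(f)=(f_{p_1}T_1^i,\dots,f_{p_s}T_s^i)$ for $f\in R_i$, where $f_{p_j}$ is the germ of $f$ at $p_j$ (the image of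 $f/x_0^i$ in $\mathcal{O}_{\mathbb{X},p_j}$). Complementary module and different. $L_0=K[x_0,x_0^{-1}]$. A homogeneous trace map of degree zero of $Q^h(R)/L_0$ is a homogeneous element $\sigma$ of degree $0$ of the graded module $\underline{\mathrm{Hom}}_{L_0}(Q^h(R),L_0)$ which is a $Q^h(R)$-basis of it; it exists when $\mathbb{X}$ is locally Gorenstein. The Dedekind complementary module $\mathfrak{C}^\sigma_{\mathbb{X}}\subseteq Q^h(R)$ is the image of the injection $\underline{\mathrm{Hom}}_{K[x_0]}(R,K[x_0])\to\underline{\mathrm{Hom}}_{L_0}(Q^h(R),L_0)=Q^h(R)\sigma\cong Q^h(R)$, $\varphi\mapsto\varphi\otimes\mathrm{id}_{L_0}$ (the last isomorphism sending $g\sigma$ to $g$). The Dedekind different is $\delta^\sigma_{\mathbb{X}}=\{f\in Q^h(R)\mid f\cdot\mathfrak{C}^\sigma_{\mathbb{X}}\subseteq R\}$, a homogeneous ideal of $R$. $\mathbb{X}$ is almost Gorenstein if there is an exact sequence of graded $R$-modules $0\to R\to\mathfrak{C}^\sigma_{\mathbb{X}}(-r_{\mathbb{X}})\to C\to0$ (degree-zero maps) with $\mathfrak{m}\cdot C=\langle0\rangle$. Cayley-Bacharach. A subscheme $\mathbb{Y}\subseteq\mathbb{X}$ is a $p_j$-subscheme if $\mathcal{O}_{\mathbb{Y},p_k}=\mathcal{O}_{\mathbb{X},p_k}$ for $k\ne j$ and $\mathcal{O}_{\mathbb{X},p_j}\to\mathcal{O}_{\mathbb{Y},p_j}$ is surjective;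 it is maximal if $\deg(\mathbb{Y})=\deg(\mathbb{X})-\varkappa_j$. Maximal $p_j$-subschemes correspond bijectively to the ideals $\langle s_j\rangle$ of $\mathcal{O}_{\mathbb{X},p_j}$ generated by a nonzero socle element $s_j$ (with $\mathcal{O}_{\mathbb{Y},p_j}=\mathcal{O}_{\mathbb{X},p_j}/\langle s_j\rangle$). For $a\in\mathcal{O}_{\mathbb{X},p_j}$ put $\mu(a)=\min\{i\in\mathbb{N}\mid(0,\dots,0,aT_j^i,0,\dots,0)\in\tilde\imath(R)\}$ (entry in position $j$). If $e_{j1},\dots,e_{j\varkappa_j}\in\mathcal{O}_{\mathbb{X},p_j}$ have residue classes forming a $K$-basis of $\kappa(p_j)$, put $\mu_{\mathbb{Y}/\mathbb{X}}=\max_k\mu(e_{jk}s_j)$ (independent of the choices). $\deg_{\mathbb{X}}(p_j)$ is the minimum of $\mu_{\mathbb{Y}/\mathbb{X}}$ over all maximal $p_j$-subschemes $\mathbb{Y}$; one has $\deg_{\mathbb{X}}(p_j)\le r_{\mathbb{X}}$. $\mathbb{X}$ is a Cayley-Bacharach scheme if $\deg_{\mathbb{X}}(p_j)=r_{\mathbb{X}}$ for all $j$. *)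

(* Defs.v *)
From HB Require Import structures.
From mathcomp Require Import all_boot all_order all_algebra.
From mathcomp Require Import generic_quotient ring_quotient boolp mpoly ring.

Set Implicit Arguments.
Unset Strict Implicit.
Unset Printing Implicit Defensive.
Import GRing.Theory.
Local Open Scope ring_scope.
Local Open Scope quotient_scope.

(** Conventions.  Subspaces and non-proper ideals are [Prop]-valued predicates;
    proper ideals to divide or localize by are the (prime) [idealr] of
    [ring_quotient], which is no restriction in classical logic. *)

(* The least natural number satisfying [P] (junk value 0 if there is none). *)
Definition minnat (P : nat -> Prop) : nat :=
  if pselect (exists i, `[< P i >]) is left h then ex_minn h else 0%N.

Definition is_ideal (A : comNzRingType) (J : A -> Prop) : Prop :=
  J 0 /\ forall a b c, J a -> J b -> J (c * a + b).

Definition idgen (A : comNzRingType) (s : seq A) (b : A) : Prop :=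
  exists c : 'I_(size s) -> A, b = \sum_(i < size s) c i * s`_i.

Definition nonunit (A : comNzRingType) (a : A) : Prop :=
  ~ exists b, a * b = 1.

Record mulset (A : comNzRingType) := MulSet {
  mset :> {pred A};
  mset1 : 1 \in mset;
  msetM : forall a b, a \in mset -> b \in mset -> a * b \in mset;
  mset0 : 0 \notin mset
}.

Section Loc.
Variables (A : comNzRingType) (S : mulset A).

Definition frac := (A * {s : A | s \in mset S})%type.
Implicit Types x y z : frac.
Definition nu x : A := x.1.
Definition de x : A := val x.2.
Lemma deP x : de x \in mset S. Proof. exact: valP x.2. Qed.
Definition mkfrac (a s : A) (h : s \in mset S) : frac := (a, exist _ s h).

Definition freq x y : bool :=
  `[< exists2 u, u \in mset S & u * (nu x * de y - nu y * de x) = 0 >].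

Lemma freq_refl : reflexive freq.
Proof. by move=> x; apply/asboolP; exists 1; rewrite ?mset1 // subrr mulr0. Qed.

Lemma freq_imp x y : freq x y -> freq y x.
Proof.
move=> /asboolP [u hu e]; apply/asboolP; exists u => //.
by rewrite -opprB mulrN e oppr0.
Qed.

Lemma freq_sym : ssrbool.symmetric freq.
Proof. by move=> x y; apply/idP/idP; apply: freq_imp. Qed.

Lemma freq_trans : transitive freq.
Proof.
move=> y x z /asboolP [u hu e] /asboolP [v hv f]; apply/asboolP.
exists (de y * (u * v)); first by apply: msetM; [apply: deP|apply: msetM].
have -> : de y * (u * v) * (nu x * de z - nu z * de x) =
  (u * (nu x * de y - nu y * de x)) * (v * de z)
  + (v * (nu y * de z - nu z * de y)) * (u * de x) by ring.
by rewrite e f !mul0r addr0.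
Qed.

Canonical freq_equiv := EquivRel freq freq_refl freq_sym freq_trans.
Definition loc := {eq_quot freq}.
HB.instance Definition _ := Choice.on loc.
HB.instance Definition _ : EqQuotient _ freq loc := EqQuotient.on loc.

Definition addf x y : frac :=
  mkfrac (nu x * de y + nu y * de x) (msetM (deP x) (deP y)).
Definition mulf x y : frac := mkfrac (nu x * nu y) (msetM (deP x) (deP y)).
Definition oppf x : frac := mkfrac (- nu x) (deP x).

Lemma loc_eqP x y : reflect
  (exists2 u, u \in mset S & u * (nu x * de y - nu y * de x) = 0)
  (\pi_loc x == \pi_loc y).
Proof. by rewrite piE; apply: asboolP. Qed.

Lemma loc_eqE x y : nu x * de y = nu y * de x -> \pi_loc x = \pi_loc y.
Proof.
by move=> e; apply/eqP/loc_eqP; exists 1; rewrite ?mset1 // e subrr mulr0.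
Qed.

Lemma loc_repr x : exists2 u, u \in mset S &
  u * (nu x * de (repr (\pi_loc x)) - nu (repr (\pi_loc x)) * de x) = 0.
Proof. by apply/loc_eqP; rewrite reprK. Qed.

Definition loc_zero : loc := \pi_loc (mkfrac 0 (mset1 S)).
Definition loc_one : loc := \pi_loc (mkfrac 1 (mset1 S)).
Definition loc_add := lift_op2 loc addf.
Definition loc_mul := lift_op2 loc mulf.
Definition loc_opp := lift_op1 loc oppf.

Lemma pi_addl : {morph \pi_loc : x y / addf x y >-> loc_add x y}.
Proof.
move=> x y; unlock loc_add; apply/eqP/loc_eqP.
have [u hu e] := loc_repr x; have [v hv f] := loc_repr y.
exists (u * v); first exact: msetM.
move: e f; set x' := repr _; set y' := repr _ => e f.
rewrite /addf /nu /de /mkfrac /= -/(nu _) -/(nu _) -/(nu _) -/(nu _)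
  -/(de _) -/(de _) -/(de _) -/(de _).
transitivity (u * (nu x * de x' - nu x' * de x) * (v * de y * de y') +
  v * (nu y * de y' - nu y' * de y) * (u * de x * de x')); first by ring.
by rewrite e f !mul0r addr0.
Qed.

Lemma pi_mull : {morph \pi_loc : x y / mulf x y >-> loc_mul x y}.
Proof.
move=> x y; unlock loc_mul; apply/eqP/loc_eqP.
have [u hu e] := loc_repr x; have [v hv f] := loc_repr y.
exists (u * v); first exact: msetM.
move: e f; set x' := repr _; set y' := repr _ => e f.
rewrite /mulf /nu /de /mkfrac /= -/(nu _) -/(nu _) -/(nu _) -/(nu _)
  -/(de _) -/(de _) -/(de _) -/(de _).
transitivity (u * (nu x * de x' - nu x' * de x) * (v * nu y * de y') +
  v * (nu y * de y' - nu y' * de y) * (u * de x * nu x')); first by ring.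
by rewrite e f !mul0r addr0.
Qed.

Lemma pi_oppl : {morph \pi_loc : x / oppf x >-> loc_opp x}.
Proof.
move=> x; unlock loc_opp; apply/eqP/loc_eqP.
have [u hu e] := loc_repr x; exists u => //.
move: e; set x' := repr _ => e.
rewrite /oppf /nu /de /mkfrac /= -/(nu _) -/(nu _) -/(de _) -/(de _).
by rewrite -[RHS]oppr0 -e; ring.
Qed.

Lemma locP (a : loc) : exists x, a = \pi_loc x.
Proof. by exists (repr a); rewrite reprK. Qed.

Ltac loc_ring :=
  apply: loc_eqE; rewrite /addf /mulf /oppf /nu /de /mkfrac /=; ring.

Lemma loc_addA : associative loc_add.
Proof.
move=> a b c; have [[x ->] [y ->] [z ->]] := And3 (locP a) (locP b) (locP c).
by rewrite -!pi_addl; loc_ring.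
Qed.
Lemma loc_addC : commutative loc_add.
Proof.
move=> a b; have [[x ->] [y ->]] := conj (locP a) (locP b).
by rewrite -!pi_addl; loc_ring.
Qed.
Lemma loc_add0 : left_id loc_zero loc_add.
Proof. by move=> a; have [x ->] := locP a; rewrite -pi_addl; loc_ring. Qed.
Lemma loc_addN : left_inverse loc_zero loc_opp loc_add.
Proof.
by move=> a; have [x ->] := locP a; rewrite -pi_oppl -pi_addl; loc_ring.
Qed.
Lemma loc_mulA : associative loc_mul.
Proof.
move=> a b c; have [[x ->] [y ->] [z ->]] := And3 (locP a) (locP b) (locP c).
by rewrite -!pi_mull; loc_ring.
Qed.
Lemma loc_mulC : commutative loc_mul.
Proof.
move=> a b; have [[x ->] [y ->]] := conj (locP a) (locP b).
by rewrite -!pi_mull; loc_ring.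
Qed.
Lemma loc_mul1 : left_id loc_one loc_mul.
Proof. by move=> a; have [x ->] := locP a; rewrite -pi_mull; loc_ring. Qed.
Lemma loc_mulDl : left_distributive loc_mul loc_add.
Proof.
move=> a b c; have [[x ->] [y ->] [z ->]] := And3 (locP a) (locP b) (locP c).
by rewrite -!(pi_mull, pi_addl); loc_ring.
Qed.
Lemma loc_nz : loc_one != loc_zero.
Proof.
apply/loc_eqP => -[u hu]; rewrite /nu /de /mkfrac /= mulr1 mul0r subr0 mulr1.
by move=> u0; move: hu; rewrite u0 (negPf (mset0 S)).
Qed.

HB.instance Definition _ :=
  GRing.isZmodule.Build loc loc_addA loc_addC loc_add0 loc_addN.
HB.instance Definition _ := GRing.Zmodule_isComNzRing.Build loc
  loc_mulA loc_mulC loc_mul1 loc_mulDl loc_nz.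

Definition loc_unit : {pred loc} := fun a => `[< exists b, b * a = 1 >].
Definition loc_inv (a : loc) : loc :=
  if pselect (exists b, b * a = 1) is left h then projT1 (cid h) else a.

Fact loc_mulVx : {in loc_unit, left_inverse 1 loc_inv *%R}.
Proof.
by move=> a /asboolP h; rewrite /loc_inv; case: pselect => // h'; case: cid.
Qed.
Fact loc_unitPl a b : b * a = 1 -> loc_unit a.
Proof. by move=> h; apply/asboolP; exists b. Qed.
Fact loc_invr_out : {in [predC loc_unit], loc_inv =1 id}.
Proof.
by move=> a /asboolPn h; rewrite /loc_inv; case: pselect.
Qed.
HB.instance Definition _ := GRing.ComNzRing_hasMulInverse.Build loc
  loc_mulVx loc_unitPl loc_invr_out.

Definition toloc (a : A) : loc := \pi_loc (mkfrac a (mset1 S)).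

Fact toloc_is_zmod_morphism : zmod_morphism toloc.
Proof.
move=> a b; apply/esym.
rewrite -[LHS]/(loc_add (toloc a) (loc_opp (toloc b))) -pi_oppl -pi_addl.
by loc_ring.
Qed.
Fact toloc_is_monoid_morphism : monoid_morphism toloc.
Proof.
split=> // a b; apply/esym.
by rewrite -[LHS]/(loc_mul (toloc a) (toloc b)) -pi_mull; loc_ring.
Qed.
HB.instance Definition _ :=
  GRing.isZmodMorphism.Build A loc toloc toloc_is_zmod_morphism.
HB.instance Definition _ :=
  GRing.isMonoidMorphism.Build A loc toloc toloc_is_monoid_morphism.

Lemma toloc_unit (s : A) : s \in mset S -> toloc s \is a GRing.unit.
Proof.
move=> hs; apply/asboolP; exists (\pi_loc (mkfrac 1 hs)).
rewrite -[LHS]/(loc_mul (\pi_loc (mkfrac 1 hs)) (toloc s)) -pi_mull.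
by loc_ring.
Qed.

End Loc.

Section PrimeCompl.
Variables (A : comNzRingType) (M : prime_idealr A).
Definition compl_prime : {pred A} := [pred a | a \notin M].
Fact compl_prime1 : 1 \in compl_prime. Proof. by rewrite inE idealr1. Qed.
Fact compl_primeM a b :
  a \in compl_prime -> b \in compl_prime -> a * b \in compl_prime.
Proof. by rewrite !inE prime_idealrM negb_or => -> ->. Qed.
Fact compl_prime0 : 0 \notin compl_prime.
Proof. by rewrite inE negbK rpred0. Qed.
Definition prime_mulset := MulSet compl_prime1 compl_primeM compl_prime0.
End PrimeCompl.

Definition noetherian (A : comNzRingType) : Prop :=
  forall J : A -> Prop, is_ideal J -> exists s, forall a, J a <-> idgen s a.

Definition maximal_ideal (A : comNzRingType) (M : idealr A) : Prop :=
  forall J : idealr A, {subset M <= J} -> {subset J <= M}.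

(* A local ring [B] is Gorenstein if it is Cohen-Macaulay of type one: some
   sequence of non-units is regular, generates an ideal primary to the maximal
   ideal (the set of non-units), and the socle of the quotient has dimension
   one over the residue field. *)
Definition regular_seq (B : comNzRingType) (s : seq B) : Prop :=
  (forall x, x \in s -> nonunit x) /\
  forall i b, (i < size s)%N -> idgen (take i s) (s`_i * b) ->
    idgen (take i s) b.

Definition gorenstein_local (B : comNzRingType) : Prop :=
  exists s : seq B,
    let soc w := forall y, nonunit y -> idgen s (y * w) in
    [/\ regular_seq s,
        forall y, nonunit y -> exists k, idgen s (y ^+ k) &
        exists z, [/\ soc z, ~ idgen s z &
          forall w, soc w -> exists a, idgen s (w - a * z)]].

Definition gorenstein (A : comNzRingType) : Prop :=
  noetherian A /\
  forall M : prime_idealr A, maximal_ideal M ->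
    gorenstein_local (loc (prime_mulset M)).

Section Scheme.
Variables (K : fieldType) (n : nat).
Local Notation P := {mpoly K[n.+1]}.
Variable I : idealr P.

Definition homogeneous_ideal : Prop :=
  forall f d, f \in I -> pihomog mdeg d f \in I.

Definition saturated : Prop :=
  forall f k, (forall m : 'X_{1..n.+1}, mdeg m = k -> 'X_[m] * f \in I) ->
    f \in I.

Definition coord_ring := Quotient.quot I.
HB.instance Definition _ := GRing.ComNzRing.on coord_ring.
Local Notation R := coord_ring.

Definition cls (f : P) : R := \pi_(Quotient.quot I) f.
Definition coordC (c : K) : R := cls c%:MP.
Definition coordX (i : 'I_n.+1) : R := cls 'X_i.
Definition x0 : R := coordX ord0.

Definition coord_deg (d : int) (f : R) : Prop :=
  if d is Posz k then exists2 g, g \is k.-homog & f = cls g else f = 0.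

Definition irrelevant (f : R) : Prop :=
  exists a : 'I_n.+1 -> R, f = \sum_i a i * coordX i.

(* The points of X = Proj R are the homogeneous primes of R not containing the
   ideal generated by the classes of the variables. *)
Definition point (p : prime_idealr R) : Prop :=
  (forall f d, cls f \in p -> cls (pihomog mdeg d f) \in p) /\
  (exists2 f, irrelevant f & f \notin p).

Definition closed_point (p : prime_idealr R) : Prop :=
  point p /\
  forall q : prime_idealr R, point q -> {subset p <= q} -> {subset q <= p}.

(* The topological space of X is nonempty and has Krull dimension zero. *)
Definition zero_dimensional : Prop :=
  (exists p, point p) /\
  forall p q : prime_idealr R, point p -> point q ->
    {subset p <= q} -> {subset q <= p}.

Lemma coord_deg_sub d f g :
  coord_deg d f -> coord_deg d g -> coord_deg d (f - g).
Proof.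
case: d => [d|d] /=; last by move=> -> ->; rewrite subr0.
move=> [a ha ->] [b hb ->]; exists (a - b); first by rewrite rpredB.
by rewrite /cls rmorphB.
Qed.

Lemma coord_degM (d e : nat) f g :
  coord_deg d f -> coord_deg e g -> coord_deg (d + e)%N (f * g).
Proof.
move=> [a ha ->] [b hb ->]; exists (a * b); first exact: dhomogM.
by rewrite /cls rmorphM.
Qed.

Lemma coord_deg1 : coord_deg 0 1.
Proof. by exists 1; [exact: dhomog1|rewrite /cls rmorph1]. Qed.

Lemma coord_degC c : coord_deg 0 (coordC c).
Proof.
exists c%:MP => //; rewrite -[c%:MP]mulr1 mul_mpolyC.
by apply/dhomogZ/dhomog1.
Qed.

Lemma coord_deg0 d : coord_deg d 0.
Proof. by case: d => [d|] //=; exists 0; rewrite ?dhomog0 /cls ?rmorph0. Qed.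

Definition homogeneous (f : R) : Prop := exists d : nat, coord_deg d f.

Lemma homogeneous1 : homogeneous 1. Proof. exists 0%N; exact: coord_deg1. Qed.
Lemma homogeneousM f g : homogeneous f -> homogeneous g -> homogeneous (f * g).
Proof. by move=> [d hd] [e he]; exists (d + e)%N; apply: coord_degM. Qed.

Section Stalk.
Variable p : prime_idealr R.

Definition hcompl : {pred R} := fun f => `[< homogeneous f /\ f \notin p >].
Fact hcompl1 : 1 \in hcompl.
Proof. by apply/asboolP; split; [exact: homogeneous1|rewrite idealr1]. Qed.
Fact hcomplM f g : f \in hcompl -> g \in hcompl -> f * g \in hcompl.
Proof.
move=> /asboolP [hf pf] /asboolP [hg pg]; apply/asboolP; split.
  exact: homogeneousM.
by rewrite prime_idealrM negb_or pf.
Qed.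
Fact hcompl0 : 0 \notin hcompl.
Proof. by apply/asboolPn => -[_]; rewrite rpred0. Qed.
Definition hcompl_mulset := MulSet hcompl1 hcomplM hcompl0.

(* The local ring of X at p is the degree-zero part [stalk] of [hloc]. *)
Definition hloc := loc hcompl_mulset.
HB.instance Definition _ := GRing.ComUnitRing.on hloc.

Definition stalk_pred : {pred hloc} := fun a =>
  `[< exists (d : nat) f g, [/\ coord_deg d f, coord_deg d g, g \in hcompl &
        a = toloc hcompl_mulset f / toloc hcompl_mulset g] >].

Fact stalk_subring : subring_closed stalk_pred.
Proof.
split.
- apply/asboolP; exists 0%N, 1, 1; split; rewrite ?hcompl1 //.
  + exact: coord_deg1.
  + exact: coord_deg1.
  by rewrite rmorph1 divr1.
- move=> _ _ /asboolP [d [f [g [hf hg sg ->]]]]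
    /asboolP [e [h [k [hh hk sk ->]]]]; apply/asboolP.
  exists (d + e)%N, (f * k - h * g), (g * k); split.
  + by apply: coord_deg_sub; [|rewrite addnC]; apply: coord_degM.
  + exact: coord_degM.
  + exact: hcomplM.
  have ug := toloc_unit (S := hcompl_mulset) sg.
  have uk := toloc_unit (S := hcompl_mulset) sk.
  rewrite rmorphB !rmorphM /= invrM // mulrBl; congr (_ - _).
    by rewrite mulrA mulrK.
  by rewrite [X in _ = _ * X]mulrC mulrA mulrK.
- move=> _ _ /asboolP [d [f [g [hf hg sg ->]]]]
    /asboolP [e [h [k [hh hk sk ->]]]]; apply/asboolP.
  exists (d + e)%N, (f * h), (g * k); split.
  + exact: coord_degM.
  + exact: coord_degM.
  + exact: hcomplM.
  have ug := toloc_unit (S := hcompl_mulset) sg.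
  have uk := toloc_unit (S := hcompl_mulset) sk.
  by rewrite !rmorphM /= invrM // [X in _ = _ * X]mulrC mulrACA.
Qed.
HB.instance Definition _ :=
  GRing.isSubringClosed.Build hloc stalk_pred stalk_subring.

Record stalk := Stalk { stalk_val :> hloc; _ : stalk_val \in stalk_pred }.
HB.instance Definition _ := [isSub for stalk_val].
HB.instance Definition _ := [Choice of stalk by <:].
HB.instance Definition _ := [SubChoice_isSubComNzRing of stalk by <:].

Fact stalkC_subproof c : toloc hcompl_mulset (coordC c) \in stalk_pred.
Proof.
apply/asboolP; exists 0%N, (coordC c), 1; split; rewrite ?hcompl1 //.
- exact: coord_degC.
- exact: coord_deg1.
by rewrite rmorph1 divr1.
Qed.
Definition stalkC (c : K) : stalk := Stalk (stalkC_subproof c).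

(* The germ f / x_0^i of f in R_i (for p off the hyperplane X_0 = 0). *)
Definition germ (i : nat) (f : R) : hloc :=
  toloc hcompl_mulset f / toloc hcompl_mulset x0 ^+ i.

End Stalk.
End Scheme.

(* [e] maps to a K-basis of V/W, where W <= V are K-subspaces of B and
   [h : K -> B] is the structure map. *)
Definition basis_mod (K : fieldType) (B : comNzRingType) (h : K -> B)
    (V W : B -> Prop) (d : nat) (e : 'I_d -> B) : Prop :=
  (forall k, V (e k)) /\
  forall v, V v -> exists! c : {ffun 'I_d -> K}, W (v - \sum_k h (c k) * e k).

(* dim_K (V/W), and 0 if it is infinite. *)
Definition dimK (K : fieldType) (B : comNzRingType) (h : K -> B)
    (V W : B -> Prop) : nat :=
  minnat (fun d => exists e : 'I_d -> B, basis_mod h V W e).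

Section GradedHom.
(* [B] is graded by [deg], and [L] is a graded subring of [B]. *)
Variables (B : comNzRingType) (deg : int -> B -> Prop) (L : B -> Prop).

Definition linear_into (phi : B -> B) : Prop :=
  (forall b, L (phi b)) /\
  forall a b b', L a -> phi (a * b + b') = a * phi b + phi b'.

Definition hom_deg (i : int) (phi : B -> B) : Prop :=
  linear_into phi /\ forall k b, deg k b -> deg (k + i) (phi b).

(* The graded module of L-linear maps B -> L: the finite sums of homogeneous
   ones. *)
Definition graded_hom (phi : B -> B) : Prop :=
  exists (m : nat) (d : 'I_m -> int) (psi : 'I_m -> B -> B),
    (forall k, hom_deg (d k) (psi k)) /\ forall b, phi b = \sum_k psi k b.
End GradedHom.

Section Different.
Variables (K : fieldType) (n : nat) (I : idealr {mpoly K[n.+1]}).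
Local Notation R := (coord_ring I).

Definition HF (i : int) : nat :=
  dimK (@coordC K n I) (@coord_deg K n I i) (eq 0).

Definition hnzd : {pred R} :=
  fun f => `[< homogeneous f /\ forall g, f * g = 0 -> g = 0 >].
Fact hnzd1 : 1 \in hnzd.
Proof.
by apply/asboolP; split; [exact: homogeneous1|move=> g; rewrite mul1r].
Qed.
Fact hnzdM f g : f \in hnzd -> g \in hnzd -> f * g \in hnzd.
Proof.
move=> /asboolP [hf zf] /asboolP [hg zg]; apply/asboolP; split.
  exact: homogeneousM.
by move=> h; rewrite -mulrA => /zf /zg.
Qed.
Fact hnzd0 : 0 \notin hnzd.
Proof.
by apply/asboolPn => -[_ /(_ 1)]; rewrite mul0r => /(_ erefl) /eqP; rewrite oner_eq0.
Qed.
Definition hnzd_mulset := MulSet hnzd1 hnzdM hnzd0.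

Definition Qh := loc hnzd_mulset.
HB.instance Definition _ := GRing.ComUnitRing.on Qh.
Definition toQ (f : R) : Qh := toloc hnzd_mulset f.
Definition QC (c : K) : Qh := toQ (coordC I c).
Definition Qx : Qh := toQ (x0 I).

Definition Q_deg (i : int) (q : Qh) : Prop :=
  exists (d : nat) (f g : R), [/\ coord_deg (i + d%:Z) f, coord_deg d g,
    g \in hnzd & q = toQ f / toQ g].

(* K[x_0] and L_0 = K[x_0, x_0^-1] as subrings of R and Q^h(R). *)
Definition Kx0 (f : R) : Prop :=
  exists (m : nat) (c : nat -> K), f = \sum_(k < m) coordC I (c k) * x0 I ^+ k.
Definition L0 (q : Qh) : Prop :=
  exists (k : nat) (f : R), Kx0 f /\ q = toQ f / Qx ^+ k.

(* Homogeneous trace maps of degree zero: maps of degree zero forming a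
   Q^h(R)-basis of the graded module of L_0-linear maps Q^h(R) -> L_0, on which
   [g] acts by [(g phi)(q) = phi (g q)]. *)
Definition trace_map (sigma : Qh -> Qh) : Prop :=
  hom_deg Q_deg L0 0 sigma /\
  forall phi, graded_hom Q_deg L0 phi ->
    exists! g, forall q, phi q = sigma (g * q).

Section Sigma.
Variable sigma : Qh -> Qh.

(* [g] lies in it iff [g sigma] is the extension [phi (x) id] of some [phi] from
   R to R (x) L_0 = Q^h(R). *)
Definition complementary_module (g : Qh) : Prop :=
  exists2 phi : R -> R, graded_hom (@coord_deg K n I) Kx0 phi &
    forall f k, sigma (g * (toQ f / Qx ^+ k)) = toQ (phi f) / Qx ^+ k.

Definition different (f : Qh) : Prop :=
  forall c, complementary_module c -> exists b, f * c = toQ b.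

Definition HF_different (i : int) : nat :=
  dimK QC (fun f => Q_deg i f /\ different f) (eq 0).

(* An exact sequence 0 -> R -> C(-r) -> C' -> 0 of graded R-modules with
   m C' = 0 amounts to an injective graded map [psi : R -> C(-r)] whose
   cokernel is annihilated by m. *)
Definition almost_gorenstein (r : int) : Prop :=
  exists psi : R -> Qh,
  [/\ forall a f g, psi (a * f + g) = toQ a * psi f + psi g,
      forall f, complementary_module (psi f),
      forall i f, coord_deg i f -> Q_deg (i - r) (psi f),
      injective psi &
      forall a c, irrelevant a -> complementary_module c ->
        exists f, toQ a * c = psi f].
End Sigma.
End Different.

Section CayleyBacharach.
Variables (K : fieldType) (n : nat) (I : idealr {mpoly K[n.+1]}).
Variables (s : nat) (p : 'I_s -> prime_idealr (coord_ring I)).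

Definition enumerates_support : Prop :=
  [/\ forall j, closed_point (p j),
      forall j k, p j =i p k -> j = k &
      forall q : prime_idealr (coord_ring I), closed_point q ->
        exists j, q =i p j].

Local Notation O j := (stalk (p j)).

(* dim_K (O_j / J), with [J] possibly the unit ideal. *)
Definition colength (j : 'I_s) (J : O j -> Prop) : nat :=
  dimK (@stalkC K n I (p j)) (fun _ => True) J.

Definition degX : nat := \sum_j colength (eq (0%R : O j)).
Definition residue_deg (j : 'I_s) : nat := colength (@nonunit (O j)).

Definition regularity_index (r : int) : Prop :=
  (forall i, r <= i -> HF I i = degX) /\
  forall r', (forall i, r' <= i -> HF I i = degX) -> r <= r'.

Definition locally_gorenstein : Prop := forall j, gorenstein (O j).

(* The least i such that (0, ..., a T_j^i, ..., 0) is the family of germs of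
   some f in R_i. *)
Definition mu (j : 'I_s) (a : O j) : nat :=
  minnat (fun i => exists f : coord_ring I, [/\ coord_deg i f,
    germ (p j) i f = stalk_val a &
    forall k, k != j -> germ (p k) i f = 0]).

(* X is finite and discrete, so that a closed subscheme Y of X is a family [J]
   of ideals of the local rings, with O_(Y,p_k) = O_(X,p_k) / J_k. *)
Definition subscheme := forall k, O k -> Prop.

Definition point_subscheme (j : 'I_s) (J : subscheme) : Prop :=
  (forall k, is_ideal (@J k)) /\ forall k, k != j -> forall a, J k a -> a = 0.

Definition deg_subscheme (J : subscheme) : nat := \sum_k colength (@J k).

Definition maximal_point_subscheme (j : 'I_s) (J : subscheme) : Prop :=
  point_subscheme j J /\ (deg_subscheme J + residue_deg j)%N = degX.

(* [m = mu_(Y/X)]: [z] is a socle element generating the ideal of Y at p_j, and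
   [e] lifts a K-basis of the residue field. *)
Definition mu_subscheme (j : 'I_s) (J : subscheme) (m : nat) : Prop :=
  exists (z : O j) (d : nat) (e : 'I_d -> O j),
    [/\ z <> 0 /\ forall a, nonunit a -> a * z = 0,
        forall b, J j b <-> exists a, b = a * z,
        basis_mod (@stalkC K n I (p j)) (fun _ => True) (@nonunit (O j)) e &
        m = \max_k mu (e k * z)%R].

Definition deg_point (j : 'I_s) : nat :=
  minnat (fun m => exists J,
    maximal_point_subscheme j J /\ mu_subscheme j J m).

Definition cayley_bacharach (r : int) : Prop :=
  forall j, (deg_point j)%:Z = r.
End CayleyBacharach.

(* Main.v *)
(* For a zero-dimensional scheme every homogeneous ideal contained in no point
   contains all forms of large degree; hence x0 is a non-zerodivisor, every
   element of Q^h(R) has a power of x0 as denominator, and R_i = x0 R_(i-1) for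
   i > r.

   Let C be the complementary module; it vanishes below degree -r.  The
   Cayley-Bacharach property provides a unit g of Q^h(R) in C_(-r): if all of
   C_(-r) had non-unit germs at p_j, it would annihilate every multiple of a
   socle element z of the local ring at p_j; by double duality the liftings of
   these multiples to R_r would be divisible by x0, so that the maximal
   p_j-subscheme defined by z would have degree less than r.  As K is infinite,
   C_(-r) is not the union of the subspaces of elements with a non-unit germ at
   some p_j.

   Since g delta is contained in R, multiplication by g embeds delta_i into
   R_(i-r); this is the inequality.  Equality in degree r gives C = g R, and
   equality in degree r + 1 gives m C <= g R, i.e. the almost Gorenstein
   sequence; conversely the image h of 1 in such a sequence gives
   h^-1 R_1 <= delta_(r+1).

   If C = g R, then g sigma is a self-dual K[x0]-valued trace form on R; a
   maximal ideal M contains some P(x0) <> 0, and modulo P(x0) the form becomes a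
   nondegenerate K-bilinear one, so the socle of R_M / P(x0) is one-dimensional.
   If R is Gorenstein, the socle of R / x0 R is one-dimensional, because the type
   does not depend on the regular parameter; it is concentrated in degree r, and
   g sigma does not vanish on it, from which C = g R follows by successively
   dividing by x0. *)

From HB Require Import structures.
Require Import Defs.
From mathcomp Require Import all_boot all_order all_algebra.
From mathcomp Require Import generic_quotient ring_quotient boolp classical_sets.
From mathcomp Require Import mpoly ring zify.
Set Implicit Arguments.
Unset Strict Implicit.
Unset Printing Implicit Defensive.
Import GRing.Theory.
Local Open Scope ring_scope.

(** * Linear algebra of [basis_mod] *)

(** [gorenstein] speaks of all maximal ideals of R, homogeneous or not, which is why polynomials
    P(x0) other than powers of x0 enter: f / P(x0) is in general not an element of Q^h(R), so C = g
    R cannot be applied to it directly and divisibility by P(x0) is obtained from divisibility by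
    powers of x0 through leading terms. In the other direction [gorenstein_local] supplies an
    unknown regular sequence; the regularity of x0 and a socle element modulo x0 force it to have
    length one.

    Dimension theory and primary decomposition are replaced by linear dependence: the powers of an
    element, placed in a finite-dimensional space, satisfy a relation, and the cofactor of the
    lowest power occurring in it lies outside the given prime. So each point is nilpotent in its own
    local ring, which yields forms whose germs vanish at all points but one.

    The exponent 2r appears because x0^(2r) g has degree r when g has degree -r, and Q^h(R) and R
    agree in degree r. *)

Lemma minnat_le (P : nat -> Prop) m : P m -> (minnat P <= m)%N.
Proof.
move=> Pm; rewrite /minnat; case: pselect => // h.
by case: ex_minnP => k _; apply; apply/asboolP.
Qed.

Lemma minnatP (P : nat -> Prop) m : P m -> P (minnat P).
Proof.
move=> Pm; rewrite /minnat; case: pselect => [h|[]].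
  by case: ex_minnP => k /asboolP.
by exists m; apply/asboolP.
Qed.

Section LinearAlgebra.
Variables (K : fieldType) (B : comNzRingType) (h : {rmorphism K -> B}).
Implicit Types V W : B -> Prop.

Definition subspace W := W 0 /\ forall c a b, W a -> W b -> W (h c * a + b).

Definition comb d (e : 'I_d -> B) (c : 'I_d -> K) := \sum_k h (c k) * e k.

Definition indep W d (e : 'I_d -> B) :=
  forall c : 'I_d -> K, W (comb e c) -> forall k, c k = 0.

Definition spans V W d (e : 'I_d -> B) :=
  forall v, V v -> exists c : 'I_d -> K, W (v - comb e c).

Definition fin_span V W := exists d (e : 'I_d -> B), spans V W e.

Lemma subspaceD W a b : subspace W -> W a -> W b -> W (a + b).
Proof. by move=> [_ hW] ha hb; have := hW 1 _ _ ha hb; rewrite rmorph1 mul1r. Qed.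

Lemma subspaceZ W c a : subspace W -> W a -> W (h c * a).
Proof. by move=> [h0 hW] ha; have := hW c _ _ ha h0; rewrite addr0. Qed.

Lemma subspaceN W a : subspace W -> W a -> W (- a).
Proof.
by move=> sW ha; rewrite -mulN1r -(rmorph1 h) -rmorphN; apply: subspaceZ.
Qed.

Lemma subspaceB W a b : subspace W -> W a -> W b -> W (a - b).
Proof. by move=> sW ha hb; apply: subspaceD => //; apply: subspaceN. Qed.

Lemma subspace_sum W (T : Type) (r : seq T) (P : pred T) (F : T -> B) :
  subspace W -> (forall i, P i -> W (F i)) -> W (\sum_(i <- r | P i) F i).
Proof.
move=> sW hF; elim/big_ind: _ => //; first by case: sW.
by move=> a b; apply: subspaceD.
Qed.

Lemma subspace_comb W d (e : 'I_d -> B) c :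
  subspace W -> (forall k, W (e k)) -> W (comb e c).
Proof. by move=> sW he; apply: subspace_sum => // i _; apply: subspaceZ. Qed.

Lemma subspace0 : subspace (eq 0).
Proof. by split=> // c a b <- <-; rewrite mulr0 addr0. Qed.

Lemma combD d (e : 'I_d -> B) c c' :
  comb e (fun k => c k + c' k) = comb e c + comb e c'.
Proof. by rewrite -big_split; apply: eq_bigr => k _; rewrite rmorphD mulrDl. Qed.

Lemma combZ d (e : 'I_d -> B) a c : comb e (fun k => a * c k) = h a * comb e c.
Proof. by rewrite mulr_sumr; apply: eq_bigr => k _; rewrite rmorphM mulrA. Qed.

Lemma combB d (e : 'I_d -> B) c c' :
  comb e (fun k => c k - c' k) = comb e c - comb e c'.
Proof.
by rewrite -sumrB; apply: eq_bigr => k _; rewrite rmorphB mulrBl.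
Qed.

Lemma steinitz V W m (e : 'I_m -> B) d (f : 'I_d -> B) : subspace W ->
  spans V W e -> (forall k, V (f k)) -> indep W f -> (d <= m)%N.
Proof.
move=> sW se Vf If; rewrite leqNgt; apply/negP => lt_md.
have /choice [c hc] : forall k, exists c : 'I_m -> K, W (f k - comb e c).
  by move=> k; apply: se.
pose A := \matrix_(k < d, i < m) c k i.
(* [A] has more rows than columns; a non-zero row vector killed by it is a forbidden dependence of
   [f] modulo [W]. *)
have : kermx A != 0.
  rewrite kermx_eq0 /row_free neq_ltn (leq_ltn_trans _ lt_md) //.
  exact: rank_leq_col.
move=> /rowV0Pn [u /sub_kermxP uA u0].
have /If : W (comb f (fun k => u 0 k)).
  have -> : comb f (fun k => u 0 k)
      = \sum_k h (u 0 k) * (f k - comb e (c k)).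
    rewrite (eq_bigr (fun k => h (u 0 k) * f k - h (u 0 k) * comb e (c k)));
      last by move=> k _; rewrite mulrBr.
    rewrite sumrB [X in _ - X](_ : _ = 0) ?subr0 // /comb.
    under eq_bigr do rewrite mulr_sumr.
    rewrite exchange_big big1 //= => i _.
    have := congr1 (fun M : 'rV_m => M 0 i) uA; rewrite !mxE => hi.
    transitivity (h (\sum_k u 0 k * A k i) * e i).
      rewrite rmorph_sum mulr_suml; apply: eq_bigr => k _.
      by rewrite rmorphM mulrA mxE.
    by rewrite hi rmorph0 mul0r.
  by apply: subspace_sum => // k _; apply: subspaceZ.
move=> u00; case/negP: u0; apply/eqP/rowP => k; rewrite mxE; exact: u00.
Qed.

Lemma basis_modP V W d (e : 'I_d -> B) : V 0 -> subspace W ->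
  basis_mod h V W e <-> [/\ forall k, V (e k), indep W e & spans V W e].
Proof.
move=> V0 sW; split; last first.
  move=> [Ve Ie Se]; split=> // v /Se [c hc]; exists (finfun c); split.
    by rewrite (_ : \sum_k _ = comb e c) //; apply: eq_bigr => k _; rewrite ffunE.
  move=> c' hc'; apply/ffunP => k; rewrite ffunE; apply/eqP.
  rewrite -subr_eq0; apply/eqP; move: k.
  apply: (Ie (fun k => c k - c' k)); rewrite combB.
  rewrite (_ : _ - _ = (v - comb e c') - (v - comb e c)); first exact: subspaceB.
  by ring.
move=> [Ve he]; split=> //; last by move=> v /he [c [hc _]]; exists c.
move=> c Wc k; have [c0 [hc0 uc0]] := he _ V0.
have := uc0 [ffun k => c0 k + c k].
rewrite (_ : \sum_k _ = comb e c0 + comb e c); last first.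
  by rewrite -combD; apply: eq_bigr => i _; rewrite ffunE.
rewrite opprD addrA => /(_ (subspaceB sW hc0 Wc)) /ffunP /(_ k).
rewrite ffunE => /esym/eqP; rewrite -subr_eq0 addrAC subrr add0r.
by move/eqP.
Qed.

Lemma indep_cons W d (e : 'I_d -> B) v : subspace W -> indep W e ->
  (forall c, ~ W (v - comb e c)) ->
  indep W (fun k : 'I_d.+1 => if unlift ord0 k is Some j then e j else v).
Proof.
move=> sW Ie hv c; rewrite /comb big_ord_recl unlift_none.
under eq_bigr do rewrite liftK.
have [c0|c0] := eqVneq (c ord0) 0.
  rewrite c0 rmorph0 mul0r add0r => /Ie hc k.
  by have [j ->|->] := unliftP ord0 k.
move=> Wc; case: (hv (fun k => - ((c ord0)^-1 * c (lift ord0 k)))).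
have := subspaceZ (c ord0)^-1 sW Wc.
rewrite mulrDr mulrA -rmorphM mulVf // rmorph1 mul1r.
congr W; congr (_ + _); rewrite /comb mulr_sumr -sumrN.
by apply: eq_bigr => k _; rewrite rmorphN rmorphM mulNr opprK mulrA.
Qed.

Lemma exists_basis V W m : V 0 -> subspace W ->
  (forall d (f : 'I_d -> B), (forall k, V (f k)) -> indep W f -> (d <= m)%N) ->
  exists d (e : 'I_d -> B), basis_mod h V W e.
Proof.
move=> V0 sW hm.
pose P d := `[< exists f : 'I_d -> B, (forall k, V (f k)) /\ indep W f >].
have P0 : exists d, P d.
  by exists 0%N; apply/asboolP; exists (fun=> 0); split=> [[]|c _ []].
have Pm d : P d -> (d <= m)%N by move=> /asboolP [f [? ?]]; apply: (hm d f).
have [d /asboolP [e [Ve Ie]] dmax] := ex_maxnP P0 Pm.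
exists d, e; apply/basis_modP => //; split=> // v Vv.
apply: contrapT => hv.
suff /dmax : P d.+1 by rewrite ltnn.
apply/asboolP; exists (fun k => if unlift ord0 k is Some j then e j else v).
split; first by move=> k; case: unliftP.
by apply: indep_cons Ie _ => // c Wc; apply: hv; exists c.
Qed.

Lemma fin_span_finType V W (T : finType) (e : T -> B) :
  (forall v, V v -> exists c : T -> K, W (v - \sum_t h (c t) * e t)) ->
  fin_span V W.
Proof.
move=> se; exists #|T|, (fun k => e (enum_val k)) => v /se [c hc].
exists (fun k => c (enum_val k)); congr W: hc; congr (_ - _).
by rewrite /comb -(big_enum_val (A := T) (fun t => h (c t) * e t)).
Qed.

Lemma fin_span_quotient V W : subspace W -> fin_span V (eq 0) -> fin_span V W.
Proof.
move=> sW [m [e se]]; exists m, e => v /se [c hc]; exists c.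
by rewrite -hc; case: sW.
Qed.

Lemma fin_span_basis V W : V 0 -> subspace W -> fin_span V W ->
  exists d (e : 'I_d -> B), basis_mod h V W e.
Proof.
move=> V0 sW [m [e se]]; apply: (@exists_basis V W m) => // d f.
exact: steinitz se.
Qed.

Lemma dimKE V W d (e : 'I_d -> B) : V 0 -> subspace W ->
  basis_mod h V W e -> dimK h V W = d.
Proof.
move=> V0 sW be; rewrite /dimK.
have [f bf] := @minnatP (fun d => exists e : 'I_d -> B, basis_mod h V W e) d
  (ex_intro _ e be).
have [Ve Ie Se] := (basis_modP _ V0 sW).1 be.
have [Vf If Sf] := (basis_modP _ V0 sW).1 bf.
by apply/eqP; rewrite eqn_leq (steinitz sW Se Vf If) (steinitz sW Sf Ve Ie).
Qed.

Lemma fin_span_dim V W : V 0 -> subspace W -> fin_span V W ->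
  exists e : 'I_(dimK h V W) -> B,
    [/\ forall k, V (e k), indep W e & spans V W e].
Proof.
move=> V0 sW fV; have [d [e be]] := fin_span_basis V0 sW fV.
by rewrite (dimKE V0 sW be); exists e; apply/basis_modP.
Qed.

Lemma fin_span_dep V W (e : nat -> B) : subspace W -> fin_span V W ->
  (forall k, V (e k)) -> exists d (c : nat -> K) k,
    [/\ (k < d)%N, c k != 0 & W (\sum_(k < d) h (c k) * e k)].
Proof.
move=> sW [m [f sf]] Ve.
have : ~ indep W (fun k : 'I_m.+1 => e k).
  by move=> /(steinitz sW sf (fun k => Ve k)); rewrite ltnn.
move=> /existsNP [c /not_implyP [Wc /existsNP [k hk]]].
exists m.+1, (fun i => c (inord i)), k; rewrite inord_val; split=> //.
  exact/eqP.
by congr W: Wc; apply: eq_bigr => i _; rewrite inord_val.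
Qed.

(** [l] is a rescaled coordinate with respect to a basis of V modulo W, chosen so that the
    coordinate of [f] is non-zero. It is extended to all of B by arbitrary choices, hence linear on
    V only. *)
Lemma exists_functional V W f : V 0 -> subspace W -> fin_span V W ->
  V f -> ~ W f -> exists l : B -> K,
    [/\ forall c a b, V a -> V b -> V (h c * a + b) ->
          l (h c * a + b) = c * l a + l b,
        forall w, W w -> V w -> l w = 0 & l f = 1].
Proof.
move=> V0 sW fV Vf Wf; have [d [e [Ve he]]] := fin_span_basis V0 sW fV.
have [_ Ie _] := (basis_modP _ V0 sW).1 (conj Ve he).
have /choice [co hco] : forall v, exists c : {ffun 'I_d -> K},
    V v -> W (v - comb e c).
  move=> v; have [/he [c [hc _]]|nV] := pselect (V v); first by exists c.
  by exists [ffun=> 0].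
have uco v c : V v -> W (v - comb e c) -> c =1 co v.
  move=> Vv hc k; apply/eqP; rewrite -subr_eq0; apply/eqP; move: k.
  apply: Ie; rewrite combB.
  rewrite (_ : _ - _ = (v - comb e (co v)) - (v - comb e c)); last by ring.
  by apply: subspaceB => //; apply: hco.
have [k hk] : exists k, co f k != 0.
  apply: contrapT => /forallNP h0; apply: Wf.
  have := hco _ Vf; rewrite /comb big1 ?subr0 // => k _.
  by have /negP := h0 k; rewrite negbK => /eqP ->; rewrite rmorph0 mul0r.
exists (fun v => (co f k)^-1 * co v k); split; last by rewrite mulVf.
- move=> c a b Va Vb Vab.
  rewrite -(uco _ (fun k => c * co a k + co b k) Vab) ?mulrDr 1?mulrCA //.
  rewrite combD combZ (_ : _ - _ = h c * (a - comb e (co a))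
    + (b - comb e (co b))); last by ring.
  by apply: sW.2; apply: hco.
- move=> w Ww Vw; rewrite -(uco _ (fun=> 0) Vw) ?mulr0 //.
  by rewrite /comb big1 ?subr0 // => i _; rewrite rmorph0 mul0r.
Qed.

End LinearAlgebra.

(** * Comparison of dimensions along injective linear maps *)

Section LinearMaps.
Variables (K : fieldType) (B B' : comNzRingType).
Variables (h : {rmorphism K -> B}) (h' : {rmorphism K -> B'}).
Variables (V W : B -> Prop) (V' W' : B' -> Prop) (phi : B -> B').
Hypotheses (sV : subspace h V) (sW : subspace h W) (sV' : subspace h' V')
  (sW' : subspace h' W').
Hypotheses (phiV : forall v, V v -> V' (phi v))
  (phiW : forall v, V v -> W' (phi v) -> W v)
  (phiL : forall c a b, V a -> V b -> phi (h c * a + b) = h' c * phi a + phi b).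
Hypothesis fin_V' : fin_span h' V' W'.

Let phi0 : phi 0 = 0.
Proof.
have := phiL 1 sV.1 sV.1; rewrite !rmorph1 !mul1r addr0 => /esym/eqP.
by rewrite -subr_eq0 addrK => /eqP.
Qed.

Lemma linear_comb d (e : 'I_d -> B) c : (forall k, V (e k)) ->
  phi (comb h e c) = comb h' (fun k => phi (e k)) c.
Proof.
move=> Ve; rewrite /comb.
suff [] : V (\sum_k h (c k) * e k) /\
  phi (\sum_k h (c k) * e k) = \sum_k h' (c k) * phi (e k) by [].
elim/big_rec2: _ => [|k y1 y2 _ [h1 h2]]; first by split=> //; case: sV.
by rewrite phiL // h2; split=> //; apply: sV.2.
Qed.

Lemma linear_indep d (e : 'I_d -> B) : (forall k, V (e k)) ->
  indep h W e -> indep h' W' (fun k => phi (e k)).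
Proof.
move=> Ve Ie c; rewrite -linear_comb // => /phiW hc; apply: Ie; apply: hc.
exact: subspace_comb.
Qed.

Lemma injective_basis : exists d (e : 'I_d -> B), basis_mod h V W e.
Proof.
have [m [e' se]] := fin_V'; apply: (@exists_basis _ _ _ _ _ m) => //.
  by case: sV.
move=> d f Vf /(linear_indep Vf); apply: (steinitz sW' se) => k; exact: phiV.
Qed.

Lemma dimK_le : (dimK h V W <= dimK h' V' W')%N.
Proof.
have [d [e be]] := injective_basis.
have [V0 V0'] := (sV.1, sV'.1).
have [Ve Ie Se] := (basis_modP _ V0 sW).1 be.
have [e' [Ve' Ie' Se']] := fin_span_dim V0' sW' fin_V'.
rewrite (dimKE V0 sW be).
apply: (steinitz sW' Se' _ (linear_indep Ve Ie)) => k; exact: phiV.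
Qed.

(** A vector outside the image could be adjoined to the image of a basis, giving an independent
    family longer than the dimension of the target. *)
Lemma dimK_surj : dimK h V W = dimK h' V' W' ->
  forall v', V' v' -> exists2 v, V v & W' (v' - phi v).
Proof.
move=> eqd v' Vv'; have [d [e be]] := injective_basis.
have [V0 V0'] := (sV.1, sV'.1).
have [Ve Ie Se] := (basis_modP _ V0 sW).1 be.
have [e' [Ve' Ie' Se']] := fin_span_dim V0' sW' fin_V'.
have [c hc] : exists c, W' (v' - comb h' (fun k => phi (e k)) c).
  apply: contrapT => /forallNP hc.
  have := indep_cons sW' (linear_indep Ve Ie) hc.
  move/(steinitz sW' Se'); rewrite -eqd (dimKE V0 sW be) ltnn => C.
  have // : false by apply: C => k; case: unliftP => // j _; apply: phiV.
exists (comb h e c); first exact: subspace_comb.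
by rewrite linear_comb.
Qed.

Lemma dimK_eq : (forall v, V v -> W v -> W' (phi v)) ->
  (forall v', V' v' -> exists2 v, V v & W' (v' - phi v)) ->
  dimK h V W = dimK h' V' W'.
Proof.
move=> phiW' surj; have [d [e be]] := injective_basis.
have [V0 V0'] := (sV.1, sV'.1).
have [Ve Ie Se] := (basis_modP _ V0 sW).1 be.
rewrite (dimKE V0 sW be); apply/esym; apply: (dimKE V0' sW').
apply/(basis_modP (fun k => phi (e k)) V0' sW'); split.
- by move=> k; apply: phiV.
- exact: linear_indep.
move=> v' /surj [v Vv hv]; have [c hc] := Se v Vv; exists c.
have Vc : V (comb h e c) by apply: subspace_comb.
rewrite -linear_comb // (_ : _ - _ = v' - phi v + phi (v - comb h e c)).
  by apply: (subspaceD sW') => //; apply: phiW' => //; apply: subspaceB sV _ _.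
have {1}-> : v = h 1 * (v - comb h e c) + comb h e c by rewrite rmorph1 mul1r subrK.
by rewrite phiL ?rmorph1 ?mul1r //; [ring|apply: subspaceB sV _ _].
Qed.

End LinearMaps.

(* Multiplication by [z] identifies [B / M] with the ideal [J]. *)
Lemma dimK_socle (K : fieldType) (B : comNzRingType) (h : {rmorphism K -> B})
    (M : B -> Prop) (z : B) :
  let T := fun=> True in let J := fun b => exists a, b = a * z in
  subspace h M -> (forall a, a * z = 0 <-> M a) -> fin_span h T (eq 0) ->
  (dimK h T J + dimK h T M)%N = dimK h T (eq 0).
Proof.
move=> T J sM hM fT.
have sJ : subspace h J.
  split; first by exists 0; rewrite mul0r.
  by move=> c _ _ [a ->] [b ->]; exists (h c * a + b); rewrite mulrDl mulrA.
have s0 := subspace0 h.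
have fJ W : subspace h W -> fin_span h T W by move/fin_span_quotient; apply.
have [e [_ Ie Se]] := fin_span_dim (I : T 0) sM (fJ _ sM).
have [f [_ If Sf]] := fin_span_dim (I : T 0) sJ (fJ _ sJ).
pose g (k : 'I_(dimK h T J + dimK h T M)) :=
  match split k with inl i => f i | inr j => e j * z end.
have gE c : comb h g c = comb h f (fun i => c (lshift _ i))
    + comb h e (fun j => c (rshift _ j)) * z.
  rewrite /comb big_split_ord /= mulr_suml; congr (_ + _).
    by apply: eq_bigr => i _; rewrite /g (unsplitK (inl i)).
  by apply: eq_bigr => i _; rewrite /g (unsplitK (inr i)) mulrA.
symmetry; apply: (@dimKE _ _ _ _ _ _ g) => //; apply/basis_modP => //; split=> //.
- move=> c; rewrite gE => hc.
  have c1 : forall i, c (lshift _ i) = 0.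
    apply: If; exists (- comb h e (fun j => c (rshift _ j))).
    by apply/eqP; rewrite mulNr -addr_eq0 -hc.
  have c2 : forall i, c (rshift _ i) = 0.
    apply: Ie; apply/hM; rewrite [RHS]hc [in RHS]/comb big1 ?add0r // => i _.
    by rewrite c1 rmorph0 mul0r.
  by move=> k; rewrite -(splitK k); case: (split k).
- move=> v _; have [c [a ha]] := Sf v I.
  have [b /hM hb] := Se a I.
  exists (fun k => match split k with inl i => c i | inr j => b j end).
  rewrite gE opprD addrA.
  rewrite (_ : comb h f _ = comb h f c); last first.
    by apply: eq_bigr => i _; rewrite (unsplitK (inl i)).
  rewrite ha -mulrBl -[LHS]hb; congr (_ * _); congr (_ - _).
  by apply: eq_bigr => i _; rewrite (unsplitK (inr i)).
Qed.

(** * Ideals and homogeneous components *)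

Section Ideals.
Variable A : comNzRingType.
Implicit Types J : A -> Prop.

Lemma idealM J a b : is_ideal J -> J b -> J (a * b).
Proof. by move=> [J0 hJ] hb; rewrite -[_ * _]addr0; apply: hJ. Qed.

Lemma idealD J a b : is_ideal J -> J a -> J b -> J (a + b).
Proof. by move=> [J0 hJ] ha hb; rewrite -[a]mul1r; apply: hJ. Qed.

Lemma idealN J a : is_ideal J -> J a -> J (- a).
Proof. by move=> hJ ha; rewrite -mulN1r; apply: idealM. Qed.

Lemma idealB J a b : is_ideal J -> J a -> J b -> J (a - b).
Proof. by move=> hJ ha hb; apply: idealD => //; apply: idealN. Qed.

Lemma ideal_sum J (T : Type) (r : seq T) (P : pred T) (F : T -> A) :
  is_ideal J -> (forall i, P i -> J (F i)) -> J (\sum_(i <- r | P i) F i).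
Proof.
move=> hJ hF; elim/big_ind: _ => //; first by case: hJ.
by move=> a b; apply: idealD.
Qed.

Definition principal (a b : A) := exists c, b = a * c.

Lemma principal_ideal a : is_ideal (principal a).
Proof.
split; first by exists 0; rewrite mulr0.
by move=> _ _ c [x ->] [y ->]; exists (c * x + y); ring.
Qed.

Definition addI (J J' : A -> Prop) a := exists b c, [/\ J b, J' c & a = b + c].

Lemma addI_ideal J J' : is_ideal J -> is_ideal J' -> is_ideal (addI J J').
Proof.
move=> [J0 hJ] [J0' hJ']; split; first by exists 0, 0; split; rewrite ?addr0.
move=> _ _ c [a [b [ha hb ->]]] [a' [b' [ha' hb' ->]]].
by exists (c * a + a'), (c * b + b'); split; [apply: hJ|apply: hJ'|ring].
Qed.

Lemma ideal_exists J : is_ideal J -> ~ J 1 ->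
  exists M : idealr A, forall a, (a \in M) <-> J a.
Proof.
move=> hJ J1.
have hi : idealr_closed (fun a => `[< J a >]).
  split; [exact/asboolP/hJ.1|exact/asboolPn|].
  by move=> c a b /asboolP ha /asboolP hb; apply/asboolP; apply: hJ.2.
pose M := isIdealr.Build A (fun a => `[< J a >]) hi.
pose MI : idealr A := HB.pack (fun a => `[< J a >]) M.
by exists MI => a; split=> /asboolP.
Qed.

Lemma prime_exists J : is_ideal J -> ~ J 1 ->
  (forall a b, J (a * b) -> J a \/ J b) ->
  exists M : prime_idealr A, forall a, (a \in M) <-> J a.
Proof.
move=> hJ J1 Jp.
have hi : idealr_closed (fun a => `[< J a >]).
  split; [exact/asboolP/hJ.1|exact/asboolPn|].
  by move=> c a b /asboolP ha /asboolP hb; apply/asboolP; apply: hJ.2.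
have hp : prime_idealr_closed (fun a => `[< J a >]).
  by move=> a b /asboolP /Jp [] h; apply/orP; [left|right]; apply/asboolP.
pose M := isIdealr.Build A (fun a => `[< J a >]) hi.
pose N := isPrimeIdealrClosed.Build A (fun a => `[< J a >]) hp.
pose MI : prime_idealr A := HB.pack (fun a => `[< J a >]) M N.
by exists MI => a; split=> /asboolP.
Qed.

Lemma prime_ideal (M : prime_idealr A) : is_ideal (fun a => a \in M).
Proof.
split; first exact: idealr0.
by move=> a b c ha hb; apply: rpredD => //; apply: idealMr.
Qed.

Lemma prime0 (M : prime_idealr A) : 0 \in M.
Proof. exact: idealr0. Qed.

Lemma prime1 (M : prime_idealr A) : 1 \notin M.
Proof. by rewrite idealr1. Qed.

Lemma primeMr (M : prime_idealr A) a b : b \in M -> a * b \in M.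
Proof. exact: idealMr. Qed.

Lemma primeM (M : prime_idealr A) a b : (a * b \in M) = (a \in M) || (b \in M).
Proof. exact: prime_idealrM. Qed.

Lemma primeX (M : prime_idealr A) a k : a \notin M -> a ^+ k \notin M.
Proof.
move=> ha; elim: k => [|k ih]; first by rewrite expr0 prime1.
by rewrite exprS primeM negb_or ha.
Qed.

End Ideals.

(** * Homogeneous components in the coordinate ring *)

Section CoordRing.
Variables (K : fieldType) (n : nat) (I : idealr {mpoly K[n.+1]}).
Local Notation R := (coord_ring I).

Fact cls_zmod : zmod_morphism (@cls K n I).
Proof. by move=> f g; rewrite /cls rmorphB. Qed.
Fact cls_monoid : monoid_morphism (@cls K n I).
Proof. by split=> [|f g]; rewrite /cls (rmorph1, rmorphM). Qed.
HB.instance Definition _ := GRing.isZmodMorphism.Build _ _ (@cls K n I) cls_zmod.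
HB.instance Definition _ :=
  GRing.isMonoidMorphism.Build _ _ (@cls K n I) cls_monoid.

Fact coordC_zmod : zmod_morphism (@coordC K n I).
Proof. by move=> a b; rewrite /coordC !rmorphB. Qed.
Fact coordC_monoid : monoid_morphism (@coordC K n I).
Proof. by split=> [|a b]; rewrite /coordC !(rmorph1, rmorphM). Qed.
HB.instance Definition _ :=
  GRing.isZmodMorphism.Build K R (@coordC K n I) coordC_zmod.
HB.instance Definition _ :=
  GRing.isMonoidMorphism.Build K R (@coordC K n I) coordC_monoid.

Fact toQ_zmod : zmod_morphism (@toQ K n I).
Proof. by move=> a b; rewrite /toQ rmorphB. Qed.
Fact toQ_monoid : monoid_morphism (@toQ K n I).
Proof. by split=> [|a b]; rewrite /toQ (rmorph1, rmorphM). Qed.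
HB.instance Definition _ :=
  GRing.isZmodMorphism.Build R (Qh I) (@toQ K n I) toQ_zmod.
HB.instance Definition _ :=
  GRing.isMonoidMorphism.Build R (Qh I) (@toQ K n I) toQ_monoid.

Fact QC_zmod : zmod_morphism (@QC K n I).
Proof. by move=> a b; rewrite /QC !rmorphB. Qed.
Fact QC_monoid : monoid_morphism (@QC K n I).
Proof. by split=> [|a b]; rewrite /QC !(rmorph1, rmorphM). Qed.
HB.instance Definition _ :=
  GRing.isZmodMorphism.Build K (Qh I) (@QC K n I) QC_zmod.
HB.instance Definition _ :=
  GRing.isMonoidMorphism.Build K (Qh I) (@QC K n I) QC_monoid.

Lemma cls_repr (f : R) : cls I (repr f) = f.
Proof. exact: reprK. Qed.

Lemma cls_eq0 g : cls I g = 0 <-> g \in I.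
Proof.
rewrite -[g in g \in I]subr0 Quotient.idealrBE; split=> [h|/eqP h].
  by apply/eqP; rewrite -[LHS]/(cls I g) h [RHS](rmorph0 (@cls K n I)).
by rewrite -(rmorph0 (@cls K n I)).
Qed.

Lemma coord_degD (d : int) (f g : R) :
  coord_deg d f -> coord_deg d g -> coord_deg d (f + g).
Proof.
move=> hf hg; rewrite -[g]opprK; apply: coord_deg_sub => //.
by rewrite -sub0r; apply: coord_deg_sub => //; apply: coord_deg0.
Qed.

Lemma coord_degCM (d : int) (f : R) c : coord_deg d f -> coord_deg d (coordC I c * f).
Proof.
case: d => d hf; last by rewrite [f]hf mulr0.
by rewrite -[d]add0n; apply: coord_degM => //; apply: coord_degC.
Qed.

Lemma coord_deg_subspace (d : int) : subspace (@coordC K n I) (@coord_deg K n I d).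
Proof.
split=> [|c a b ha hb]; first exact: coord_deg0.
by apply: coord_degD => //; apply: coord_degCM.
Qed.

Lemma coord_deg_x0 : coord_deg 1 (x0 I).
Proof. by exists 'X_ord0 => //; rewrite dhomogX /= mdeg1. Qed.

Lemma coord_degX i : coord_deg 1 (coordX I i).
Proof. by exists 'X_i => //; rewrite dhomogX /= mdeg1. Qed.

Lemma coord_degXn (d : nat) (f : R) (e : nat) : coord_deg d f -> coord_deg (e * d)%N (f ^+ e).
Proof.
move=> hf; elim: e => [|e ih]; first exact: coord_deg1.
by rewrite exprS mulSn; apply: coord_degM.
Qed.

Lemma coord_deg_x0n (e : nat) : coord_deg e (x0 I ^+ e).
Proof. by rewrite -[X in Posz X]muln1; apply: coord_degXn coord_deg_x0. Qed.

Lemma deg_span (d e : nat) f : coord_deg e f -> (e <= d)%N ->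
  exists c : 'X_{1..n.+1 < d.+1} -> K, f = \sum_m coordC I (c m) * cls I 'X_[m].
Proof.
move=> [g hg ->] ed; exists (fun m => g@_m).
have hs : (msize g <= d.+1)%N.
  rewrite msizeE; apply/bigmax_leqP_seq => m hm _.
  by have /dhomogP -> := hg.
rewrite {1}(mpolywE hs) rmorph_sum; apply: eq_bigr => m _.
by rewrite -mul_mpolyC rmorphM.
Qed.

Lemma deg_fin (d : int) : fin_span (@coordC K n I) (@coord_deg K n I d) (eq 0).
Proof.
case: d => d; last first.
  exists 0%N, (fun=> 0) => v ->; exists (fun=> 0).
  by rewrite /comb big_ord0 subr0.
apply: (@fin_span_finType _ _ _ _ _ 'X_{1..n.+1 < d.+1} (fun m => cls I 'X_[m])).
by move=> v /deg_span /(_ (leqnn d)) [c vE]; exists c; rewrite -vE subrr.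
Qed.

Lemma deg_monomials (d : nat) (J : R -> Prop) : is_ideal J ->
  (forall m : 'X_{1..n.+1}, mdeg m = d -> J (cls I 'X_[m])) ->
  forall f, coord_deg d f -> J f.
Proof.
move=> hJ hm _ [g hg ->]; rewrite [g]mpolyE rmorph_sum big_seq.
apply: ideal_sum => // m hs.
rewrite -mul_mpolyC rmorphM; apply: idealM => //; apply: hm.
by have /dhomogP -> := hg.
Qed.

Section Components.
Hypothesis homI : homogeneous_ideal I.

(** The arbitrary representative is harmless because [I] is homogeneous; [component_cls] records the
    independence. *)
Definition component (d : nat) (f : R) : R := cls I (pihomog mdeg d (repr f)).

Lemma component_cls d g : component d (cls I g) = cls I (pihomog mdeg d g).
Proof.
apply/eqP; rewrite -subr_eq0 -rmorphB -raddfB; apply/eqP/cls_eq0.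
by apply: homI; apply/cls_eq0; rewrite rmorphB /= cls_repr subrr.
Qed.

Fact component_zmod d : zmod_morphism (component d).
Proof.
move=> a b; rewrite -{1}(cls_repr a) -{1}(cls_repr b) -rmorphB /=.
by rewrite component_cls raddfB rmorphB.
Qed.

Lemma component_deg (d : nat) f : coord_deg d (component d f).
Proof. by exists (pihomog mdeg d (repr f)) => //; apply: pihomogP. Qed.

Lemma componentB d f g : component d (f - g) = component d f - component d g.
Proof. exact: component_zmod. Qed.

Lemma component0 d : component d 0 = 0.
Proof. by rewrite -[0 in LHS](subrr 0) componentB subrr. Qed.

Lemma componentN d f : component d (- f) = - component d f.
Proof. by rewrite -sub0r componentB component0 sub0r. Qed.

Lemma componentD d f g : component d (f + g) = component d f + component d g.
Proof. by rewrite -[g in LHS]opprK componentB componentN opprK. Qed.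

Lemma component_sum d (T : Type) (r : seq T) (P : pred T) (F : T -> R) :
  component d (\sum_(i <- r | P i) F i) = \sum_(i <- r | P i) component d (F i).
Proof.
by elim/big_rec2: _ => [|i a b _ <-]; rewrite (component0, componentD).
Qed.

Lemma component_id (d e : nat) f :
  coord_deg d f -> component e f = if e == d then f else 0.
Proof.
move=> [g hg ->]; rewrite component_cls; case: eqVneq => [->|ne].
  by rewrite pihomog_dE.
by rewrite (@pihomog_ne0 _ _ mdeg d) ?rmorph0 // eq_sym.
Qed.

Lemma component_bound f : exists N : nat, forall N', (N <= N')%N ->
  f = \sum_(i < N') component i f.
Proof.
exists (msize (repr f)) => N' hN.
rewrite -[LHS]cls_repr (@pihomog_partitionE _ _ mdeg N' _ hN) rmorph_sum.
by [].
Qed.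

Lemma component_ge f : exists N : nat, forall i, (N <= i)%N -> component i f = 0.
Proof.
have [N hN] := component_bound f; exists N => i hi.
rewrite (hN N) // component_sum big1 // => j _.
rewrite (component_id _ (component_deg j f)); case: eqP => // ij.
by move: hi; rewrite ij leqNgt ltn_ord.
Qed.

Lemma component_sum_le f N : (forall i, (N <= i)%N -> component i f = 0) ->
  f = \sum_(i < N) component i f.
Proof.
move=> h; have [M hM] := component_bound f.
rewrite {1}(hM (M + N)%N) ?leq_addr // addnC big_split_ord /=.
by rewrite [X in _ + X]big1 ?addr0 // => i _; apply: h; apply: leq_addr.
Qed.

Lemma component_ext f g : (forall i, component i f = component i g) -> f = g.
Proof.
move=> h; have [M hM] := component_bound f; have [N hN] := component_bound g.
rewrite (hM (M + N)%N) ?leq_addr // (hN (M + N)%N) ?leq_addl //.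
by apply: eq_bigr => i _.
Qed.

Lemma components_exist N (c : nat -> R) : (forall i : nat, coord_deg i (c i)) ->
  (forall i, (N <= i)%N -> c i = 0) -> exists f, forall i, component i f = c i.
Proof.
move=> hc c0; exists (\sum_(j < N) c j) => i; rewrite component_sum.
have hci (j : nat) : component i (c j) = if j == i then c j else 0.
  by rewrite (component_id _ (hc j)) eq_sym.
rewrite (eq_bigr (fun j : 'I_N => if val j == i then c j else 0)) //.
rewrite -big_mkcond; case: (ltnP i N) => iN.
  by rewrite (big_pred1 (Ordinal iN)).
rewrite big_pred0 ?c0 // => j; apply/negP => /eqP ji.
by have := ltn_ord j; rewrite ji ltnNge iN.
Qed.

Lemma component_ideal (J : R -> Prop) f : is_ideal J ->
  (forall i, J (component i f)) -> J f.
Proof.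
by move=> hJ h; have [N /(_ N (leqnn _)) ->] := component_bound f; apply: ideal_sum.
Qed.

Lemma componentM k (e : nat) f g : coord_deg e g ->
  component k (f * g) = if (e <= k)%N then component (k - e) f * g else 0.
Proof.
move=> hg; have [N hN] := component_ge f.
have hN' : forall i, (N + k.+1 <= i)%N -> component i f = 0.
  by move=> i hi; apply: hN; lia.
rewrite {1}(component_sum_le hN') mulr_suml component_sum.
have hk i : component k (component i f * g) =
    if k == (i + e)%N then component i f * g else 0.
  by apply: component_id; apply: coord_degM => //; apply: component_deg.
case: leqP => hek; last first.
  by rewrite big1 // => i _; rewrite hk; case: eqP => // E; move: hek; rewrite {1}E; lia.
have lt : (k - e < N + k.+1)%N by lia.
rewrite (bigD1 (Ordinal lt)) //= hk subnK // eqxx big1 ?addr0 // => i.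
by rewrite hk -val_eqE /= => ne; case: eqP => // E; move/eqP: ne; lia.
Qed.

Lemma componentMl k (e : nat) f g : coord_deg e g ->
  component k (g * f) = if (e <= k)%N then g * component (k - e) f else 0.
Proof. by move=> hg; rewrite mulrC (componentM _ _ hg) [g * _]mulrC. Qed.

Lemma componentCM k c f : component k (coordC I c * f) = coordC I c * component k f.
Proof. by rewrite (componentMl _ _ (coord_degC I c)) leq0n subn0. Qed.

Lemma component_lowM i j f g :
  (forall a, (a < i)%N -> component a f = 0) ->
  (forall b, (b < j)%N -> component b g = 0) ->
  component (i + j) (f * g) = component i f * component j g.
Proof.
move=> hf hg; have [N hN] := component_ge f.
have hN' : forall a, (N + i.+1 <= a)%N -> component a f = 0.
  by move=> a ha; apply: hN; lia.
rewrite {1}(component_sum_le hN') mulr_suml component_sum.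
have lt : (i < N + i.+1)%N by lia.
rewrite (bigD1 (Ordinal lt)) //= big1 ?addr0.
  rewrite (componentMl _ _ (component_deg i f)) leq_addr.
  by rewrite addnC addnK.
move=> a; rewrite -val_eqE /= => ha.
rewrite (componentMl _ _ (component_deg a f)); case: leqP => // ha'.
have [lt_ai|le_ia] := ltnP a i; first by rewrite hf // mul0r.
by rewrite hg ?mulr0 //; lia.
Qed.

(** After subtraction of initial parts lying in [J], the lowest components of f and g are outside
    [J]. Their product is a component of an element of the homogeneous ideal [J], so primality for
    forms applies to it. *)
Lemma homogeneous_prime (J : R -> Prop) : is_ideal J ->
  (forall f d, J f -> J (component d f)) ->
  (forall (d e : nat) f g, coord_deg d f -> coord_deg e g -> J (f * g) ->
     J f \/ J g) ->
  forall f g, J (f * g) -> J f \/ J g.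
Proof.
move=> hJ homJ pJ f g hfg; apply: contrapT => /not_orP [nf ng].
have low h : ~ J h -> exists i u, [/\ J u,
    forall a, (a < i)%N -> component a (h - u) = 0 & ~ J (component i (h - u))].
  move=> nh; have ex : exists i, ~~ `[< J (component i h) >].
    apply: contrapT => /forallNP hn; apply: nh; apply: component_ideal => // i.
    by have /negP/negbNE/asboolP := hn i.
  have [i /asboolPn hi imin] := ex_minnP ex.
  exists i, (\sum_(a < i) component a h); split.
  - apply: ideal_sum => // a _; apply: contrapT => /asboolPn /imin.
    by rewrite leqNgt ltn_ord.
  - move=> a lt_ai; rewrite componentB component_sum (bigD1 (Ordinal lt_ai)) //=.
    rewrite (component_id _ (component_deg a h)) eqxx big1 ?addr0 ?subrr // => b.
    rewrite -val_eqE /= (component_id _ (component_deg b h)) eq_sym.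
    by case: eqP.
  - rewrite componentB component_sum big1 ?subr0 // => b _.
    rewrite (component_id _ (component_deg b h)); case: eqP => // ib.
    by have := ltn_ord b; rewrite -ib ltnn.
have [i [u [Ju hu ni]]] := low _ nf; have [j [v [Jv hv nj]]] := low _ ng.
have : J ((f - u) * (g - v)).
  rewrite (_ : _ * _ = f * g - f * v - (g - v) * u); last by ring.
  apply: idealB => //; last exact: idealM.
  by apply: idealB => //; apply: idealM.
move/(homJ _ (i + j)%N); rewrite component_lowM //.
by move/(pJ _ _ _ _ (component_deg _ _) (component_deg _ _)) => [].
Qed.

Definition low (d : nat) (f : R) := forall i, (d < i)%N -> component i f = 0.

Lemma low_deg (d e : nat) f : coord_deg e f -> (e <= d)%N -> low d f.
Proof.
move=> hf ed i di; rewrite (component_id _ hf); case: eqP => // ie.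
by move: di; rewrite ie ltnNge ed.
Qed.

Lemma low_subspace d : subspace (@coordC K n I) (low d).
Proof.
split=> [i _|c a b ha hb i di]; first exact: component0.
by rewrite componentD componentCM ha // hb // mulr0 addr0.
Qed.

Lemma lowM d (e : nat) f g : low d f -> coord_deg e g -> low (d + e) (f * g).
Proof.
move=> hf hg i di; rewrite (componentM _ _ hg); case: leqP => // ei.
by rewrite hf ?mul0r //; lia.
Qed.

Lemma low_exists f : exists d, low d f.
Proof.
by have [N hN] := component_ge f; exists N => i /ltnW; apply: hN.
Qed.

Lemma low_fin d : fin_span (@coordC K n I) (low d) (eq 0).
Proof.
apply: (@fin_span_finType _ _ _ _ _ 'X_{1..n.+1 < d.+1} (fun m => cls I 'X_[m])).
move=> v hv; have /choice [c hc] : forall i : 'I_d.+1, exists c : 'X_{1..n.+1 < d.+1} -> K,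
    component i v = \sum_m coordC I (c m) * cls I 'X_[m].
  by move=> i; apply: deg_span (component_deg i v) _; rewrite -ltnS.
exists (fun m => \sum_i c i m); rewrite {1}(component_sum_le (N := d.+1) hv).
rewrite (eq_bigr _ (fun i _ => hc i)) exchange_big -sumrB big1 // => m _.
by rewrite rmorph_sum mulr_suml subrr.
Qed.

Definition homogeneous_sub (J : R -> Prop) := forall f d, J f -> J (component d f).

Lemma principal_homogeneous (d : nat) f : coord_deg d f ->
  homogeneous_sub (principal f).
Proof.
move=> hf _ k [g ->]; rewrite (componentMl _ _ hf); case: ifP => _.
  by exists (component (k - d) g).
by exists 0; rewrite mulr0.
Qed.

Lemma addI_homogeneous J J' : homogeneous_sub J -> homogeneous_sub J' ->
  homogeneous_sub (addI J J').
Proof.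
move=> hJ hJ' _ d [b [c [hb hc ->]]]; rewrite componentD.
by exists (component d b), (component d c); split; [apply: hJ|apply: hJ'|].
Qed.

Lemma principal_deg (d e : nat) (f g : R) : coord_deg d f -> coord_deg e g ->
  principal f g -> exists2 k, coord_deg (e - d)%N k & g = f * k.
Proof.
move=> hf hg [k E]; have := component_id e hg; rewrite eqxx E.
rewrite (componentMl _ _ hf); case: leqP => _ hk.
  by exists (component (e - d) k); [exact: component_deg|].
by exists 0; [exact: coord_deg0|rewrite mulr0 hk].
Qed.

(* Prime avoidance: a homogeneous ideal maximal among those containing [J] and
   missing all powers of a variable would be a point containing [J]. *)
Lemma homogeneous_cofinite (J : R -> Prop) : is_ideal J -> homogeneous_sub J ->
  (forall q : prime_idealr R, Defs.point q -> exists2 f, J f & f \notin q) ->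
  exists N : nat, forall d : nat, (N <= d)%N -> forall f, coord_deg d f -> J f.
Proof.
move=> hJ homJ Jpt.
have hX i : exists k, J (coordX I i ^+ k).
  apply: contrapT => /forallNP noX.
  pose good (A : R -> Prop) := [/\ is_ideal A, homogeneous_sub A,
    (forall f, J f -> A f) & forall k, ~ A (coordX I i ^+ k)].
  (* Joining [J] to the set makes the empty chain in Zorn's lemma admissible: its union is empty and
     stands for [J] itself. *)
  pose P (A : set R) := good (fun f => J f \/ A f).
  have Jgood : good J by split.
  have [|A [[hA homA JA nA] Amax]] := @Zorn_bigcup R P.
    move=> F FP Fch; rewrite /P; set U := (X in good X).
    have FJ : forall X, F X \/ X = set0 -> P X.
      move=> X [/FP //|->]; rewrite /P (_ : (fun f => _) = J) //.
      by apply/funext => f; apply/propext; split; [case|left].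
    have cov f g : U f -> U g -> exists X, [/\ F X \/ X = set0,
        J f \/ X f & J g \/ X g].
      move=> [Jf|[X FX Xf]] [Jg|[Y FY Yg]].
      - by exists set0; split; [right|left|left].
      - by exists Y; split; [left|left|right].
      - by exists X; split; [left|right|left].
      have [XY|YX] := Fch _ _ FX FY.
        by exists Y; split; [left|right; apply: XY|right].
      by exists X; split; [left|right|right; apply: YX].
    have sub X f : F X \/ X = set0 -> J f \/ X f -> U f.
      by move=> [FX|->] [Jf|Xf] //; [left|right; exists X|left].
    split=> [|f d Uf|f Jf|k Uk].
    - split=> [|f g c Uf Ug]; first by left; apply: hJ.1.
      have [X [FX hf hg]] := cov _ _ Uf Ug; apply: (sub X) => //.
      by have [[_ +] _ _ _] := FJ _ FX; apply.
    - have [X [FX hf _]] := cov _ _ Uf Uf; apply: (sub X) => //.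
      by have [_ + _ _] := FJ _ FX; apply.
    - by left.
    - have [X [FX hf _]] := cov _ _ Uk Uk.
      by have [_ _ _ /(_ k)] := FJ _ FX.
  set Q := fun f => J f \/ A f in hA homA JA nA.
  have ext (d : nat) f : coord_deg d f -> ~ Q f ->
      exists k, addI Q (principal f) (coordX I i ^+ k).
    move=> hf nf; apply: contrapT => /forallNP hk.
    have QJ g : Q g -> addI Q (principal f) g.
      move=> Qg; exists g, 0; split; rewrite ?addr0 //.
      by case: (principal_ideal f).
    apply: (Amax (addI Q (principal f))).
      rewrite properEneq; split; last by move=> g Ag; apply: QJ; right.
      apply/eqP => AE; apply: nf; right; rewrite AE.
      exists 0, f; split; [exact: hA.1| |by rewrite add0r].
      by exists 1; rewrite mulr1.
    rewrite /P (_ : (fun g => _) = addI Q (principal f)).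
      split=> //; first exact: addI_ideal (principal_ideal f).
        by apply: addI_homogeneous => //; apply: principal_homogeneous hf.
      by move=> g Jg; apply: QJ; left.
    apply/funext => g; apply/propext; split; last by right.
    by case=> // Jg; apply: QJ; left.
  have Q1 : ~ Q 1 by move=> h; apply: (nA 0%N); rewrite expr0.
  have [|q hq] := prime_exists hA Q1.
    apply: homogeneous_prime => // d e f g hf hg Qfg.
    apply: contrapT => /not_orP [nf ng].
    have [k [u [_ [Qu [x ->] E]]]] := ext _ _ hf nf.
    have [l [v [_ [Qv [y ->] E']]]] := ext _ _ hg ng.
    apply: (nA (k + l)%N); rewrite exprD E E'.
    rewrite (_ : (_ + _) * (_ + _) = (v + g * y) * u + (f * x) * v + (x * y) * (f * g));
      last by ring.
    by apply: (idealD (J := Q)) => //; [apply: (idealD (J := Q)) => //|]; apply: (idealM (J := Q)).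
  have [|f Jf] := Jpt q; last by case/negP; apply/hq; left.
  split=> [f d|].
    move=> /hq Qf; apply/hq; have := homA _ d Qf.
    by rewrite component_cls.
  exists (coordX I i); last by apply/negP => /hq h; apply: (nA 1%N).
  exists (fun j => (j == i)%:R); rewrite (bigD1 i) //= eqxx mul1r big1 ?addr0 //.
  by move=> j /negPf ->; rewrite mul0r.
(* Pigeonhole: in a monomial of degree at least the sum of the [k i], some exponent reaches its
   [k i]. *)
have [k hk] := choice hX; pose N := (\sum_i k i)%N.
exists N => d hd; apply: deg_monomials => // m hm.
have [i hi] : exists i, (k i <= m i)%N.
  apply: contrapT => /forallNP h; suff : (d < N)%N by rewrite ltnNge hd.
  rewrite -hm mdegE.
  apply: (@leq_trans (\sum_(i < n.+1) (m i).+1)%N).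
    rewrite [X in (_ < X)%N](eq_bigr (fun i => m i + 1)%N); last by move=> j _; rewrite addn1.
    by rewrite big_split /= sum1_card card_ord addnS ltnS leq_addr.
  by apply: leq_sum => i _; rewrite ltnNge; apply/negP/h.
rewrite mpolyXE_id (bigD1 i) //= rmorphM rmorphXn /=.
by rewrite -(subnK hi) exprD mulrAC; apply: idealM; last exact: hk.
Qed.
End Components.
End CoordRing.

(** * Points and germs *)

Lemma toloc_eq0 (A : comNzRingType) (S : mulset A) a :
  toloc S a = 0 <-> exists2 u, u \in mset S & u * a = 0.
Proof.
split=> [/eqP/loc_eqP [u hu]|[u hu e]].
  by rewrite /nu /de /= mulr1 mul0r subr0; exists u.
apply/eqP/loc_eqP; exists u => //.
by rewrite /nu /de /= mulr1 mul0r subr0.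
Qed.

Lemma loc_fracE (A : comNzRingType) (S : mulset A) (q : loc S) :
  exists a u, u \in mset S /\ q = toloc S a / toloc S u.
Proof.
have [[a [u hu]] ->] := locP q; exists a, u; split=> //.
apply: (mulIr (toloc_unit hu)); rewrite mulrVK ?toloc_unit //.
rewrite -[LHS]/(loc_mul _ (toloc S u)) -pi_mull.
by apply: loc_eqE; rewrite /mulf /nu /de /mkfrac /= /de /=; ring.
Qed.

(** The regularity index enters only through the Hilbert function, which is constant from [r] on and
    changes at [r]; its final value is written as HF(r) instead of the degree of X. *)
Record zero_dim_scheme (K : fieldType) (n : nat) (I : idealr {mpoly K[n.+1]})
    (s : nat) (p : 'I_s -> prime_idealr (coord_ring I)) (r : nat) : Prop :=
  ZeroDimScheme {
    scheme_hom : homogeneous_ideal I;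
    scheme_sat : saturated I;
    scheme_dim : zero_dimensional I;
    scheme_supp : enumerates_support p;
    scheme_off : forall j, x0 I \notin p j;
    scheme_HF : forall i : int, (r%:Z <= i)%R -> HF I i = HF I r;
    scheme_HF_min : HF I (r%:Z - 1) <> HF I r
  }.

Section Scheme.
Variables (K : fieldType) (n : nat) (I : idealr {mpoly K[n.+1]}).
Local Notation R := (coord_ring I).
Local Notation x := (x0 I).
Variables (s : nat) (p : 'I_s -> prime_idealr R) (r : nat).
Hypothesis X : zero_dim_scheme p r.
Let homI : homogeneous_ideal I. Proof. by case: X. Qed.
Let satI : saturated I. Proof. by case: X. Qed.
Let zdI : zero_dimensional I. Proof. by case: X. Qed.
Let suppI : enumerates_support p. Proof. by case: X. Qed.
Let offI j : x \notin p j. Proof. by case: X. Qed.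
Let HF_const (i : int) : (r%:Z <= i)%R -> HF I i = HF I r.
Proof. exact: (scheme_HF X). Qed.

(** In dimension zero every point is closed, so testing the enumerated points suffices. *)
Lemma cofinite (J : R -> Prop) : is_ideal J -> homogeneous_sub J ->
  (forall j, exists2 f, J f & f \notin p j) ->
  exists N : nat, forall d : nat, (N <= d)%N -> forall f, coord_deg d f -> J f.
Proof.
move=> hJ homJ hp; apply: homogeneous_cofinite => // q pq.
have cq : closed_point q by split=> // q' pq' qq'; apply: zdI.2 qq'.
have [_ _ /(_ q cq) [j qj]] := suppI.
by have [f Jf fp] := hp j; exists f; rewrite ?qj.
Qed.

Lemma saturated_eq0 (N : nat) (f : R) :
  (forall g, coord_deg N g -> g * f = 0) -> f = 0.
Proof.
move=> h; rewrite -(cls_repr f); apply/cls_eq0; apply: (satI (k := N)) => m hm.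
apply/cls_eq0; rewrite rmorphM /= cls_repr; apply: h.
by exists 'X_[m] => //; rewrite dhomogX /= hm.
Qed.

(** All forms of some large degree are multiples of x0 and hence annihilate [f]; saturation
    concludes. *)
Lemma x0_nzd f : x * f = 0 -> f = 0.
Proof.
move=> xf; have [||j|N hN] := @cofinite (principal x).
- exact: principal_ideal.
- exact: principal_homogeneous (coord_deg_x0 I).
- by exists x => //; exists 1; rewrite mulr1.
apply: (saturated_eq0 (N := N)) => g /(hN _ (leqnn _)) [k ->].
by rewrite mulrAC xf mul0r.
Qed.

Lemma x0n_nzd k f : x ^+ k * f = 0 -> f = 0.
Proof.
elim: k => [|k ih]; first by rewrite expr0 mul1r.
by rewrite exprS -mulrA => /x0_nzd.
Qed.

Lemma x0n_inj k : injective (fun f => x ^+ k * f).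
Proof.
move=> f g e; apply/eqP; rewrite -subr_eq0; apply/eqP/(@x0n_nzd k).
by rewrite mulrBr e subrr.
Qed.

Lemma x0n_notin j k : x ^+ k \notin p j.
Proof.
exact: primeX.
Qed.

Lemma point_homogeneous j : homogeneous_sub (fun f => f \in p j).
Proof.
move=> f d; have [/(_ j) [[h _] _] _ _] := suppI.
by rewrite -[f in f \in _](cls_repr f); apply: h.
Qed.

Lemma component_notin j f : f \notin p j -> exists d, component d f \notin p j.
Proof.
move=> nf; apply: contrapT => /forallNP h; case/negP: nf.
apply: (component_ideal (J := fun f => f \in p j)).
  exact: prime_ideal.
by move=> i; have /negP/negbNE := h i.
Qed.

(** From degree r on, multiplication by x0 is an injection between spaces of equal dimension, hence
    onto. *)
Lemma divide_x0 (d e : nat) f : (r <= d <= e)%N -> coord_deg e f ->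
  exists2 g, coord_deg d g & f = x ^+ (e - d) * g.
Proof.
move=> /andP [rd]; elim: e f => [|e ih] f.
  by rewrite leqn0 => /eqP -> hf; exists f; rewrite // expr0 mul1r.
rewrite leq_eqVlt => /predU1P [->|]; first by rewrite subnn; exists f; rewrite // expr0 mul1r.
rewrite ltnS => de hf.
have [g hg e0] : exists2 g, coord_deg e g & 0 = f - x * g.
  apply: (dimK_surj (h := @coordC K n I) (h' := @coordC K n I)
    (V := @coord_deg K n I e) (W := eq 0) (V' := @coord_deg K n I e.+1)
    (W' := eq 0) (phi := fun g => x * g) _ _ _ _ _ _ _ _ _ hf).
  - exact: coord_deg_subspace.
  - exact: subspace0.
  - exact: coord_deg_subspace.
  - exact: subspace0.
  - by move=> v hv; rewrite -add1n; apply: coord_degM => //; apply: coord_deg_x0.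
  - by move=> v _ /esym /x0_nzd ->.
  - by move=> c a b _ _; ring.
  - exact: deg_fin.
  - by rewrite -![dimK _ _ _]/(HF I _) HF_const ?(HF_const (i := e.+1)) //; lia.
have [g' hg' eg] := ih _ de hg; exists g' => //.
move/esym/eqP: e0; rewrite subr_eq0 => /eqP ->.
by rewrite eg mulrA -exprS subSn.
Qed.

(* The elements [f^k / x0^(k d)] of the finite-dimensional algebra [Q_0] are
   linearly dependent; the relation of lowest order gives [v]. *)
Lemma point_nilpotent j (d : nat) f : coord_deg d f -> f \in p j ->
  exists k v, [/\ homogeneous v, v \notin p j & v * f ^+ k = 0].
Proof.
move=> hf pf.
(* [u] is the numerator of f^k / x0^(k d) over the denominator x0^r, so all powers are represented
   in the one space R_r. *)
have hu k : exists u, coord_deg r u /\ x ^+ (k * d) * u = x ^+ r * f ^+ k.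
  have [||u hu e] := @divide_x0 r (r + k * d) (x ^+ r * f ^+ k).
  - by rewrite leqnn leq_addr.
  - by apply: coord_degM; [exact: coord_deg_x0n|exact: coord_degXn].
  by exists u; rewrite e addKn.
have [u uP] := choice hu.
have [m [c [k0 [k0m ck0 /esym rel]]]] := fin_span_dep (subspace0 _) (deg_fin I r)
  (fun k => (uP k).1).
have rel' : \sum_(k < m) coordC I (c k) * x ^+ ((m - k) * d) * f ^+ k = 0.
  apply: (@x0n_nzd r); rewrite mulr_sumr.
  transitivity (x ^+ (m * d) * \sum_(k < m) coordC I (c k) * u k);
    last by rewrite rel mulr0.
  rewrite mulr_sumr; apply: eq_bigr => k _.
  have -> : (m * d = (m - k) * d + k * d)%N by rewrite -mulnDl subnK // ltnW.
  transitivity (coordC I (c k) * x ^+ ((m - k) * d) * (x ^+ r * f ^+ k)).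
    by ring.
  by rewrite -(uP k).2 exprD; ring.
have ex : exists k, (k < m)%N && (c k != 0) by exists k0; rewrite k0m.
have [k /andP [km ck] kmin] := ex_minnP ex.
(* The relation with f^k divided out, k being its lowest index. Modulo [p j] only c_k x0^((m - k) d)
   is left of it, which is not in [p j]. *)
pose v := \sum_(i < m | (k <= i)%N)
  coordC I (c i) * x ^+ ((m - i) * d) * f ^+ (i - k).
exists k, v; split.
- exists ((m - k) * d)%N; apply: subspace_sum; first exact: coord_deg_subspace.
  move=> i ki; rewrite -mulrA; apply: coord_degCM.
  have -> : ((m - k) * d = (m - i) * d + (i - k) * d)%N.
    by rewrite -mulnDl; congr muln; have := ltn_ord i; lia.
  by apply: coord_degM; [exact: coord_deg_x0n|exact: coord_degXn].
- rewrite /v (bigD1 (Ordinal km)) //= subnn expr0 mulr1.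
  rewrite rpredDr; last first.
    apply: rpred_sum => i /andP [ki ik]; apply: primeMr.
    have : (0 < i - k)%N by move: ik; rewrite -val_eqE /=; lia.
    by case: (i - k)%N => // e _; rewrite exprS mulrC; apply: primeMr.
  apply/negP.
  rewrite primeM (negPf (x0n_notin j _)) orbF => pc.
  have := primeMr (coordC I (c k)^-1) pc.
  by rewrite -rmorphM mulVf // rmorph1 (negPf (prime1 _)).
- rewrite -rel' /v mulr_suml [RHS](bigID (fun i : 'I_m => (k <= i)%N)) /=.
  rewrite [X in _ = _ + X]big1 ?addr0.
    by apply: eq_bigr => i ki; rewrite -mulrA -exprD subnK.
  move=> i; rewrite -ltnNge => ik.
  have [->|ci] := eqVneq (c i) 0; first by rewrite rmorph0 !mul0r.
  by have := kmin i; rewrite ltn_ord ci leqNgt ik => /(_ isT).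
Qed.

Definition germ_ker j (f : R) := exists2 v, v \in hcompl (p j) & v * f = 0.

Lemma germ_kerP j f : toloc (hcompl_mulset (p j)) f = 0 <-> germ_ker j f.
Proof. exact: toloc_eq0. Qed.

Lemma germ_ker_ideal j : is_ideal (germ_ker j).
Proof.
split; first by apply/germ_kerP; rewrite rmorph0.
move=> a b c /germ_kerP ha /germ_kerP hb; apply/germ_kerP.
by rewrite rmorphD rmorphM /= ha hb mulr0 addr0.
Qed.

Lemma germ_ker_homogeneous j : homogeneous_sub (germ_ker j).
Proof.
move=> f d [v hv e]; exists v => //; move/asboolP: hv => [[a hv] _].
have := congr1 (component (a + d)%N) e.
by rewrite (componentMl homI _ _ hv) leq_addr addKn component0.
Qed.

Lemma germ_ker_sub j f : germ_ker j f -> f \in p j.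
Proof.
move=> [v /asboolP [_ pv] e].
have : v * f \in p j by rewrite e prime0.
by rewrite primeM (negPf pv).
Qed.

(** For a component of [f], the annihilator is a homogeneous ideal contained in no point, so it
    contains all forms of a large degree, and saturation applies. *)
Lemma germ_ker_eq0 f : (forall j, germ_ker j f) -> f = 0.
Proof.
move=> hf; apply: component_ext => d; rewrite component0 //.
have {}hf j : germ_ker j (component d f) by apply: germ_ker_homogeneous.
have hd := component_deg d f.
move: (component d f) hf hd => {}f hf hd.
have [|g k|j|N hN] := @cofinite (fun g => g * f = 0).
- split=> [|a b c ha hb]; first by rewrite mul0r.
  by rewrite mulrDl -mulrA ha hb mulr0 addr0.
- move=> e; have := congr1 (component (k + d)%N) e.
  by rewrite (componentM homI _ _ hd) leq_addl addnK component0.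
- by have [v /asboolP [_ pv] e] := hf j; exists v.
by apply: (saturated_eq0 (N := N)) => g; apply: hN.
Qed.

(** Distinct points are incomparable, so some form in [p j] avoids [p l]; by [point_nilpotent] one
    of its powers has zero germ at [p j]. *)
Lemma germ_ker_separate j l : j != l ->
  exists t, [/\ germ_ker j t, homogeneous t & t \notin p l].
Proof.
move=> jl; have [cp pinj _] := suppI.
have [f pf nf] : exists2 f, f \in p j & f \notin p l.
  apply: contrapT => hn.
  have sub : {subset p j <= p l}.
    by move=> f pf; apply: contrapT => /negP nf; apply: hn; exists f.
  case/eqP: jl; apply: pinj => f; apply/idP/idP; first exact: sub.
  by apply: zdI.2 sub _; [case: (cp j)|case: (cp l)].
have [d nd] := component_notin nf.
have pd := point_homogeneous d pf.
have [k [v [hv nv e]]] := point_nilpotent (component_deg d f) pd.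
exists (component d f ^+ k); split.
- by exists v => //; apply/asboolP.
- by exists (k * d)%N; apply: coord_degXn; apply: component_deg.
- exact: primeX.
Qed.

Lemma germ_ker_others j : exists u,
  [/\ forall l, l != j -> germ_ker l u, homogeneous u & u \notin p j].
Proof.
have ht l : exists t, [/\ l != j -> germ_ker l t, homogeneous t & t \notin p j].
  have [lj|/negbNE/eqP ->] := boolP (l != j).
    by have [t [h1 h2 h3]] := germ_ker_separate lj; exists t.
  by exists 1; split=> //; [exact: homogeneous1|rewrite prime1].
have [t tP] := choice ht.
exists (\prod_l t l); split.
- move=> l lj; rewrite (bigD1 l) //= mulrC; apply: idealM.
    exact: germ_ker_ideal.
  by case: (tP l) => + _ _; apply.
- apply: big_ind => [| |l _]; [exact: homogeneous1|exact: homogeneousM|].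
  by case: (tP l).
- apply: (big_ind (fun u => u \notin p j)) => [|a b|l _].
  + by rewrite prime1.
  + by rewrite primeM negb_or => -> ->.
  + by case: (tP l).
Qed.

(** A form [u] vanishing locally at the other points but not at [p j] generates, together with the
    germ kernel at [p j], an ideal contained in no point. A form of large degree is therefore a
    multiple of [u] up to an element without germ at [p j], and this multiple is the extension by
    zero. *)
Lemma germ_extension j : exists N : nat, forall d : nat, (N <= d)%N ->
  forall f, coord_deg d f -> exists g,
    [/\ coord_deg d g, germ_ker j (f - g) & forall l, l != j -> germ_ker l g].
Proof.
have [u [hu [du hdu] nu]] := germ_ker_others j.
have [|||N hN] := @cofinite (addI (principal u) (germ_ker j)).
- exact: addI_ideal (principal_ideal u) (germ_ker_ideal j).
- apply: addI_homogeneous => //; last exact: germ_ker_homogeneous.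
  exact: principal_homogeneous hdu.
- move=> l; have [->|jl] := eqVneq l j.
    exists u => //; exists u, 0; split; rewrite ?addr0 //.
      by exists 1; rewrite mulr1.
    by case: (germ_ker_ideal j).
  rewrite eq_sym in jl; have [t [ht _ nt]] := germ_ker_separate jl.
  exists t => //; exists 0, t; split; rewrite ?add0r //.
  by case: (principal_ideal u).
exists N => d Nd f hf; have [a [b [[k ->] hb e]]] := hN d Nd f hf.
have ker_uk l : l != j -> germ_ker l (u * k).
  by move=> lj; rewrite mulrC; apply: idealM (hu _ lj); apply: germ_ker_ideal.
exists (component d (u * k)); split.
- exact: component_deg.
- have <- : component d (f - u * k) = f - component d (u * k).
    by rewrite componentB // (component_id homI _ hf) eqxx.
  by apply: germ_ker_homogeneous; rewrite e addrC addKr.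
- by move=> l lj; apply: germ_ker_homogeneous; apply: ker_uk.
Qed.

Lemma divides_x0n (d : nat) g : coord_deg d g -> (forall j, g \notin p j) ->
  exists (N : nat) h, [/\ (d <= N)%N, coord_deg (N - d)%N h & g * h = x ^+ N].
Proof.
move=> hg ng; have [|||N hN] := @cofinite (principal g).
- exact: principal_ideal.
- exact: principal_homogeneous hg.
- by move=> j; exists g => //; exists 1; rewrite mulr1.
have := hN (N + d)%N (leq_addr _ _) _ (coord_deg_x0n I (N + d)).
move/(principal_deg homI hg (coord_deg_x0n I _)) => [h hh e].
by exists (N + d)%N, h; rewrite leq_addl.
Qed.

Lemma nzd_notin (d : nat) g : coord_deg d g -> (forall f, g * f = 0 -> f = 0) ->
  forall j, g \notin p j.
Proof.
move=> hg zg j; apply/negP => pg.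
have [k [v [_ nv e]]] := point_nilpotent hg pg.
suff v0 : v = 0 by rewrite v0 prime0 in nv.
elim: k e => [|k ih]; first by rewrite expr0 mulr1.
by rewrite exprS mulrCA => /zg.
Qed.

Lemma coord_degMz (i : int) (e : nat) (f g : R) :
  coord_deg i f -> coord_deg e g -> coord_deg (i + e%:Z) (f * g).
Proof.
case: i => i hf hg; first exact: coord_degM.
by rewrite [f]hf mul0r; apply: coord_deg0.
Qed.

Lemma hnzdP (g : R) : g \in @hnzd K n I <-> homogeneous g /\ forall j, g \notin p j.
Proof.
split=> [/asboolP [[d hg] zg]|[[d hg] ng]].
  by split; [exists d|exact: nzd_notin hg zg].
apply/asboolP; split; first by exists d.
move=> f gf; have [N [h [_ _ e]]] := divides_x0n hg ng.
by apply: (@x0n_nzd N); rewrite -e mulrAC gf mul0r.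
Qed.

Lemma x0_hnzd k : x ^+ k \in @hnzd K n I.
Proof.
apply/hnzdP; split; last by move=> j; apply: x0n_notin.
by exists k; apply: coord_deg_x0n.
Qed.

Lemma toQ_inj : injective (@toQ K n I).
Proof.
move=> f g e; apply/eqP; rewrite -subr_eq0; apply/eqP.
have /toloc_eq0 [u hu ue] : toloc (hnzd_mulset I) (f - g) = 0.
  by rewrite rmorphB; apply/eqP; rewrite subr_eq0; apply/eqP.
by move/asboolP: hu => [_]; apply.
Qed.

Lemma Qx_unit k : Qx I ^+ k \is a GRing.unit.
Proof. by rewrite /Qx /toQ -rmorphXn; apply: toloc_unit; apply: x0_hnzd. Qed.

Lemma Q_fracE (q : Qh I) : exists f k, q = toQ f / Qx I ^+ k.
Proof.
have [f [u [hu ->]]] := loc_fracE q.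
have /hnzdP [[d hd] nu] := hu.
have [N [h [_ _ e]]] := divides_x0n hd nu.
exists (f * h), N; apply: (mulIr (Qx_unit N)); rewrite mulrVK ?Qx_unit //.
rewrite /Qx -rmorphXn /= -e !rmorphM /=.
rewrite -[toloc _ f]/(toQ f) -[toloc _ u]/(toQ u).
by rewrite mulrA mulrVK //; apply: toloc_unit.
Qed.

Lemma Q_degE (i : int) (q : Qh I) : Q_deg i q <->
  exists (k : nat) f, coord_deg (i + k%:Z) f /\ q = toQ f / Qx I ^+ k.
Proof.
split=> [[d [f [g [hf hg /hnzdP [_ ng] ->]]]]|[k [f [hf ->]]]]; last first.
  exists k, f, (x ^+ k); split=> //; [exact: coord_deg_x0n|exact: x0_hnzd|].
  by rewrite /Qx rmorphXn.
have ug : toQ g \is a GRing.unit.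
  by apply: toloc_unit; apply/hnzdP; split=> //; exists d.
have [N [h [dN hh e]]] := divides_x0n hg ng.
exists N, (f * h); split.
  have -> : i + N%:Z = i + d%:Z + (N - d)%N%:Z by lia.
  exact: coord_degMz.
apply: (mulIr (Qx_unit N)); rewrite mulrVK ?Qx_unit //.
by rewrite /Qx -rmorphXn /= -e !rmorphM /= mulrA mulrVK.
Qed.
End Scheme.

(** * Local rings and finite quotients *)

Section LocalRing.
Variables (A : comNzRingType) (M : prime_idealr A).
Local Notation B := (loc (prime_mulset M)).
Local Notation tl := (toloc (prime_mulset M)).

Lemma loc_unit_notin u : u \notin M -> tl u \is a GRing.unit.
Proof. by move=> hu; apply: toloc_unit. Qed.

Lemma loc_frac (q : B) : exists f u, u \notin M /\ q = tl f / tl u.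
Proof. by have [f [u [hu ->]]] := loc_fracE q; exists f, u. Qed.

Lemma loc_nonunit f u : u \notin M -> (nonunit (tl f / tl u) <-> f \in M).
Proof.
move=> hu; split=> [nf|hf [b]].
  apply: contrapT => /negP hf; apply: nf; exists (tl u / tl f).
  by rewrite mulrA mulrVK ?loc_unit_notin // divrr // loc_unit_notin.
have [k [v [hv ->]]] := loc_frac b; move=> e.
have : tl (f * k - u * v) = 0.
  have E : tl (f * k) = tl (u * v).
    rewrite !rmorphM /= -[RHS]mul1r -e [RHS]mulrACA.
    by rewrite !mulrVK ?loc_unit_notin.
  by rewrite rmorphB /= E subrr.
move=> /toloc_eq0 [w hw /eqP]; rewrite mulrBr subr_eq0 => /eqP E.
have : w * (u * v) \in M by rewrite -E !primeM hf orbT.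
by rewrite !primeM (negPf hu) (negPf hv) orbF (negPf hw).
Qed.

Lemma loc_principal a f :
  principal (tl a) (tl f) <-> exists2 v, v \notin M & principal a (v * f).
Proof.
split=> [[b e]|[v hv [k e]]]; last first.
  exists (tl k / tl v); rewrite mulrA -rmorphM -e rmorphM /= mulrC mulKr //.
  exact: loc_unit_notin.
have [k [v [hv bE]]] := loc_frac b.
have : tl (v * f - a * k) = 0.
  by rewrite rmorphB !rmorphM /= e bE mulrCA [tl k / _]mulrC mulVKr ?subrr // loc_unit_notin.
move=> /toloc_eq0 [w hw /eqP]; rewrite mulrBr subr_eq0 => /eqP E.
exists (w * v); first by rewrite primeM negb_or hv andbT.
by exists (w * k); rewrite -mulrA E mulrCA.
Qed.

Lemma principal_divr a (b c : B) : c \is a GRing.unit ->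
  (principal a (b / c) <-> principal a b).
Proof.
move=> uc; split=> -[k e]; last by exists (k / c); rewrite e mulrA.
by exists (k * c); rewrite mulrA -e mulrVK.
Qed.

End LocalRing.

(** * The socle of a local ring modulo a regular element *)

Section Gorenstein.
Variable B : comNzRingType.
Implicit Types a b c w z : B.

Lemma idgen1 a b : idgen [:: a] b <-> principal a b.
Proof.
split=> [[c ->]|[c ->]].
  by exists (c ord0); rewrite big_ord_recl big_ord0 addr0 mulrC.
by exists (fun=> c); rewrite big_ord_recl big_ord0 addr0 mulrC.
Qed.

Lemma idgen0 b : idgen [::] b <-> b = 0.
Proof.
split=> [[c ->]|->]; first by rewrite big_ord0.
by exists (fun=> 0); rewrite big_ord0.
Qed.

Definition socle_mod a w := forall b, nonunit b -> principal a (b * w).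

(* For regular [a] and [b], division by [b] after multiplication by [a] maps
   [(b : m) / b] isomorphically to [(a : m) / a]. *)
Lemma socle_transfer a b w : nonunit a -> (forall c, a * c = 0 -> c = 0) ->
  (forall c, b * c = 0 -> c = 0) -> socle_mod b w ->
  exists w', [/\ a * w = b * w', socle_mod a w' & principal a w' -> principal b w].
Proof.
move=> na za zb sw; have [w' e] := sw a na; exists w'; split=> // [c /sw [v ev]|[v ev]].
  exists v; apply/eqP; rewrite -subr_eq0; apply/eqP/zb.
  by rewrite mulrBr mulrCA -e mulrCA ev; ring.
exists v; apply/eqP; rewrite -subr_eq0; apply/eqP/za.
by rewrite mulrBr e ev; ring.
Qed.

(** The regular sequence given by [gorenstein_local] has length one: the empty sequence would make
    the regular element [b] nilpotent, and a second entry would annihilate, modulo the first, the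
    transfer of the socle element w0, against regularity. With a single entry [a], both socle
    elements are compared with [z] modulo [a]. *)
Lemma gorenstein_socle b : nonunit b -> (forall c, b * c = 0 -> c = 0) ->
  (exists w, socle_mod b w /\ ~ principal b w) -> gorenstein_local B ->
  forall w1 w2, socle_mod b w1 -> socle_mod b w2 ->
    ~ principal b w1 -> ~ principal b w2 -> exists c, principal b (w1 - c * w2).
Proof.
move=> nb zb [w0 [sw0 nw0]] [s [[s_nu s_reg] s_nil [z [zsoc nz zgen]]]].
case: s s_nu s_reg s_nil zsoc nz zgen => [|a t] s_nu s_reg s_nil zsoc nz zgen.
  have [k /idgen0] := s_nil b nb; elim: k => [|k ih].
    by move/eqP; rewrite expr0 oner_eq0.
  by rewrite exprS => /zb.
have na : nonunit a by apply: s_nu; rewrite inE eqxx.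
have za c : a * c = 0 -> c = 0.
  move=> ac; have := s_reg 0%N c isT; rewrite take0 => h.
  by apply/idgen0/h/idgen0.
case: t s_nu s_reg s_nil zsoc nz zgen => [|a' t] s_nu s_reg s_nil zsoc nz zgen.
  move=> w1 w2 sw1 sw2 nw1 nw2.
  (* The coefficient [c] of [z] is a unit, since otherwise c z, and with it w', would be a multiple
     of [a], and w a multiple of [b]. *)
  have gen w : socle_mod b w -> ~ principal b w -> exists w' c d,
      [/\ a * w = b * w', c * d = 1 & principal a (w' - c * z)].
    move=> sw nw; have [w' [e sw' nw']] := socle_transfer na za zb sw.
    have [c /idgen1 hc] : exists c, idgen [:: a] (w' - c * z).
      by apply: zgen => y ny; apply/idgen1/sw'.
    have [[d cd]|nc] := pselect (exists d, c * d = 1); first by exists w', c, d.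
    case: nw; apply: nw'; have /idgen1 [u hu] := zsoc c nc.
    by have [v hv] := hc; exists (v + u); rewrite mulrDr -hv -hu subrK.
  have [w1' [c1 [d1 [e1 _ [u1 h1]]]]] := gen _ sw1 nw1.
  have [w2' [c2 [d2 [e2 cd [u2 h2]]]]] := gen _ sw2 nw2.
  exists (c1 * d2), (u1 - c1 * d2 * u2); apply/eqP; rewrite -subr_eq0.
  apply/eqP/za.
  have -> : a * (w1 - c1 * d2 * w2 - b * (u1 - c1 * d2 * u2)) =
      a * w1 - c1 * d2 * (a * w2) - b * (a * u1 - c1 * d2 * (a * u2)) by ring.
  rewrite e1 e2 -h1 -h2.
  transitivity (b * c1 * z * (1 - c2 * d2)); first by ring.
  by rewrite cd subrr mulr0.
have [w' [_ sw' nw']] := socle_transfer na za zb sw0.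
case: nw0; apply: nw'; apply/idgen1.
have := s_reg 1%N w' isT; rewrite /= ?take0; apply.
by apply/idgen1/sw'; apply: s_nu; rewrite !inE eqxx orbT.
Qed.

End Gorenstein.

(** * Socle elements of a finite-dimensional quotient, localized at a prime by means of multipliers
    outside it *)

Section FiniteQuotient.
Variables (K : fieldType) (A : comNzRingType) (h : {rmorphism K -> A}).
Variables J M : A -> Prop.
Hypotheses (hJ : is_ideal J) (hM : is_ideal M) (M1 : ~ M 1)
  (primeMp : forall a b, M (a * b) -> M a \/ M b) (JM : forall a, J a -> M a)
  (finJ : fin_span h (fun=> True) J).

Lemma ideal_subspace (J' : A -> Prop) : is_ideal J' -> subspace h J'.
Proof. by move=> hJ'; split=> [|c a b]; [exact: hJ'.1|exact: hJ'.2]. Qed.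

(* In a linear relation between the powers of [f] modulo [J], the factor next to
   the lowest power is not in [M]. *)
Lemma finite_nilpotent f : M f -> exists k v, ~ M v /\ J (v * f ^+ k).
Proof.
move=> Mf; have sJ := ideal_subspace hJ.
have [d [c [k0 [k0d ck0 rel]]]] := fin_span_dep (e := fun k => f ^+ k) sJ finJ (fun=> Logic.I).
have ex : exists k, (k < d)%N && (c k != 0) by exists k0; rewrite k0d.
have [k /andP [kd ck] kmin] := ex_minnP ex.
exists k, (\sum_(i < d | (k <= i)%N) h (c i) * f ^+ (i - k)); split.
  rewrite (bigD1 (Ordinal kd)) //= subnn expr0 mulr1 => Mv.
  apply: M1; rewrite -(rmorph1 h) -(mulVf ck) rmorphM; apply: idealM => //.
  rewrite -[h (c k)](addrK (\sum_(i < d | (k <= i)%N && (i != Ordinal kd))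
    h (c i) * f ^+ (i - k))).
  apply: idealB => //; apply: ideal_sum => // i /andP [ki ik].
  apply: idealM => //; have : (0 < i - k)%N by move: ik; rewrite -val_eqE /=; lia.
  by case: (i - k)%N => // e _; rewrite exprSr; apply: idealM.
rewrite (_ : _ * _ = \sum_(k < d) h (c k) * f ^+ k) //.
rewrite mulr_suml [RHS](bigID (fun i : 'I_d => (k <= i)%N)) /=.
rewrite [X in _ = _ + X]big1 ?addr0.
  by apply: eq_bigr => i ki; rewrite -mulrA -exprD subnK.
move=> i; rewrite -ltnNge => ik.
have [->|ci] := eqVneq (c i) 0; first by rewrite rmorph0 mul0r.
by have := kmin i; rewrite ltn_ord ci leqNgt ik => /(_ isT).
Qed.

Lemma prod_notM m (v : 'I_m -> A) : (forall i, ~ M (v i)) -> ~ M (\prod_i v i).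
Proof.
by move=> hv; apply: (big_ind (fun u => ~ M u)) => // a b na nb /primeMp [].
Qed.

(** M is finite-dimensional modulo J, so the product of the multipliers belonging to a basis works
    for every element of M. *)
Lemma uniform_annihilator u : (forall f, M f -> exists v, ~ M v /\ J (v * (f * u))) ->
  exists v, ~ M v /\ forall f, M f -> J (f * (v * u)).
Proof.
move=> hu; have sJ := ideal_subspace hJ.
have fM : fin_span h M J by have [m [e se]] := finJ; exists m, e => v _; apply: se.
have [m [e [Me he]]] := fin_span_basis hM.1 sJ fM.
have [_ _ Se] := (basis_modP e hM.1 sJ).1 (conj Me he).
have /choice [v hv] : forall i, exists v, ~ M v /\ J (v * (e i * u)).
  by move=> i; apply: hu.
exists (\prod_i v i); split; first by apply: prod_notM => i; case: (hv i).
move=> f /Se [c hc]; rewrite -[f](subrK (comb h e c)) mulrDl.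
apply: idealD => //; first by rewrite mulrC; apply: idealM.
rewrite /comb mulr_suml; apply: ideal_sum => // i _.
rewrite (bigD1 i) //= (_ : _ * _ = h (c i) * (\prod_(j | j != i) v j) * (v i * (e i * u))).
  by apply: idealM => //; case: (hv i).
by ring.
Qed.

(** Starting from 1, the element is multiplied for each basis vector of M modulo J by the highest
    power that keeps it non-zero locally at M. The result is killed by M locally, and
    [uniform_annihilator] removes the multipliers. *)
Lemma socle_exists : exists u, (forall f, M f -> J (f * u)) /\
  forall v, ~ M v -> ~ J (v * u).
Proof.
have sJ := ideal_subspace hJ.
have fM : fin_span h M J by have [m [e se]] := finJ; exists m, e => v _; apply: se.
have [m [e [Me he]]] := fin_span_basis hM.1 sJ fM.
have [_ _ Se] := (basis_modP e hM.1 sJ).1 (conj Me he).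
have : forall t, (t <= m)%N -> exists u, (forall v, ~ M v -> ~ J (v * u)) /\
    forall i : 'I_m, (i < t)%N -> exists v, ~ M v /\ J (v * (e i * u)).
  elim=> [|t ih] tm.
    by exists 1; split=> // v nv; rewrite mulr1 => /JM.
  have [u [nu eu]] := ih (ltnW tm).
  pose et := e (Ordinal tm).
  have [k0 [v0 [nv0 Jv0]]] := finite_nilpotent (Me (Ordinal tm)).
  have ex : exists k, `[< exists v, ~ M v /\ J (v * (et ^+ k * u)) >].
    exists k0; apply/asboolP; exists v0; split=> //.
    by rewrite mulrA mulrC; apply: idealM.
  (* The least exponent that kills [u] locally is positive because [u] is not killed; its
     predecessor is the power to multiply by. *)
  case: (ex_minnP ex) => -[|k] /asboolP [v [nv Jv]] kmin.
    by case: (nu v nv); rewrite expr0 mul1r in Jv.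
  exists (et ^+ k * u); split.
    move=> w nw Jw; have : `[< exists v, ~ M v /\ J (v * (et ^+ k * u)) >].
      by apply/asboolP; exists w.
    by move/kmin; rewrite ltnn.
  move=> i; rewrite ltnS leq_eqVlt => /predU1P [it|it].
    exists v; split=> //; rewrite (_ : e i = et); first by rewrite [et * _]mulrA -exprS.
    by rewrite /et; congr e; apply: val_inj.
  have [w [nw Jw]] := eu i it; exists w; split=> //.
  by rewrite (_ : _ * _ = et ^+ k * (w * (e i * u))); [apply: idealM|ring].
move=> /(_ m (leqnn m)) [u [nu eu]].
have /choice [v hv] : forall i : 'I_m, exists v, ~ M v /\ J (v * (e i * u)).
  by move=> i; apply: eu.
have [|w [nw Jw]] := @uniform_annihilator u.
  move=> f /Se [c hc]; exists (\prod_i v i).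
  split; first by apply: prod_notM => i; case: (hv i).
  rewrite -[f](subrK (comb h e c)) mulrDl mulrDr; apply: idealD => //.
    by rewrite [_ * u]mulrC mulrA; apply: idealM.
  rewrite /comb mulr_suml mulr_sumr; apply: ideal_sum => // i _.
  rewrite (bigD1 i) //= (_ : _ * _ = h (c i) * (\prod_(j | j != i) v j) * (v i * (e i * u))).
    by apply: idealM => //; case: (hv i).
  by ring.
exists (w * u); split=> // v' nv'; rewrite mulrA; apply: nu.
by case/primeMp.
Qed.

End FiniteQuotient.

(** * The grading of the homogeneous ring of fractions *)

Section Kx0Ring.
Variables (K : fieldType) (n : nat) (I : idealr {mpoly K[n.+1]}).
Local Notation R := (coord_ring I).
Local Notation x := (x0 I).
Hypothesis homI : homogeneous_ideal I.

Definition evx0 (P : {poly K}) : R := (map_poly (@coordC K n I) P).[x].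

Lemma evx0E (P : {poly K}) N : (size P <= N)%N ->
  evx0 P = \sum_(k < N) coordC I P`_k * x ^+ k.
Proof.
move=> hN; rewrite /evx0 (@horner_coef_wide _ N); last first.
  by rewrite (leq_trans (size_poly _ _)).
by apply: eq_bigr => k _; rewrite coef_map.
Qed.

Fact evx0_zmod : zmod_morphism evx0.
Proof. by move=> P P'; rewrite /evx0 rmorphB hornerD hornerN. Qed.
Fact evx0_monoid : monoid_morphism evx0.
Proof.
by split=> [|P P']; rewrite /evx0 ?rmorph1 ?hornerC // rmorphM hornerM.
Qed.
HB.instance Definition _ := GRing.isZmodMorphism.Build _ _ evx0 evx0_zmod.
HB.instance Definition _ := GRing.isMonoidMorphism.Build _ _ evx0 evx0_monoid.

Lemma evx0C c : evx0 c%:P = coordC I c.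
Proof. by rewrite /evx0 map_polyC hornerC. Qed.

Lemma evx0X : evx0 'X = x.
Proof. by rewrite /evx0 map_polyX hornerX. Qed.

Lemma Kx0P f : Kx0 f <-> exists P, f = evx0 P.
Proof.
split=> [[m [c ->]]|[P ->]].
  exists (\poly_(k < m) c k); rewrite (@evx0E _ m) ?size_poly //.
  by apply: eq_bigr => k _; rewrite coef_poly ltn_ord.
by exists (size P), (fun k => P`_k); rewrite (@evx0E _ (size P)).
Qed.

Lemma component_evx0 k (P : {poly K}) : component k (evx0 P) = coordC I P`_k * x ^+ k.
Proof.
rewrite (@evx0E _ (size P + k.+1)) ?leq_addr // component_sum //.
have hk : (k < size P + k.+1)%N by lia.
have hd (i : nat) : coord_deg i (coordC I P`_i * x ^+ i).
  by apply: coord_degCM; apply: coord_deg_x0n.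
rewrite (bigD1 (Ordinal hk)) //= (component_id homI _ (hd k)) eqxx big1 ?addr0 //.
move=> i; rewrite -val_eqE /= => /negPf ik.
by rewrite (component_id homI _ (hd i)) eq_sym ik.
Qed.

Lemma coordC_inj : injective (@coordC K n I).
Proof.
move=> a b /eqP; rewrite -subr_eq0 -rmorphB => /eqP e.
apply/eqP; rewrite -subr_eq0; apply/negP => /negP ab.
have := congr1 (fun u => coordC I (a - b)^-1 * u) e.
by rewrite -rmorphM mulVf // rmorph1 mulr0 => /eqP; rewrite oner_eq0.
Qed.

Definition zcomponent (i : int) (f : R) : R :=
  if i is Posz m then component m f else 0.

Lemma zcomponent_deg i f : coord_deg i (zcomponent i f).
Proof. by case: i => m //; apply: component_deg. Qed.

Lemma zcomponentD i f g : zcomponent i (f + g) = zcomponent i f + zcomponent i g.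
Proof. by case: i => m /=; rewrite ?addr0 ?componentD. Qed.

Lemma zcomponent_id i j f : coord_deg i f -> zcomponent j f = if j == i then f else 0.
Proof.
case: i => i; last first.
  by move=> ->; rewrite if_same; case: j => //= j; rewrite component0.
by case: j => j hf //=; rewrite (component_id homI _ hf).
Qed.

Lemma zcomponent_x0n i (e : nat) f :
  zcomponent (i + e%:Z) (x ^+ e * f) = x ^+ e * zcomponent i f.
Proof.
have hx := coord_deg_x0n I e.
case: i => [m|m] /=.
  by rewrite (componentMl homI _ _ hx) leq_addl addnK.
rewrite mulr0; case E: (_ + _) => [k|k] //=.
rewrite (componentMl homI _ _ hx) leqNgt (_ : (k < e)%N = true) //.
by lia.
Qed.

End Kx0Ring.

Section GradedQ.
Variables (K : fieldType) (n : nat) (I : idealr {mpoly K[n.+1]}).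
Local Notation R := (coord_ring I).
Local Notation x := (x0 I).
Variables (s : nat) (p : 'I_s -> prime_idealr R) (r : nat).
Hypothesis X : zero_dim_scheme p r.
Let homI : homogeneous_ideal I. Proof. by case: X. Qed.
Local Notation Q := (Qh I).
Implicit Types q : Q.
Local Notation y := (Qx I).

Lemma QxE k : y ^+ k = toQ (x ^+ k).
Proof. by rewrite /Qx rmorphXn. Qed.

Lemma Qy_unit k : y ^+ k \is a GRing.unit. Proof. exact: (Qx_unit X). Qed.

Lemma Q_fracP f k f' k' : toQ f / y ^+ k = toQ f' / y ^+ k' <->
  x ^+ k' * f = x ^+ k * f'.
Proof.
have [u u'] := (Qy_unit k, Qy_unit k'); split=> e.
  apply: (@toQ_inj K n I); rewrite !rmorphM /= -!QxE.
  by rewrite -[toQ f](mulrVK u) e mulrA [y ^+ k' * _]mulrC mulrVK // mulrC.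
apply: (mulIr u); apply: (mulIr u'); rewrite mulrVK // mulrAC mulrVK //.
by rewrite !QxE -!rmorphM /= mulrC e mulrC.
Qed.

Lemma Q_frac2 q q' : exists f f' k, q = toQ f / y ^+ k /\ q' = toQ f' / y ^+ k.
Proof.
have [f [k ->]] := Q_fracE X q; have [f' [k' ->]] := Q_fracE X q'.
exists (x ^+ k' * f), (x ^+ k * f'), (k + k')%N.
by split; apply/Q_fracP; rewrite exprD; ring.
Qed.

Lemma Q_frac_addE f f' k :
  toQ f / y ^+ k + toQ f' / y ^+ k = toQ (f + f') / y ^+ k.
Proof. by rewrite -mulrDl -rmorphD. Qed.

Lemma Q_deg_frac i (k : nat) f : coord_deg (i + k%:Z) f -> Q_deg i (toQ f / y ^+ k).
Proof. by move=> hf; apply/(Q_degE X); exists k, f. Qed.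

Lemma Q_degM i j q q' : Q_deg i q -> Q_deg j q' -> Q_deg (i + j) (q * q').
Proof.
move=> /(Q_degE X) [k [f [hf ->]]] /(Q_degE X) [k' [f' [hf' ->]]].
rewrite mulrACA -invrM ?Qy_unit // -exprD -rmorphM.
apply: Q_deg_frac; rewrite (_ : _ + _ = (i + k%:Z) + (j + k'%:Z)); last by lia.
move: hf'; case: (j + _) => m hf'; first exact: coord_degMz.
by rewrite [f']hf' mulr0; apply: coord_deg0.
Qed.

Definition Qnum q : R := projT1 (cid (Q_fracE X q)).
Definition Qexp q : nat := projT1 (cid (projT2 (cid (Q_fracE X q)))).
Lemma Qnum_frac q : q = toQ (Qnum q) / y ^+ Qexp q.
Proof. exact: projT2 (cid (projT2 (cid (Q_fracE X q)))). Qed.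

(** Another choice of fraction gives the same result, since multiplying by x0^e shifts components by
    e; see [QcomponentE]. *)
Definition Qcomponent (i : int) q : Q :=
  toQ (zcomponent (i + (Qexp q)%:Z) (Qnum q)) / y ^+ Qexp q.

Lemma QcomponentE i f k :
  Qcomponent i (toQ f / y ^+ k) = toQ (zcomponent (i + k%:Z) f) / y ^+ k.
Proof.
set q := toQ f / _; have /Q_fracP e := Qnum_frac q.
apply/Q_fracP; rewrite -!(zcomponent_x0n homI) -e.
by congr zcomponent; lia.
Qed.

Lemma QcomponentD i q q' : Qcomponent i (q + q') = Qcomponent i q + Qcomponent i q'.
Proof.
have [f [f' [k [-> ->]]]] := Q_frac2 q q'.
by rewrite Q_frac_addE !QcomponentE zcomponentD // Q_frac_addE.
Qed.

Lemma Qcomponent_id i j q : Q_deg i q -> Qcomponent j q = if j == i then q else 0.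
Proof.
move=> /(Q_degE X) [k [f [hf ->]]]; rewrite QcomponentE (zcomponent_id homI _ hf).
rewrite (_ : (_ == _) = (j == i)); last by apply/eqP/eqP; lia.
by case: eqP => // _; rewrite rmorph0 mul0r.
Qed.

Lemma Qcomponent_deg i q : Q_deg i (Qcomponent i q).
Proof. by apply: Q_deg_frac; apply: zcomponent_deg. Qed.

Lemma Q_deg0 i : Q_deg i (0 : Q).
Proof.
have := @Q_deg_frac i 0 0 (coord_deg0 _ _).
by rewrite rmorph0 mul0r.
Qed.

Lemma Q_degP i q : Q_deg i q <-> Qcomponent i q = q.
Proof.
split=> [/Qcomponent_id ->|<-]; [by rewrite eqxx|exact: Qcomponent_deg].
Qed.

Lemma Q_degD i q q' : Q_deg i q -> Q_deg i q' -> Q_deg i (q + q').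
Proof. by move=> /Q_degP h /Q_degP h'; apply/Q_degP; rewrite QcomponentD h h'. Qed.

Lemma coord_deg_toQ (i : int) (f : R) : Q_deg i (toQ f) <-> coord_deg i f.
Proof.
have e : toQ f = toQ f / y ^+ 0 by rewrite expr0 divr1.
split=> [|hf]; last by rewrite e; apply: Q_deg_frac; rewrite addr0.
move/Q_degP; rewrite e QcomponentE addr0 => /Q_fracP.
by rewrite expr0 !mul1r => <-; apply: zcomponent_deg.
Qed.

Lemma Q_degQC c : Q_deg 0 (QC I c).
Proof. by apply/coord_deg_toQ; apply: coord_degC. Qed.

Lemma Q_deg_subspace i : subspace (@QC K n I) (@Q_deg K n I i).
Proof.
split=> [|c a b ha hb]; first exact: Q_deg0.
by apply: Q_degD => //; rewrite -[i]add0r; apply: Q_degM => //; apply: Q_degQC.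
Qed.

Lemma Qcomponent_sum i N (F : 'I_N -> Q) :
  Qcomponent i (\sum_k F k) = \sum_k Qcomponent i (F k).
Proof.
elim/big_rec2: _ => [|k a b _ <-]; last by rewrite QcomponentD.
by rewrite (Qcomponent_id _ (Q_deg0 i)) if_same.
Qed.

Lemma Q_decompose q : exists N (F : 'I_N -> Q) (d : 'I_N -> int),
  q = \sum_k F k /\ forall k, Q_deg (d k) (F k).
Proof.
have [f [k ->]] := Q_fracE X q; have [N /(_ N (leqnn _)) fE] := component_bound f.
exists N, (fun i => toQ (component i f) / y ^+ k), (fun i => i%:Z - k%:Z).
split; first by rewrite {1}fE rmorph_sum mulr_suml.
by move=> i; apply: Q_deg_frac; rewrite subrK; apply: component_deg.
Qed.

End GradedQ.

(** * Trace maps and the complementary module *)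

Section Trace.
Variables (K : fieldType) (n : nat) (I : idealr {mpoly K[n.+1]}).
Local Notation R := (coord_ring I).
Local Notation x := (x0 I).
Variables (s : nat) (p : 'I_s -> prime_idealr R) (r : nat).
Hypothesis X : zero_dim_scheme p r.
Let homI : homogeneous_ideal I. Proof. by case: X. Qed.
Local Notation Q := (Qh I).
Implicit Types q : Q.
Local Notation y := (Qx I).
Local Notation ev := (@evx0 K n I).
Variable sigma : Q -> Q.
Hypothesis tr : trace_map sigma.

Lemma L0_frac P k : L0 (toQ (ev P) / y ^+ k).
Proof. by exists k, (ev P); split=> //; apply/Kx0P; exists P. Qed.

Lemma L0P a : L0 a <-> exists P k, a = toQ (ev P) / y ^+ k.
Proof.
split=> [[k [f [/Kx0P [P ->] ->]]]|[P [k ->]]]; first by exists P, k.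
exact: L0_frac.
Qed.

Lemma L0_ev P : L0 (toQ (ev P)).
Proof. by rewrite -[toQ _]divr1 -(expr0 y); apply: L0_frac. Qed.

Lemma L0_yV k : L0 (y ^+ k)^-1.
Proof.
rewrite -[X in L0 X]mul1r -(rmorph1 (@toQ K n I)) -(rmorph1 ev).
exact: L0_frac.
Qed.

Lemma sigmaL a q q' : L0 a -> sigma (a * q + q') = a * sigma q + sigma q'.
Proof. by case: tr => [[[_ h] _] _]; apply: h. Qed.

Lemma sigma_deg i q : Q_deg i q -> Q_deg i (sigma q).
Proof. by case: tr => [[_ h] _] /h; rewrite addr0. Qed.

Lemma sigmaD q q' : sigma (q + q') = sigma q + sigma q'.
Proof.
have := sigmaL q q' (L0_ev 1).
by rewrite !rmorph1 !mul1r.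
Qed.

Lemma sigma0 : sigma 0 = 0.
Proof.
have := sigmaD 0 0; rewrite addr0 => e.
by apply: (addrI (sigma 0)); rewrite addr0 -e.
Qed.

Lemma sigmaZ a q : L0 a -> sigma (a * q) = a * sigma q.
Proof. by move=> ha; rewrite -[a * q]addr0 sigmaL // sigma0 addr0. Qed.

Lemma sigma_sum N (F : 'I_N -> Q) : sigma (\sum_k F k) = \sum_k sigma (F k).
Proof.
by elim/big_rec2: _ => [|k a b _ <-]; rewrite (sigma0, sigmaD).
Qed.

Lemma sigma_frac q k : sigma (q / y ^+ k) = sigma q / y ^+ k.
Proof. by rewrite [q * _]mulrC [RHS]mulrC; apply: (sigmaZ q (L0_yV k)). Qed.

Lemma sigma_x0n k q : sigma (toQ (x ^+ k) * q) = toQ (x ^+ k) * sigma q.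
Proof. by apply: sigmaZ; rewrite -evx0X -rmorphXn; apply: L0_ev. Qed.

Lemma sigma_eq0 g : (forall q, sigma (g * q) = 0) -> g = 0.
Proof.
move=> hg; have [|g0 [_ u]] := tr.2 (fun=> 0).
  (* The zero map is the empty sum of homogeneous maps; both [g] and 0 represent it. *)
  exists 0%N, (fun=> 0), (fun=> fun=> 0); split=> [[]//|b].
  by rewrite big_ord0.
rewrite -(u g) => [|q]; last by rewrite hg.
by rewrite (u 0) // => q; rewrite mul0r sigma0.
Qed.

Lemma sigma_eq0_R g : (forall f, sigma (g * toQ f) = 0) -> g = 0.
Proof.
move=> hg; apply: sigma_eq0 => q; have [f [k ->]] := Q_fracE X q.
by rewrite mulrA sigma_frac hg mul0r.
Qed.

Lemma trace_inj g g' : (forall q, sigma (g * q) = sigma (g' * q)) -> g = g'.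
Proof.
move=> hg; apply/eqP; rewrite -subr_eq0; apply/eqP/sigma_eq0 => q.
have := sigmaD ((g - g') * q) (g' * q); rewrite -mulrDl subrK hg.
by move/esym/eqP; rewrite -subr_eq0 addrK => /eqP.
Qed.

(** [trace_map] provides [g] without a degree. Since [Phi] and [sigma] are homogeneous, the
    component of degree d of [g] represents [Phi] too, and injectivity of the representation
    identifies the two. *)
Lemma trace_rep d Phi : hom_deg (@Q_deg K n I) (@L0 K n I) d Phi ->
  exists2 g, Q_deg d g & forall q, Phi q = sigma (g * q).
Proof.
move=> hPhi; have [|g [hg _]] := tr.2 Phi.
  by exists 1%N, (fun=> d), (fun=> Phi); split=> // b; rewrite big_ord_recl big_ord0 addr0.
exists g => //; rewrite (_ : g = Qcomponent X d g); first exact: Qcomponent_deg.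
apply: trace_inj => q; have [N [F [t [-> ht]]]] := Q_decompose X q.
rewrite !mulr_sumr !sigma_sum; apply: eq_bigr => k _.
have [M [G [u [gE hu]]]] := Q_decompose X g.
have := hPhi.2 _ _ (ht k); rewrite hg => /(Q_degP X) <-.
rewrite gE mulr_suml (Qcomponent_sum X) mulr_suml !sigma_sum (Qcomponent_sum X).
apply: eq_bigr => i _.
rewrite (Qcomponent_id X _ (hu i)).
rewrite (Qcomponent_id X _ (sigma_deg (Q_degM X (hu i) (ht k)))).
rewrite (_ : (_ == _) = (d == u i)); last by apply/eqP/eqP; lia.
by case: eqP => // _; rewrite mul0r sigma0.
Qed.

(* For homogeneous [g] this is membership in the complementary module. *)
Definition integral_trace g := forall f, exists P, sigma (g * toQ f) = toQ (ev P).

Lemma complementary_integral g : complementary_module sigma g -> integral_trace g.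
Proof.
move=> [phi [m [d [psi [hpsi phiE]]]] hphi] f.
have : Kx0 (phi f).
  rewrite phiE; elim/big_ind: _ => [|a b /Kx0P [P ->] /Kx0P [P' ->]|k _].
  - by apply/Kx0P; exists 0; rewrite rmorph0.
  - by apply/Kx0P; exists (P + P'); rewrite rmorphD.
  - by case: (hpsi k) => -[].
move=> /Kx0P [P e]; exists P; rewrite -e.
by have := hphi f 0%N; rewrite expr0 !divr1.
Qed.

Lemma L0_QC c : L0 (QC I c).
Proof. by rewrite /QC -evx0C; apply: L0_ev. Qed.

Lemma integral_hom_deg d g (P : R -> {poly K}) : Q_deg d g ->
  (forall f, sigma (g * toQ f) = toQ (ev (P f))) ->
  hom_deg (@coord_deg K n I) (@Kx0 K n I) d (fun f => ev (P f)).
Proof.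
move=> hd hP; split; first split.
- by move=> b; apply/Kx0P; exists (P b).
- move=> a b b' /Kx0P [A ->]; apply: (@toQ_inj K n I).
  rewrite -hP rmorphD rmorphM /= mulrDr mulrCA sigmaL; last exact: L0_ev.
  by rewrite !hP ?rmorphD ?rmorphM.
- move=> k b hb; apply/(coord_deg_toQ X); rewrite -hP; apply: sigma_deg.
  by rewrite [k + d]addrC; apply: (Q_degM X) => //; apply/(coord_deg_toQ X).
Qed.

(** [complementary_module] asks for a finite sum of homogeneous maps; the components of the possibly
    inhomogeneous [a] provide the summands. *)
Lemma integral_complementary d g a : Q_deg d g -> integral_trace g ->
  complementary_module sigma (toQ a * g).
Proof.
move=> hd /choice [P hP]; have [N /(_ N (leqnn N)) aE] := component_bound a.
have E b f : sigma (toQ b * g * toQ f) = toQ (ev (P (b * f))).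
  by rewrite -hP [toQ (b * f)]rmorphM [toQ b * g]mulrC mulrA.
exists (fun f => ev (P (a * f))); last first.
  by move=> f k; rewrite mulrA sigma_frac E.
exists N, (fun i => i%:Z + d), (fun i f => ev (P (component i a * f))); split.
  move=> i; apply: (integral_hom_deg (g := toQ (component i a) * g)).
    by apply: (Q_degM X) => //; apply/(coord_deg_toQ X); apply: component_deg.
  by move=> f; rewrite E.
move=> b; apply: (@toQ_inj K n I); rewrite -hP rmorph_sum /=.
rewrite {1}aE mulr_suml rmorph_sum mulr_sumr sigma_sum.
by apply: eq_bigr => i _; rewrite hP.
Qed.

(* Double duality in the lowest degree: linear functionals on [R_r / x0 R_(r-1)]
   extend to [K[x0]]-linear maps [R -> K[x0]] of degree [-r]. *)
Lemma complementary_detects f : coord_deg r f -> ~ principal x f ->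
  exists g, [/\ Q_deg (- r%:Z) g, complementary_module sigma g & g * toQ f <> 0].
Proof.
move=> hf nf.
pose V := @coord_deg K n I r; pose W w := V w /\ principal x w.
have sV : subspace (@coordC K n I) V by apply: coord_deg_subspace.
have sW : subspace (@coordC K n I) W.
  split; first by split; [exact: sV.1|exact: (principal_ideal x).1].
  move=> c a b [Va pa] [Vb pb]; split; first exact: sV.2.
  exact: (principal_ideal x).2.
have fV : fin_span (@coordC K n I) V W.
  have [m [e se]] := deg_fin I r; exists m, e => v /se [c hc]; exists c.
  by rewrite -hc; apply: sW.1.
have [l [lL lW lf]] := exists_functional sV.1 sW fV hf (fun h : W f => nf h.2).
have l0 : l 0 = 0 by apply: lW; [exact: sW.1|exact: sV.1].
(* [D (i, h)] is the component of degree r + i of [h] divided by x0^i. Below, [phi h] is the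
   polynomial in x0 with coefficients l (D (i, h)). *)
have /choice [D hD] : forall ih : nat * R, exists g, V g /\
    x ^+ ih.1 * g = component (r + ih.1) ih.2.
  move=> [i h] /=; have [||g hg e] := divide_x0 X (d := r) (e := (r + i)%N)
    (f := component (r + i) h).
  - by rewrite leqnn leq_addr.
  - exact: component_deg.
  by exists g; rewrite e addKn.
have uD i h g : V g -> x ^+ i * g = component (r + i) h -> D (i, h) = g.
  by move=> Vg e; apply: (x0n_inj X (k := i)); rewrite /= (hD (i, h)).2 e.
have D0 i h : component (r + i) h = 0 -> D (i, h) = 0.
  by move=> e; apply: uD; [exact: sV.1|rewrite mulr0 e].
have /choice [phi hphi] : forall h, exists g, forall i,
    component i g = coordC I (l (D (i, h))) * x ^+ i.
  move=> h; have [N hN] := component_ge homI h.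
  apply: (components_exist homI (N := N)) => i.
    by apply: coord_degCM; apply: coord_deg_x0n.
  move=> Ni; rewrite D0 ?l0 ?rmorph0 ?mul0r //; apply: hN.
  by apply: leq_trans Ni (leq_addl _ _).
have phiL c h h' : phi (coordC I c * h + h') = coordC I c * phi h + phi h'.
  apply: component_ext => i; rewrite componentD // componentCM // !hphi.
  have Vd h0 : V (D (i, h0)) by case: (hD (i, h0)).
  have -> : D (i, coordC I c * h + h') = coordC I c * D (i, h) + D (i, h').
    apply: uD; first exact: sV.2.
    rewrite componentD // componentCM // -(hD (i, h)).2 -(hD (i, h')).2 /=.
    by ring.
  by rewrite lL //; [rewrite rmorphD rmorphM /=; ring|exact: sV.2].
have phi0 : phi 0 = 0.
  apply: component_ext => i; rewrite hphi D0 ?component0 // l0.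
  by rewrite rmorph0 mul0r.
have phiD h h' : phi (h + h') = phi h + phi h'.
  by have := phiL 1 h h'; rewrite rmorph1 !mul1r.
have phiC c h : phi (coordC I c * h) = coordC I c * phi h.
  by have := phiL c h 0; rewrite phi0 !addr0.
have phix h : phi (x * h) = x * phi h.
  apply: component_ext => i; rewrite (componentMl homI _ _ (coord_deg_x0 I)).
  (* In degree 0, compatibility with x0 is the vanishing of [l] on multiples of x0; in higher
     degrees both sides use the same quotient. *)
  rewrite !hphi; case: i => [|i] /=.
    rewrite lW ?rmorph0 ?mul0r //; last by case: (hD (0%N, x * h)).
    split; first by case: (hD (0%N, x * h)).
    have := (hD (0%N, x * h)).2; rewrite /= expr0 mul1r => ->.
    rewrite (componentMl homI _ _ (coord_deg_x0 I)); case: ifP => _.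
      by exists (component (r + 0 - 1) h).
    by case: (principal_ideal x).
  rewrite subSS subn0 (_ : D (i.+1, x * h) = D (i, h)); last first.
    apply: uD; first by case: (hD (i, h)).
    rewrite (componentMl homI _ _ (coord_deg_x0 I)) addnS subSS subn0 /=.
    by rewrite -(hD (i, h)).2 exprS mulrA.
  by rewrite exprS; ring.
have phi_ev P h : phi (ev P * h) = ev P * phi h.
  elim/poly_ind: P h => [|P c ih] h; first by rewrite rmorph0 !mul0r.
  rewrite rmorphD rmorphM /= evx0C evx0X.
  by rewrite mulrDl phiD phiC -mulrA ih phix; ring.
have phi_deg (k : int) h : coord_deg k h -> coord_deg (k + - r%:Z) (phi h).
  case: k => k hk; last by rewrite [h]hk phi0; apply: coord_deg0.
  have hi (i : nat) : (r + i)%N <> k -> component i (phi h) = 0.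
    move=> ik; rewrite hphi D0 ?l0 ?rmorph0 ?mul0r //.
    by rewrite (component_id homI _ hk); case: eqP.
  have [rk|kr] := leqP r k.
    rewrite (_ : phi h = component (k - r) (phi h)).
      rewrite (_ : _ + _ = (k - r)%N%:Z); last by lia.
      exact: component_deg.
    apply: component_ext => i.
    rewrite (component_id homI _ (component_deg _ _)); case: eqP => [->//|ne].
    by apply: hi; lia.
  rewrite (_ : phi h = 0); first exact: coord_deg0.
  by apply: component_ext => i; rewrite component0 // hi //; lia.
have phif : phi f = 1.
  have fE : phi f = component 0 (phi f).
    apply: component_ext => i; rewrite (component_id homI _ (component_deg _ _)).
    have := phi_deg r f hf; rewrite subrr => h0.
    by rewrite !(component_id homI _ h0).
  rewrite fE hphi expr0 mulr1 (uD 0%N f f) ?lf ?rmorph1 //.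
  by rewrite expr0 mul1r addn0 (component_id homI _ hf) eqxx.
have phi_Kx0 h : exists P, phi h = ev P.
  have [N hN] := component_ge homI (phi h).
  exists (\poly_(i < N) l (D (i, h))); apply: component_ext => i.
  rewrite component_evx0 // coef_poly; case: ltnP => iN; first by rewrite hphi.
  by rewrite hN // rmorph0 mul0r.
have phi_x0n k h : phi (x ^+ k * h) = x ^+ k * phi h.
  by rewrite -evx0X -rmorphXn phi_ev.
(* The extension of [phi] to Q^h(R) by x0-linearity, to be represented by the trace map. *)
pose Phi q := toQ (phi (Qnum X q)) / y ^+ Qexp X q.
have PhiE h k : Phi (toQ h / y ^+ k) = toQ (phi h) / y ^+ k.
  apply/(Q_fracP X); rewrite -!phi_x0n; congr phi.
  by apply/(Q_fracP X); rewrite -(Qnum_frac X).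
have [|g hg gE] := @trace_rep (- r%:Z) Phi.
  split; first split.
  - by move=> q; have [h [k ->]] := Q_fracE X q; have [P hP] := phi_Kx0 h;
      rewrite PhiE hP; apply: L0_frac.
  - move=> a q q' /L0P [P [k ->]]; have [h [h' [k' [-> ->]]]] := Q_frac2 X q q'.
    rewrite mulrACA -invrM ?(Qy_unit X) // -exprD.
    have -> : toQ h' / y ^+ k' = toQ (x ^+ k * h') / y ^+ (k' + k).
      by apply/(Q_fracP X); rewrite exprD mulrA.
    rewrite -rmorphM /= Q_frac_addE !PhiE phiD phi_ev phi_x0n.
    rewrite -Q_frac_addE [toQ (_ * _)]rmorphM mulrACA -invrM ?(Qy_unit X) // -exprD.
    by congr (_ + _); apply/(Q_fracP X); rewrite exprD mulrA.
  - move=> i q /(Q_degE X) [k [h [hh ->]]]; rewrite PhiE.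
    apply: (Q_deg_frac X).
    by rewrite addrAC; apply: phi_deg.
have gR h : sigma (g * toQ h) = toQ (phi h).
  by rewrite -gE -[toQ h]divr1 -(expr0 y) PhiE expr0 divr1.
exists g; split=> //.
  rewrite -[g]mul1r -(rmorph1 (@toQ K n I)); apply: integral_complementary hg _.
  by move=> h; have [P hP] := phi_Kx0 h; exists P; rewrite gR hP.
move=> e; have := gR f; rewrite e sigma0 phif rmorph1 => /eqP.
by rewrite eq_sym oner_eq0.
Qed.

End Trace.

(** * Stalks *)

(** On the line t g' + g each of the first k + 1 bad subspaces excludes at most one t: two excluded
    values would put g', and then also g, into it, while one of them is known to lie outside. *)
Lemma avoid_subspaces (K : fieldType) (B : comNzRingType) (h : {rmorphism K -> B})
    (V : B -> Prop) s (bad : 'I_s -> B -> Prop) :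
  (forall l : seq K, exists x, x \notin l) -> subspace h V ->
  (forall j, subspace h (bad j)) -> (forall j, exists2 g, V g & ~ bad j g) ->
  exists2 g, V g & forall j, ~ bad j g.
Proof.
move=> infK sV sb hV.
suff /(_ s (leqnn s)) [g Vg hg] : forall k, (k <= s)%N ->
    exists2 g, V g & forall j : 'I_s, (j < k)%N -> ~ bad j g.
  by exists g => // j; apply: hg.
elim=> [|k ih] ks; first by exists 0; [exact: sV.1|].
have [g Vg hg] := ih (ltnW ks); have [g' Vg' hg'] := hV (Ordinal ks).
have hT (j : 'I_s) : exists t, (j < k.+1)%N ->
    forall t', bad j (h t' * g' + g) -> t' = t.
  have [[t ht]|nt] := pselect (exists t, bad j (h t * g' + g)); last first.
    by exists 0 => _ t' ht'; case: nt; exists t'.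
  exists t => jk t' ht'; apply/eqP; apply: contrapT => /negP tt'.
  have bg' : bad j g'.
    have := subspaceZ (t' - t)^-1 (sb j) (subspaceB (sb j) ht' ht).
    rewrite (_ : _ * _ = g') // opprD addrACA subrr addr0 -mulrBl -rmorphB.
    by rewrite mulrA -rmorphM mulVf ?rmorph1 ?mul1r // subr_eq0.
  move: jk; rewrite ltnS leq_eqVlt => /predU1P [jk|jk].
    by apply: hg'; rewrite (_ : Ordinal ks = j) //; apply: val_inj.
  apply: (hg j jk); rewrite (_ : g = h t * g' + g - h t * g'); last by ring.
  by apply: subspaceB ht _ => //; apply: subspaceZ.
have [T TP] := choice hT.
have [t ht] := infK [seq T j | j <- enum 'I_s].
exists (h t * g' + g); first exact: sV.2.
move=> j jk /(TP j jk) e; case/negP: ht; rewrite e.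
by apply: map_f; rewrite mem_enum.
Qed.

Section Stalks.
Variables (K : fieldType) (n : nat) (I : idealr {mpoly K[n.+1]}).
Local Notation R := (coord_ring I).
Local Notation x := (x0 I).

Fact stalkC_zmod (P : prime_idealr R) : zmod_morphism (@stalkC K n I P).
Proof. by move=> a b; apply: val_inj; rewrite /= !rmorphB. Qed.
Fact stalkC_monoid (P : prime_idealr R) : monoid_morphism (@stalkC K n I P).
Proof. by split=> [|a b]; apply: val_inj; rewrite /= ?rmorph1 // !rmorphM. Qed.
HB.instance Definition _ P :=
  GRing.isZmodMorphism.Build _ _ (@stalkC K n I P) (stalkC_zmod P).
HB.instance Definition _ P :=
  GRing.isMonoidMorphism.Build _ _ (@stalkC K n I P) (stalkC_monoid P).

Variables (s : nat) (p : 'I_s -> prime_idealr R) (r : nat).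
Hypothesis X : zero_dim_scheme p r.
Let homI : homogeneous_ideal I. Proof. by case: X. Qed.
Local Notation O j := (stalk (p j)).
Local Notation tl j := (toloc (hcompl_mulset (p j))).

Lemma stalk_val_inj j : injective (@stalk_val K n I (p j)).
Proof. exact: val_inj. Qed.

Lemma stalk_valM j (a b : O j) : stalk_val (a * b) = stalk_val a * stalk_val b.
Proof. by []. Qed.

Lemma stalk_val0 j : stalk_val (0 : O j) = 0.
Proof. by []. Qed.

Lemma x0n_hcompl j k : x ^+ k \in hcompl (p j).
Proof.
apply/asboolP; split; last exact: (x0n_notin X).
by exists k; apply: coord_deg_x0n.
Qed.

Lemma tl_unit j k : tl j x ^+ k \is a GRing.unit.
Proof. by rewrite -rmorphXn; apply: toloc_unit; apply: x0n_hcompl. Qed.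

Lemma germD j i f f' : germ (p j) i (f + f') = germ (p j) i f + germ (p j) i f'.
Proof. by rewrite /germ rmorphD mulrDl. Qed.

Lemma germM j i k f f' :
  germ (p j) (i + k) (f * f') = germ (p j) i f * germ (p j) k f'.
Proof. by rewrite /germ rmorphM exprD invrM ?tl_unit //= [X in _ * X = _]mulrC mulrACA. Qed.

Lemma germ_x0n j k : germ (p j) k (x ^+ k) = 1.
Proof. by rewrite /germ rmorphXn /= divrr ?tl_unit. Qed.

Lemma germ_mulx0n j i k f : germ (p j) (k + i) (x ^+ k * f) = germ (p j) i f.
Proof. by rewrite germM germ_x0n mul1r. Qed.

Lemma germ_eq0 j i f : germ (p j) i f = 0 <-> germ_ker p j f.
Proof.
rewrite -germ_kerP /germ; split=> [e|->]; last by rewrite mul0r.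
have u : (tl j x ^+ i)^-1 \is a GRing.unit by rewrite unitrV tl_unit.
by apply: (mulIr u); rewrite mul0r.
Qed.

Lemma germC j c : germ (p j) 0 (coordC I c) = stalk_val (stalkC (p j) c).
Proof. by rewrite /germ expr0 divr1. Qed.

Lemma stalk_germ j (i : nat) f : coord_deg i f ->
  exists a : O j, stalk_val a = germ (p j) i f.
Proof.
move=> hf; have h : germ (p j) i f \in @stalk_pred K n I (p j).
  apply/asboolP; exists i, f, (x ^+ i); split=> //.
  - exact: coord_deg_x0n.
  - exact: x0n_hcompl.
  - by rewrite /germ rmorphXn.
by exists (Stalk h).
Qed.

(** Up to an element of the germ kernel, the denominator of [a] divides a power x0^m, so [a] is the
    germ of a form of degree m. [germ_extension] makes it vanish at the other points and [divide_x0]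
    lowers the degree to r. *)
Lemma stalk_lift j (a : O j) : exists h, [/\ coord_deg r h,
  germ (p j) r h = stalk_val a & forall l, l != j -> germ (p l) r h = 0].
Proof.
have /asboolP [d [f [g [hf hg sg aE]]]] : stalk_val a \in @stalk_pred K n I (p j).
  by case: a.
have [M hM] := germ_extension X j.
have [|||N hN] := @cofinite _ _ _ _ _ _ X (addI (principal g) (germ_ker p j)).
- by apply: addI_ideal; [exact: principal_ideal|exact: germ_ker_ideal].
- apply: addI_homogeneous => //; last exact: (germ_ker_homogeneous X).
  exact: (principal_homogeneous homI hg).
- move=> l; have [->|jl] := eqVneq l j.
    exists g; last by have /asboolP [] := sg.
    exists g, 0; split; rewrite ?addr0 //; first by exists 1; rewrite mulr1.
    by case: (germ_ker_ideal p j).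
  rewrite eq_sym in jl; have [t [ht _ nt]] := germ_ker_separate X jl.
  exists t => //; exists 0, t; split; rewrite ?add0r //.
  by case: (principal_ideal g).
(* Large enough to apply [hN] and [germ_extension], to subtract the degree of [g], and to divide
   down to degree r. *)
pose m := (N + d + M + r)%N.
have [||_ [w [[k ->] hw e]]] := hN m _ (x ^+ m); [by rewrite /m; lia|exact: coord_deg_x0n|].
have {}e : x ^+ m = g * component (m - d) k + component m w.
  have := congr1 (component m) e; rewrite componentD // (componentMl homI _ _ hg).
  rewrite (component_id homI _ (coord_deg_x0n I m)) eqxx => ->.
  by rewrite (_ : (d <= m)%N = true) //; rewrite /m; lia.
have {}hw := germ_ker_homogeneous X m hw.
have hk := component_deg (m - d)%N k.
move: (component _ k) (component _ w) e hw hk => {}k {}w e hw hk.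
have hfk : coord_deg m (f * k).
  have -> : m = (d + (m - d))%N by rewrite /m; lia.
  exact: coord_degM.
have fkE : germ (p j) m (f * k) = stalk_val a.
  rewrite aE /germ -rmorphXn /= e rmorphD rmorphM /=.
  have -> : tl j w = 0 by apply/germ_kerP.
  have ux : tl j (g * k) \is a GRing.unit.
    have := tl_unit j m; rewrite -rmorphXn /= e rmorphD /=.
    by have -> : tl j w = 0 by [apply/germ_kerP]; rewrite addr0.
  move: (ux); rewrite addr0 !rmorphM /= unitrM => /andP [ug uk].
  by rewrite invrM // mulrA mulrK.
have [h [hh hj hl]] := hM m ltac:(rewrite /m; lia) _ hfk.
have [|h' hh' hE] := divide_x0 X (d := r) _ hh; first by rewrite /m; lia.
have gE l : germ (p l) r h' = germ (p l) m h.
  rewrite hE -[X in germ _ X _ = _]addn0 -(germ_mulx0n l _ (m - r)).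
  by congr germ; rewrite /m; lia.
exists h'; split=> //; last by move=> l lj; rewrite gE; apply/germ_eq0/hl.
rewrite gE -fkE -[f * k](subrK h) germD.
by have /germ_eq0 -> := hj; rewrite add0r.
Qed.

Lemma stalk_nonunit j (a : O j) (i : nat) f : coord_deg i f ->
  stalk_val a = germ (p j) i f -> (nonunit a <-> f \in p j).
Proof.
move=> hf aE; split=> [na|pf [b ab]].
  apply: contrapT => /negP nf; apply: na.
  have sf : f \in hcompl (p j) by apply/asboolP; split=> //; exists i.
  have h : tl j (x ^+ i) / tl j f \in @stalk_pred K n I (p j).
    apply/asboolP; exists i, (x ^+ i), f; split=> //; exact: coord_deg_x0n.
  exists (Stalk h); apply: val_inj => /=; rewrite aE /germ rmorphXn /=.
  have uf : tl j f \is a GRing.unit by apply: (toloc_unit (S := hcompl_mulset (p j))).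
  by rewrite mulrA mulrVK ?tl_unit // divrr.
have [h [hh bE _]] := stalk_lift b.
have : germ (p j) (i + r) (f * h - x ^+ (i + r)) = 0.
  rewrite -[- x ^+ _]mulN1r germD.
  have -> : germ (p j) (i + r) (-1 * x ^+ (i + r)) = -1.
    by rewrite -[(i + r)%N]add0n germM germ_x0n mulr1 /germ rmorphN1 expr0 divr1.
  by rewrite germM -aE bE -[_ * _]/(stalk_val (a * b)) ab subrr.
move=> /germ_eq0 /germ_ker_sub h1.
have h2 : f * h \in p j by rewrite mulrC primeMr.
case/negP: (x0n_notin X j (i + r)).
by rewrite -[x ^+ _](subKr (f * h)) rpredB.
Qed.

Lemma nonunit_subspace j : subspace (@stalkC K n I (p j)) (@nonunit (O j)).
Proof.
have hr (a : O j) : exists h, [/\ coord_deg r h, stalk_val a = germ (p j) r h &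
    nonunit a <-> h \in p j].
  have [h [hh e _]] := stalk_lift a; exists h; split=> //.
  exact: (stalk_nonunit hh (esym e)).
split.
  have e : stalk_val (0 : O j) = germ (p j) 0 0 by rewrite /germ rmorph0 mul0r.
  by apply/(stalk_nonunit (coord_deg0 _ _) e); apply: prime0.
move=> c a b na nb; have [h [hh aE ha]] := hr a; have [h' [hh' bE hb]] := hr b.
have hd : coord_deg r (coordC I c * h + h').
  by apply: (coord_deg_subspace I r).2.
apply/(stalk_nonunit (a := stalkC (p j) c * a + b) hd).
  rewrite germD -[X in germ _ X (_ * _)]add0n germM germC -aE -bE.
  by [].
by rewrite rpredD ?primeMr //; [apply/ha|apply/hb].
Qed.

Lemma stalk_fin j : fin_span (@stalkC K n I (p j)) (fun=> True) (eq 0).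
Proof.
have [e [Ve _ Se]] := fin_span_dim (coord_deg_subspace I r).1 (subspace0 _) (deg_fin I r).
have /choice [E hE] : forall k, exists a : O j, stalk_val a = germ (p j) r (e k).
  by move=> k; apply: stalk_germ.
exists _, E => v _; have [h [/Se [c hc] vE _]] := stalk_lift v.
exists c; apply/esym/eqP; rewrite subr_eq0; apply/eqP/val_inj.
rewrite -[val v]/(stalk_val v) -vE.
move/esym/eqP: hc; rewrite subr_eq0 => /eqP ->.
rewrite /comb -[val _]/(stalk_val _).
elim/big_rec2: _ => [|k a b _ IH]; first by rewrite /germ rmorph0 mul0r.
by rewrite germD IH -[X in germ _ X (_ * _)]add0n germM germC -hE.
Qed.

Lemma stalk_socle j : exists z : O j, z <> 0 /\ forall a, nonunit a -> a * z = 0.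
Proof.
have nuM (a b : O j) : nonunit b -> nonunit (a * b).
  by move=> nb [c e]; apply: nb; exists (a * c); rewrite mulrCA mulrA.
have hM : is_ideal (@nonunit (O j)).
  split=> [|a b c na nb]; first exact: (nonunit_subspace j).1.
  by have := (nonunit_subspace j).2 1 _ _ (nuM c a na) nb; rewrite rmorph1 mul1r.
have [||||||z [zM zn]] := @socle_exists K (O j) (@stalkC K n I (p j)) (eq 0)
    (@nonunit (O j)).
- by split=> // a b c <- <-; rewrite mulr0 addr0.
- exact: hM.
- by apply; exists 1; rewrite mulr1.
- move=> a b nab; apply: contrapT => /not_orP [/contrapT [a' ha] /contrapT [b' hb]].
  by apply: nab; exists (a' * b'); rewrite mulrACA ha hb mulr1.
- by move=> _ <-; exact: hM.1.
- exact: stalk_fin.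
exists z; split=> [z0|a na]; last by rewrite -(zM a na).
apply: (zn 1); last by rewrite mul1r z0.
by apply; exists 1; rewrite mulr1.
Qed.

End Stalks.

(** * The Cayley-Bacharach property and the different *)

Section CB.
Variables (K : fieldType) (n : nat) (I : idealr {mpoly K[n.+1]}).
Local Notation R := (coord_ring I).
Local Notation x := (x0 I).
Variables (s : nat) (p : 'I_s -> prime_idealr R) (r : nat).
Hypothesis X : zero_dim_scheme p r.
Let homI : homogeneous_ideal I. Proof. by case: X. Qed.
Local Notation Q := (Qh I).
Local Notation O j := (stalk (p j)).
Local Notation y := (Qx I).
Local Notation ev := (@evx0 K n I).
Variable sigma : Q -> Q.
Hypothesis tr : trace_map sigma.
Hypothesis infK : forall l : seq K, exists x, x \notin l.
Hypothesis CB : cayley_bacharach p r.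

Lemma Q_deg_r (q : Q) : Q_deg r q -> exists2 f, coord_deg r f & q = toQ f.
Proof.
move=> /(Q_degE X) [k [f [hf ->]]].
have [|g hg e] := divide_x0 X (d := r) _ hf; first by rewrite leqnn leq_addr.
exists g => //; rewrite e addKn rmorphM /= mulrC -QxE mulKr //.
exact: (Qy_unit X).
Qed.

(* The germ at [p j] of the degree-zero element [x0^r g] is not a unit. *)
Definition nonunit_at j (g : Q) :=
  exists f, [/\ coord_deg r f, toQ f = y ^+ (r + r) * g & f \in p j].

Lemma nonunit_at_subspace j : subspace (@QC K n I) (nonunit_at j).
Proof.
split.
  by exists 0; rewrite rmorph0 mulr0; split=> //; [exact: coord_deg0|exact: prime0].
move=> c a b [f [hf fE pf]] [f' [hf' fE' pf']].
exists (coordC I c * f + f'); split.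
- exact: (coord_deg_subspace I r).2.
- by rewrite rmorphD rmorphM /= fE fE' mulrDr mulrCA.
- by rewrite rpredD ?primeMr.
Qed.

(** The part C_(-r) of the complementary module, phrased by traces so that closure under linear
    combinations is immediate. *)
Definition lowest (g : Q) := Q_deg (- r%:Z) g /\ integral_trace sigma g.

Lemma lowest_subspace : subspace (@QC K n I) lowest.
Proof.
split; first split; first exact: (Q_deg0 X).
  by move=> f; exists 0; rewrite mul0r (sigma0 tr) !rmorph0.
move=> c a b [ha ta] [hb tb]; split; first exact: (Q_deg_subspace X _).2.
move=> f; have [P hP] := ta f; have [P' hP'] := tb f.
exists (c%:P * P + P'); rewrite mulrDl -mulrA (sigmaL tr); last exact: L0_QC.
by rewrite hP hP' rmorphD rmorphM /= evx0C rmorphD rmorphM.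
Qed.

(** Otherwise [complementary_detects] gives g in C_(-r) with g h non-zero. But the germ of x0^r g at
    [p j] is a non-unit and kills a z, and the other germs of [h] are zero. *)
Lemma socle_lift_divisible j (z : O j) h :
  (forall g, lowest g -> nonunit_at j g) ->
  (forall a, nonunit a -> a * z = 0) -> coord_deg r h ->
  (exists a, germ (p j) r h = stalk_val (a * z)) ->
  (forall l, l != j -> germ (p l) r h = 0) -> principal x h.
Proof.
move=> bad zsoc hh [a hj] hl.
apply: contrapT => /(complementary_detects X tr hh) [g [dg cg]]; apply.
have [f [hf fE pf]] := bad g (conj dg (complementary_integral cg)).
have fh : f * h = 0.
  apply: (germ_ker_eq0 X) => l; apply/(germ_eq0 X l (r + r)); rewrite (germM X).
  have [->|lj] := eqVneq l j; last by rewrite hl // mulr0.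
  have [b bE] := stalk_germ X j hf.
  have nb : nonunit b by apply/(stalk_nonunit X hf bE).
  by rewrite hj -bE -stalk_valM mulrCA zsoc // mulr0 stalk_val0.
apply: (mulrI (Qy_unit X (r + r))).
by rewrite mulr0 mulrA -fE -rmorphM fh rmorph0.
Qed.

Lemma deg_point_le j (z : O j) m : z <> 0 ->
  (forall a, nonunit a -> a * z = 0) -> (forall a, mu (a * z)%R <= m)%N ->
  (deg_point p j <= m)%N.
Proof.
move=> z0 zsoc mu_le.
have [d [e be]] := fin_span_basis (Logic.I : (fun=> True) 0) (nonunit_subspace X j)
  (fin_span_quotient (nonunit_subspace X j) (stalk_fin X j)).
have [hz [hhz hzj hzl]] := stalk_lift X z.
have hzz l : exists a : O l, stalk_val a = germ (p l) r hz by apply: (stalk_germ X).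
(* The family with [z] at [j] and 0 elsewhere. Reading it off the germs of one lift of [z] avoids a
   cast between the types [O l] and [O j]. *)
pose zz l := projT1 (cid (hzz l)).
have zzE l : stalk_val (zz l) = germ (p l) r hz := projT2 (cid (hzz l)).
have zzj : zz j = z by apply: stalk_val_inj; rewrite zzE.
have zzl l : l != j -> zz l = 0.
  by move=> lj; apply: stalk_val_inj; rewrite zzE hzl // stalk_val0.
pose J : subscheme p := fun l b => exists a, b = a * zz l.
have muJ : mu_subscheme j J (\max_k mu (e k * z)%R).
  by exists z, d, e; split=> // b; rewrite /J zzj.
have az_nonunit (a : O j) : a * z = 0 <-> nonunit a.
  split=> [az|]; last exact: zsoc.
  by move=> [b ab]; apply: z0; rewrite -[z]mul1r -ab mulrAC az mul0r.
have maxJ : maximal_point_subscheme j J.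
  split.
    split=> [k|k kj a [b ->]]; last by rewrite zzl // mulr0.
    split; first by exists 0; rewrite mul0r.
    by move=> _ _ c [a ->] [b ->]; exists (c * a + b); rewrite mulrDl mulrA.
  rewrite /deg_subscheme /degX (bigD1 j) //= [RHS](bigD1 j) //= addnAC.
  congr (_ + _)%N.
    have -> : @J j = (fun b => exists a, b = a * z).
      by apply/funext => b; rewrite /J zzj.
    exact: (dimK_socle (nonunit_subspace X j) az_nonunit (stalk_fin X j)).
  apply: eq_bigr => k kj; congr colength; apply/funext => b; apply/propext.
  split=> [[a ->]|<-]; first by rewrite zzl // mulr0.
  by exists 0; rewrite mul0r.
apply: leq_trans (minnat_le (ex_intro _ J (conj maxJ muJ))) _.
by apply/bigmax_leqP => k _; apply: mu_le.
Qed.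

Lemma lowest_unit_at j : exists2 g, lowest g & ~ nonunit_at j g.
Proof.
apply: contrapT => hn.
have bad g : lowest g -> nonunit_at j g.
  by move=> lg; apply: contrapT => ng; apply: hn; exists g.
have [z [z0 zsoc]] := stalk_socle X j.
have divided (a : O j) : exists h k, [/\ coord_deg r h, coord_deg (r - 1)%N k,
    h = x * k, germ (p j) r h = stalk_val (a * z) &
    forall l, l != j -> germ (p l) r h = 0].
  have [h [hh hj hl]] := stalk_lift X (a * z).
  have xh := socle_lift_divisible bad zsoc hh (ex_intro _ a hj) hl.
  have [k hk e] := principal_deg homI (coord_deg_x0 I) hh xh.
  by exists h, k.
(* A form of degree 0 divisible by x0 is zero, so r = 0 would make [z] zero. Positivity makes r - 1
   a true predecessor in the final contradiction. *)
have r0 : (0 < r)%N.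
  rewrite lt0n; apply/negP => /eqP r0.
  have [h [k [hh _ e hj _]]] := divided 1; apply: z0.
  have h0 : h = 0.
    have := component_id homI 0 hh; rewrite r0 eqxx => <-.
    by rewrite e (componentMl homI _ _ (coord_deg_x0 I)).
  apply: stalk_val_inj; rewrite -[z]mul1r -hj h0.
  by rewrite /germ rmorph0 mul0r.
have mu_le (a : O j) : (mu (a * z)%R <= r - 1)%N.
  have [h [k [hh hk e hj hl]]] := divided a.
  have gE l : germ (p l) (r - 1) k = germ (p l) r h.
    rewrite e -[x in x * k]expr1 -[X in germ _ X (_ * _)](subnKC r0).
    by rewrite (germ_mulx0n X).
  apply: minnat_le; exists k; split=> //; first by rewrite gE.
  by move=> l lj; rewrite gE; apply: hl.
have := deg_point_le z0 zsoc mu_le; have [->] := CB j.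
by rewrite leqNgt ltn_subrL r0.
Qed.

Lemma lowest_exists_unit : exists2 g, lowest g & g \is a GRing.unit.
Proof.
have [g lg ng] := avoid_subspaces infK lowest_subspace nonunit_at_subspace
  lowest_unit_at.
exists g => //.
have [f hf fE] : exists2 f, coord_deg r f & y ^+ (r + r) * g = toQ f.
  apply: Q_deg_r; rewrite (_ : r%:Z = (r + r)%N%:Z + - r%:Z); last by lia.
  apply: (Q_degM X) lg.1; rewrite QxE; apply/(coord_deg_toQ X).
  exact: coord_deg_x0n.
have uf : toQ f \is a GRing.unit.
  apply: (toloc_unit (S := hnzd_mulset I)); apply/(hnzdP X); split; first by exists r.
  by move=> j; apply/negP => pf; apply: (ng j); exists f.
by move: uf; rewrite -fE unitrM => /andP [].
Qed.
End CB.

(** * The Hilbert function of the different and the almost Gorenstein sequence *)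

Section Different.
Variables (K : fieldType) (n : nat) (I : idealr {mpoly K[n.+1]}).
Local Notation R := (coord_ring I).
Local Notation x := (x0 I).
Variables (s : nat) (p : 'I_s -> prime_idealr R) (r : nat).
Hypothesis X : zero_dim_scheme p r.
Local Notation Q := (Qh I).
Local Notation y := (Qx I).
Variable sigma : Q -> Q.
Hypothesis tr : trace_map sigma.
Variable g : Q.
Hypotheses (lg : lowest r sigma g) (ug : g \is a GRing.unit).

Lemma unit_complementary : complementary_module sigma g.
Proof.
by have := integral_complementary X tr 1 lg.1 lg.2; rewrite rmorph1 mul1r.
Qed.

Lemma Q_deg_inv i (q : Q) d : q \is a GRing.unit -> Q_deg d q -> forall q',
  Q_deg (i + d) (q * q') -> Q_deg i q'.
Proof.
move=> uq dq q' dqq'; apply/(Q_degP X); apply: (mulrI uq).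
have [N [F [t [q'E ht]]]] := Q_decompose X q'.
have -> : q * Qcomponent X i q' = Qcomponent X (i + d) (q * q').
  rewrite q'E mulr_sumr !(Qcomponent_sum X) mulr_sumr; apply: eq_bigr => k _.
  rewrite (Qcomponent_id X _ (ht k)).
  rewrite (Qcomponent_id X _ (Q_degM X dq (ht k))).
  rewrite (_ : (i + d == d + t k) = (i == t k)); last by apply/eqP/eqP; lia.
  by case: eqP => // _; rewrite mulr0.
by apply/(Q_degP X).
Qed.

Definition different_deg (i : int) (f : Q) := Q_deg i f /\ different sigma f.

Lemma different_subspace i : subspace (@QC K n I) (different_deg i).
Proof.
split; first by split; [exact: (Q_deg0 X)|move=> c _; exists 0; rewrite mul0r rmorph0].
move=> c a b [da ha] [db hb]; split; first exact: (Q_deg_subspace X _).2.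
move=> q cq; have [f fE] := ha q cq; have [f' fE'] := hb q cq.
by exists (coordC I c * f + f'); rewrite mulrDl -mulrA fE fE' rmorphD rmorphM.
Qed.

Lemma different_mul i f : different_deg i f ->
  exists2 b, coord_deg (i - r%:Z) b & g * f = toQ b.
Proof.
move=> [df /(_ _ unit_complementary) [b e]]; rewrite mulrC in e; exists b => //.
by apply/(coord_deg_toQ X); rewrite -e addrC; apply: (Q_degM X) lg.1 df.
Qed.

Lemma toQ_deg_subspace i : subspace (@QC K n I)
  (fun q => exists2 b, coord_deg i b & q = toQ b).
Proof.
split; first by exists 0; rewrite ?rmorph0 //; apply: coord_deg0.
move=> c _ _ [a ha ->] [b hb ->]; exists (coordC I c * a + b).
  exact: (coord_deg_subspace I i).2.
by rewrite rmorphD rmorphM.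
Qed.

Lemma toQ_deg_fin i : fin_span (@QC K n I)
  (fun q => exists2 b, coord_deg i b & q = toQ b) (eq 0).
Proof.
have [m [e se]] := deg_fin I i; exists m, (fun k => toQ (e k)) => _ [b /se [c hc] ->].
exists c; move/esym/eqP: hc; rewrite subr_eq0 => /eqP ->; rewrite /comb rmorph_sum.
by rewrite -sumrB big1 // => k _; rewrite rmorphM subrr.
Qed.

Lemma HF_toQ i : HF I i =
  dimK (@QC K n I) (fun q => exists2 b, coord_deg i b & q = toQ b) (eq 0).
Proof.
apply: (dimK_eq (phi := @toQ K n I)).
- exact: coord_deg_subspace.
- exact: subspace0.
- exact: toQ_deg_subspace.
- exact: subspace0.
- by move=> b hb; exists b.
- by move=> b _ e; apply: (@toQ_inj K n I); rewrite rmorph0.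
- by move=> c a b _ _; rewrite rmorphD rmorphM.
- exact: toQ_deg_fin.
- by move=> b _ <-; rewrite rmorph0.
- by move=> _ [b hb ->]; exists b; rewrite // subrr.
Qed.

Lemma HF_different_le i : (HF_different sigma i <= HF I (i - r%:Z))%N.
Proof.
rewrite HF_toQ; apply: (dimK_le (phi := fun f => g * f)).
- exact: different_subspace.
- exact: subspace0.
- exact: toQ_deg_subspace.
- exact: subspace0.
- by move=> f /different_mul.
- by move=> f _ e; apply: (mulrI ug); rewrite mulr0 -e.
- by move=> c a b _ _; rewrite mulrDr mulrCA.
- exact: toQ_deg_fin.
Qed.

Lemma HF_different_eq i : HF_different sigma i = HF I (i - r%:Z) ->
  forall b, coord_deg (i - r%:Z) b -> different sigma (g^-1 * toQ b).
Proof.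
rewrite HF_toQ => e b hb.
have [f [_ hf] /esym/eqP] := dimK_surj (phi := fun f => g * f)
   (different_subspace i) (subspace0 _) (toQ_deg_subspace (i - r%:Z)) (subspace0 _)
   (fun f => @different_mul i f)
   (fun f _ (e : 0 = g * f) => mulrI ug (etrans (mulr0 g) e))
   (fun c a b _ _ => etrans (mulrDr g _ b) (congr1 (+%R^~ _) (mulrCA g (QC I c) a)))
   (toQ_deg_fin _) e (ex_intro2 _ _ b hb erefl).
by rewrite subr_eq0 => /eqP ->; rewrite mulKr.
Qed.

(** Multiplication by h^-1 gives the missing inequality. [h] is kept apart from [g], because the
    image of 1 in an almost Gorenstein sequence may be another unit of degree -r. *)
Lemma HF_different_ge i h : h \is a GRing.unit -> Q_deg (- r%:Z) h ->
  (forall b, coord_deg (i - r%:Z) b -> different sigma (h^-1 * toQ b)) ->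
  HF_different sigma i = HF I (i - r%:Z).
Proof.
move=> uh dh hh; apply/eqP; rewrite eqn_leq HF_different_le /=.
(* [dimK] is 0 on infinite-dimensional spaces, so finiteness of the target has to precede the
   comparison. *)
have fin : fin_span (@QC K n I) (different_deg i) (eq 0).
  have [m [e se]] := toQ_deg_fin (i - r%:Z); exists m, (fun k => g^-1 * e k) => f hf.
  have [c hc] := se _ (different_mul hf); exists c.
  apply: (mulrI ug); rewrite mulr0 hc mulrBr; congr (_ - _).
  by rewrite /comb mulr_sumr; apply: eq_bigr => k _; rewrite mulrCA mulVKr.
rewrite HF_toQ; apply: (dimK_le (phi := fun f => h^-1 * f)).
- exact: toQ_deg_subspace.
- exact: subspace0.
- exact: different_subspace.
- exact: subspace0.
- move=> _ [b hb ->]; split; last exact: hh.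
  by apply: (Q_deg_inv uh dh); rewrite mulVKr //; apply/(coord_deg_toQ X).
- by move=> f _ e; apply: (mulrI (etrans (unitrV h) uh)); rewrite mulr0 -e.
- by move=> c a b _ _; rewrite mulrDr mulrCA.
- exact: fin.
Qed.

Lemma almost_gorensteinP :
  almost_gorenstein sigma r <-> HF_different sigma (r%:Z + 1) = HF I 1.
Proof.
have r1 : r%:Z + 1 - r%:Z = 1 by lia.
split=> [[psi [psiL psiC psi_deg psi_inj psi_m]]|e].
  have psiE f : psi f = toQ f * psi 1.
    have psi0 : psi 0 = 0.
      have := psiL 0 0 0; rewrite mul0r addr0 rmorph0 mul0r add0r => _.
      have := psiL 1 0 0; rewrite mul1r addr0 rmorph1 mul1r => e.
      by apply: (addrI (psi 0)); rewrite addr0 -e.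
    by have := psiL f 1 0; rewrite mulr1 addr0 psi0 addr0.
  have dpsi : Q_deg (- r%:Z) (psi 1).
    by have := psi_deg 0 1 (coord_deg1 I); rewrite sub0r.
  (* Injectivity of [psi] makes the form x0^(2r) psi(1) of R_r a non-zerodivisor, hence invertible
     in Q^h(R). *)
  have upsi : psi 1 \is a GRing.unit.
    have [f hf fE] : exists2 f, coord_deg r f & y ^+ (r + r) * psi 1 = toQ f.
      apply: (Q_deg_r X); rewrite (_ : r%:Z = (r + r)%N%:Z + - r%:Z); last by lia.
      apply: (Q_degM X) dpsi; rewrite QxE; apply/(coord_deg_toQ X).
      exact: coord_deg_x0n.
    have : toQ f \is a GRing.unit.
      apply: (toloc_unit (S := hnzd_mulset I)); apply/asboolP; split.
        by exists r.
      move=> k fk; apply: psi_inj; rewrite (psiE k) (psiE 0) rmorph0 mul0r.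
      apply: (mulrI (Qy_unit X (r + r))); rewrite mulr0 mulrCA fE.
      by rewrite -rmorphM mulrC fk rmorph0.
    by rewrite -fE unitrM => /andP [].
  rewrite -{2}r1; apply: (HF_different_ge upsi dpsi) => b; rewrite r1 => hb c hc.
  have ib : irrelevant b.
    apply: (deg_monomials (d := 1%N)) hb.
      split; first by exists (fun=> 0); rewrite big1 // => k _; rewrite mul0r.
      move=> _ _ a [u ->] [v ->]; exists (fun k => a * u k + v k).
      by rewrite mulr_sumr -big_split; apply: eq_bigr => k _; rewrite /= mulrDl mulrA.
    move=> m /eqP; rewrite mdeg_eq1 => /existsP [k /eqP ->].
    exists (fun j => (j == k)%:R); rewrite (bigD1 k) //= eqxx mul1r big1 ?addr0 //.
    by move=> j /negPf ->; rewrite mul0r.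
  have [f fE] := psi_m b c ib hc; exists f.
  by rewrite -mulrA fE (psiE f) mulrCA mulVr // mulr1.
have hb b : coord_deg 1 b -> different sigma (g^-1 * toQ b).
  by rewrite -{1}r1; apply: HF_different_eq; rewrite r1.
exists (fun f => toQ f * g); split.
- by move=> a f f'; rewrite rmorphD rmorphM /= mulrDl mulrA.
- by move=> f; apply: (integral_complementary X tr _ lg.1 lg.2).
- by move=> i f hf; apply: (Q_degM X) lg.1; apply/(coord_deg_toQ X).
- by move=> f f' /(mulIr ug) /(@toQ_inj K n I).
- move=> a c [u ->] hc.
  have hk k : exists b, toQ (coordX I k) * c = toQ b * g.
    have [b bE] := hb _ (coord_degX I k) c hc; exists b.
    by rewrite -bE [RHS]mulrC !mulrA mulrV // mul1r.
  have /choice [b bE] := hk.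
  exists (\sum_k u k * b k); rewrite !rmorph_sum !mulr_suml.
  by apply: eq_bigr => k _; rewrite !rmorphM /= -!mulrA bE.
Qed.

End Different.

(** * The socle modulo [x0] *)

Section CoordRing.
Variables (K : fieldType) (n : nat) (I : idealr {mpoly K[n.+1]}).
Local Notation R := (coord_ring I).
Hypothesis homI : homogeneous_ideal I.

Lemma deg0_const (f : R) : coord_deg 0 f -> exists c, f = coordC I c.
Proof.
move=> [g hg ->]; exists g@_0; rewrite /coordC; congr cls.
apply: msize1_polyC; rewrite msizeE; apply/bigmax_leqP_seq => m hm _.
by have /dhomogP -> := hg.
Qed.

Lemma component0_const (f : R) : exists c, component 0 f = coordC I c.
Proof. exact: deg0_const (component_deg 0 f). Qed.

Lemma irrelevant_multiples (J : R -> Prop) (w : R) : is_ideal J ->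
  (forall i, J (coordX I i * w)) -> forall f, component 0 f = 0 -> J (f * w).
Proof.
move=> hJ hX f f0.
have hJw : is_ideal (fun a => J (a * w)).
  split; first by rewrite mul0r; apply: hJ.1.
  by move=> a b c ha hb; rewrite mulrDl -mulrA; apply: hJ.2.
apply: (component_ideal hJw) => -[|d]; first by rewrite f0 mul0r; apply: hJ.1.
apply: (deg_monomials hJw) (component_deg d.+1 f) => m hm.
have [i hi] : exists i, (0 < m i)%N.
  apply: contrapT => /forallNP h; move: hm; rewrite mdegE big1 // => i _.
  by have /negP := h i; rewrite -eqn0Ngt => /eqP.
rewrite mpolyXE_id (bigD1 i) //= rmorphM rmorphXn /= -(prednK hi) exprS.
by rewrite -/(coordX I i) -!mulrA [coordX I i * _]mulrC -!mulrA; do 2!apply: idealM => //; rewrite mulrC.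
Qed.

Lemma irrelevant_prime : exists2 M : prime_idealr R,
  (forall f, (f \in M) <-> component 0 f = 0) & maximal_ideal M.
Proof.
have c0M (f g : R) : component 0 (f * g) = component 0 f * component 0 g.
  exact: (@component_lowM _ _ _ homI 0 0).
have [|||M hM] := @prime_exists R (fun f => component 0 f = 0).
- split=> [|a b c ha hb]; first exact: component0.
  by rewrite componentD // c0M ha hb mulr0 addr0.
- by rewrite (component_id homI 0 (coord_deg1 I)) => /eqP; rewrite oner_eq0.
- move=> a b; rewrite c0M.
  have [ca ->] := component0_const a; have [cb ->] := component0_const b.
  rewrite -rmorphM -(rmorph0 (@coordC K n I)) => /(@coordC_inj K n I)/eqP.
  by rewrite mulf_eq0 => /orP [] /eqP ->; [left|right].
exists M => // J MJ f Jf; apply/hM.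
have [c fE] := component0_const f; rewrite fE.
have [->|c0] := eqVneq c 0; first by rewrite rmorph0.
have Jc : coordC I c \in J.
  rewrite -fE -[component 0 f](subKr f) rpredB //; apply: MJ; apply/hM.
  by rewrite componentB // (component_id homI 0 (component_deg 0 f)) subrr.
have := idealMr (coordC I c^-1) Jc.
by rewrite -rmorphM mulVf // rmorph1 idealr1.
Qed.

End CoordRing.

Section Socle.
Variables (K : fieldType) (n : nat) (I : idealr {mpoly K[n.+1]}).
Local Notation R := (coord_ring I).
Local Notation x := (x0 I).
Variables (s : nat) (p : 'I_s -> prime_idealr R) (r : nat).
Hypothesis X : zero_dim_scheme p r.
Let homI : homogeneous_ideal I. Proof. by case: X. Qed.
Let pI := principal_ideal x.
Local Notation tl M := (toloc (prime_mulset M)).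

Definition socle_x0 (w : R) := forall i, principal x (coordX I i * w).

Lemma principal_x0_homogeneous : homogeneous_sub (principal x).
Proof. exact: (principal_homogeneous homI (coord_deg_x0 I)). Qed.

Lemma principal_above (d : nat) f : coord_deg d f -> (r < d)%N -> principal x f.
Proof.
move=> hf rd; have [|g _ ->] := divide_x0 X (d := r) (e := d) _ hf.
  by rewrite leqnn ltnW.
by rewrite -(prednK (n := (d - r)%N)) ?subn_gt0 // exprS -mulrA; exists (x ^+ (d - r).-1 * g).
Qed.

(** Otherwise multiplication by x0 would be a bijection from R_(r-1) to R_r, against the minimality
    of r. *)
Lemma top_exists : exists2 t, coord_deg r t & ~ principal x t.
Proof.
apply: contrapT => hn; apply: (scheme_HF_min X).
have all_pr t : coord_deg r t -> principal x t.
  by move=> ht; apply: contrapT => nt; apply: hn; exists t.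
apply: (dimK_eq (h := @coordC K n I) (h' := @coordC K n I) (phi := fun f : R => x * f)).
- exact: coord_deg_subspace.
- exact: subspace0.
- exact: coord_deg_subspace.
- exact: subspace0.
- move=> v; case: (r) => [|r'] hv.
    have -> : v = 0 := hv.
    by rewrite mulr0; apply: coord_deg0.
  rewrite -add1n; apply: coord_degM; first exact: coord_deg_x0.
  by rewrite (_ : r'.+1%:Z - 1 = r') in hv; last by lia.
- by move=> v _ /esym /(x0_nzd X) ->.
- by move=> c a b _ _; rewrite mulrDr mulrCA.
- exact: deg_fin.
- by move=> v _ <-; rewrite mulr0.
- move=> f hf; have [k hk fE] := principal_deg homI (coord_deg_x0 I) hf (all_pr f hf).
  case: (posnP r) => r0.
    exists 0; first exact: coord_deg0.
    rewrite mulr0 subr0; have := component_id homI 0 hf; rewrite r0 eqxx => <-.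
    by rewrite fE (componentMl homI _ _ (coord_deg_x0 I)).
  exists k; last by rewrite fE subrr.
  by rewrite (_ : r%:Z - 1 = (r - 1)%N); last by lia.
Qed.

Lemma top_socle t : coord_deg r t -> socle_x0 t.
Proof.
move=> ht i; apply: principal_above (ltnSn r); rewrite -add1n.
by apply: coord_degM => //; apply: coord_degX.
Qed.

(** An element outside the irrelevant ideal has a non-zero constant component, so a form divisible
    by x0 after localization is divisible already in R. The proportionality of [gorenstein_socle]
    thus descends, and a socle element sees only the constant component of its coefficient. *)
Lemma socle_unique : gorenstein R -> forall (d1 d2 : nat) w1 w2,
  coord_deg d1 w1 -> coord_deg d2 w2 -> socle_x0 w1 -> socle_x0 w2 ->
  ~ principal x w1 -> ~ principal x w2 ->
  exists c, principal x (w1 - coordC I c * w2).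
Proof.
move=> [_ gor] d1 d2 w1 w2 h1 h2 s1 s2 n1 n2.
have [M hM maxM] := irrelevant_prime homI; have {gor} gor := gor M maxM.
have xM : x \in M by apply/hM; rewrite (component_id homI 0 (coord_deg_x0 I)).
have nx : nonunit ((tl M) x).
  have := loc_nonunit x (prime1 M); rewrite rmorph1 divr1 => -[_]; exact.
have unit0 u : u \notin M -> exists2 c, c != 0 & component 0 u = coordC I c.
  move=> nu; have [c uE] := component0_const u; exists c => //.
  apply/eqP => c0; case/negP: nu; apply/hM; by rewrite uE c0 rmorph0.
have kill (d : nat) u f : u \notin M -> coord_deg d f -> principal x (u * f) ->
    principal x f.
  move=> /unit0 [c c0 uE] hf /(principal_x0_homogeneous d).
  rewrite (componentM homI _ _ hf) leqnn subnn uE => hc.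
  have := idealM (coordC I c^-1) pI hc.
  by rewrite mulrA -rmorphM mulVf // rmorph1 mul1r.
have zx b : (tl M) x * b = 0 -> b = 0.
  have [f [u [nu ->]]] := loc_frac b => e.
  have : (tl M) (x * f) = 0.
    apply: (mulIr (x := ((tl M) u)^-1)); first by rewrite unitrV loc_unit_notin.
    by rewrite mul0r rmorphM -mulrA.
  move=> /toloc_eq0 [v hv]; rewrite mulrCA => /(x0_nzd X) vf.
  suff -> : (tl M) f = 0 by rewrite mul0r.
  by apply/toloc_eq0; exists v.
have soc (w : R) : socle_x0 w -> socle_mod ((tl M) x) ((tl M) w).
  move=> sw b nb; have [f [u [nu bE]]] := loc_frac b.
  have fM : f \in M by apply/(loc_nonunit f nu); rewrite -bE.
  have [k fw] := irrelevant_multiples pI sw ((hM f).1 fM).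
  exists ((tl M) k / (tl M) u); rewrite bE mulrAC -rmorphM fw rmorphM /=.
  by rewrite mulrA.
have nsoc (d : nat) w : coord_deg d w -> ~ principal x w -> ~ principal ((tl M) x) ((tl M) w).
  by move=> hw nw /loc_principal [u nu /(kill _ _ _ nu hw)].
have [C hC] := gorenstein_socle nx zx
  (ex_intro _ ((tl M) w1) (conj (soc _ s1) (nsoc _ _ h1 n1))) gor
  (soc _ s1) (soc _ s2) (nsoc _ _ h1 n1) (nsoc _ _ h2 n2).
have [f [u [nu CE]]] := loc_frac C.
have : principal ((tl M) x) ((tl M) (u * w1 - f * w2)).
  case: hC => k kE; exists (tl M u * k); rewrite mulrCA -kE CE.
  have E : tl M u * (tl M f / tl M u) = tl M f.
    by rewrite mulrC mulrVK ?loc_unit_notin.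
  by rewrite mulrBr [tl M u * (_ * _)]mulrA E rmorphB !rmorphM.
move=> /loc_principal [v nv hv].
have red (w : R) a : socle_x0 w -> principal x (a * w - component 0 a * w).
  move=> sw; rewrite -mulrBl; apply: (irrelevant_multiples pI sw).
  by rewrite componentB // (component_id homI 0 (component_deg 0 a)) subrr.
have nvu : v * u \notin M by rewrite primeM negb_or nv.
have [c c0 cE] := unit0 _ nvu; have [c' c'E] := component0_const (v * f).
exists (c^-1 * c').
have P1 := red w1 (v * u) s1; have P2 := red w2 (v * f) s2.
rewrite cE in P1; rewrite c'E in P2.
have P3 : principal x (coordC I c * w1 - coordC I c' * w2).
  rewrite (_ : _ - _ = v * (u * w1 - f * w2) - (v * u * w1 - coordC I c * w1)
    + (v * f * w2 - coordC I c' * w2)); last by ring.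
  by apply: idealD => //; apply: idealB.
have := idealM (coordC I c^-1) pI P3.
by rewrite mulrBr !mulrA -!rmorphM mulVf // rmorph1 mul1r.
Qed.

(** A socle form modulo x0 is proportional to one of degree r, so it cannot have smaller degree.
    Below degree r some variable therefore keeps the form non-zero modulo x0. *)
Lemma reach_top : gorenstein R -> forall (d : nat) f, coord_deg d f ->
  ~ principal x f -> exists (e : nat) h, [/\ coord_deg e h, (d + e)%N = r &
    ~ principal x (h * f)].
Proof.
move=> gor d; move E : (r - d)%N => m; elim: m d E => [|m ih] d E f hf nf.
all: have dr : (d <= r)%N
  by rewrite leqNgt; apply/negP => rd; apply: nf; apply: principal_above hf rd.
  exists 0%N, 1; split; [exact: coord_deg1|lia|by rewrite mul1r].
have [sf|/existsNP [i ni]] := pselect (socle_x0 f).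
  have [t ht nt] := top_exists.
  have [c hc] := socle_unique gor hf ht sf (top_socle ht) nf nt.
  case: nf; have := principal_x0_homogeneous d hc.
  rewrite componentB // componentCM // (component_id homI _ hf) eqxx.
  rewrite (component_id homI _ ht) (_ : (d == r) = false) ?mulr0 ?subr0 //.
  by apply/eqP; lia.
have [|||e [h [he der nh]]] := ih d.+1 _ (coordX I i * f).
- lia.
- by rewrite -add1n; apply: coord_degM => //; apply: coord_degX.
- exact: ni.
exists e.+1, (h * coordX I i); split; last by rewrite -mulrA.
- by rewrite -addn1; apply: coord_degM => //; apply: coord_degX.
- by rewrite addnS -addSn.
Qed.

Local Notation Q := (Qh I).
Local Notation y := (Qx I).
Local Notation ev := (@evx0 K n I).
Variable sigma : Q -> Q.
Hypothesis tr : trace_map sigma.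
Variable g : Q.
Hypothesis lg : lowest r sigma g.

Definition generates := forall c, complementary_module sigma c ->
  exists b, c = g * toQ b.

Lemma trace_component (i : int) q :
  Qcomponent X i (sigma (g * q)) = sigma (g * Qcomponent X (i + r%:Z) q).
Proof.
have [N [F [t [-> ht]]]] := Q_decompose X q.
rewrite mulr_sumr (sigma_sum tr) !(Qcomponent_sum X) mulr_sumr (sigma_sum tr).
apply: eq_bigr => k _; rewrite (Qcomponent_id X _ (ht k)).
rewrite (Qcomponent_id X _ (sigma_deg tr (Q_degM X lg.1 (ht k)))).
rewrite (_ : (i == _) = (i + r%:Z == t k)); last by apply/eqP/eqP; lia.
by case: eqP => // _; rewrite mulr0 (sigma0 tr).
Qed.

Lemma trace_below (d : nat) f : coord_deg d f -> (d < r)%N -> sigma (g * toQ f) = 0.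
Proof.
move=> hf dr; have [P hP] := lg.2 f; rewrite hP.
have : coord_deg (- r%:Z + d%:Z) (ev P).
  apply/(coord_deg_toQ X); rewrite -hP; apply: (sigma_deg tr).
  by apply: (Q_degM X) lg.1 _; apply/(coord_deg_toQ X).
by case E : (- r%:Z + d%:Z) => [m|m] //; [lia|move=> ->; rewrite rmorph0].
Qed.

Lemma trace_principal f : coord_deg r f -> principal x f -> sigma (g * toQ f) = 0.
Proof.
move=> hf /(principal_deg homI (coord_deg_x0 I) hf) [k hk fE].
case: (posnP r) => r0.
  have := component_id homI 0 hf; rewrite r0 eqxx => <-.
  by rewrite fE (componentMl homI _ _ (coord_deg_x0 I)) /= rmorph0 mulr0 (sigma0 tr).
rewrite fE rmorphM mulrCA (sigmaZ tr) /=; last by rewrite -evx0X; apply: L0_ev.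
by rewrite (trace_below hk) ?mulr0 //; lia.
Qed.

Hypothesis ug : g \is a GRing.unit.

(** If the value were zero, g sigma would vanish on all of R: below degree r for degree reasons, in
    degree r because R_r is spanned by [t] and multiples of x0, above by division by x0. This would
    force g = 0. *)
Lemma trace_top : gorenstein R -> forall t, coord_deg r t -> ~ principal x t ->
  sigma (g * toQ t) <> 0.
Proof.
move=> gor t ht nt st.
suff g0 : g = 0 by move: ug; rewrite g0 unitr0.
apply: (sigma_eq0_R X tr) => f.
have [N /(_ N (leqnn N)) ->] := component_bound f.
rewrite rmorph_sum mulr_sumr (sigma_sum tr) big1 // => i _.
have hi := component_deg i f.
have [ir|ri] := ltnP i r; first exact: trace_below hi ir.
have [|f' hf' ->] := divide_x0 X (d := r) _ hi; first by rewrite leqnn.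
rewrite rmorphM mulrCA (sigmaZ tr) /=; last first.
  by rewrite -evx0X -rmorphXn; apply: L0_ev.
suff -> : sigma (g * toQ f') = 0 by rewrite mulr0.
have [pf|nf] := pselect (principal x f'); first exact: trace_principal.
have [c hc] := socle_unique gor hf' ht (top_socle hf') (top_socle ht) nf nt.
have hd : coord_deg r (f' - coordC I c * t).
  by apply: coord_deg_sub => //; apply: coord_degCM.
rewrite -[f'](subrK (coordC I c * t)) rmorphD mulrDr (sigmaD tr).
rewrite (trace_principal hd hc) add0r rmorphM mulrCA (sigmaZ tr).
  by rewrite st mulr0.
exact: L0_QC.
Qed.

Lemma gorenstein_generates : gorenstein R -> generates.
Proof.
move=> gor c cc.
(* If x0^N divides every trace of F h, then it divides [F]. A component of [F] not divisible by x0
   could be moved to degree r by some form [h]; its trace there is the constant coefficient of the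
   trace of F h, non-zero by [trace_top]. *)
have main N : forall F, (forall h, exists P,
    sigma (g * toQ (F * h)) = toQ (ev (P * 'X^N))) -> exists F', F = x ^+ N * F'.
  elim: N => [|N ih] F hF; first by exists F; rewrite expr0 mul1r.
  have [F1 FE] : principal x F.
    apply: (component_ideal pI) => i; apply: contrapT => ni.
    have [e [h [he ier nh]]] := reach_top gor (component_deg i F) ni.
    have ht : coord_deg r (component i F * h).
      by rewrite -ier; apply: coord_degM => //; apply: component_deg.
    have := trace_top gor ht; rewrite mulrC; apply => //.
    have [P hP] := hF h; have := trace_component 0 (toQ (F * h)).
    have -> : Qcomponent X (0 + r%:Z) (toQ (F * h)) = toQ (component i F * h).
      rewrite -[toQ (F * h)]divr1 -(expr0 y) QcomponentE expr0 divr1 add0r addr0 /=.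
      by rewrite (componentM homI _ _ he) -ier leq_addl addnK.
    rewrite [h * _]mulrC => <-.
    rewrite hP -[toQ (ev _)]divr1 -(expr0 y) QcomponentE expr0 divr1 /=.
    by rewrite component_evx0 // coefMXn /= rmorph0 mul0r rmorph0.
  have [|F' F'E] := ih F1.
    move=> h; have [P hP] := hF h; exists P.
    apply: (mulrI (Qy_unit X 1)); rewrite QxE expr1.
    transitivity (sigma (g * toQ (F * h))).
      rewrite FE -mulrA [toQ (x * _)]rmorphM [g * (_ * _)]mulrCA.
      by rewrite -[in RHS](expr1 x) (sigma_x0n tr) expr1.
    by rewrite hP exprS mulrCA rmorphM /= evx0X rmorphM.
  by exists F'; rewrite FE F'E mulrA -exprS.
have [F [k qE]] := Q_fracE X (g^-1 * c).
have [|F' FE] := main k F.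
  move=> h; have [P hP] := complementary_integral cc h; exists P.
  have cE : c = g * (toQ F / y ^+ k) by rewrite -qE mulVKr.
  have -> : ev (P * 'X^k) = ev P * x ^+ k by rewrite rmorphM rmorphXn /= evx0X.
  rewrite [toQ (_ * x ^+ k)]rmorphM /= -QxE -hP [in RHS]cE.
  have -> : g * (toQ F / y ^+ k) * toQ h = g * toQ (F * h) / y ^+ k.
    by rewrite rmorphM mulrA mulrAC mulrA.
  by rewrite (sigma_frac tr) mulrVK ?(Qy_unit X).
exists F'; rewrite -(mulVKr ug c) qE FE; congr (_ * _).
by rewrite rmorphM /= -QxE mulrC mulKr // (Qy_unit X).
Qed.

End Socle.

(** * Gorenstein property from a self-dual trace form *)

Lemma maximal_unit (A : comNzRingType) (M : prime_idealr A) u :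
  maximal_ideal M -> u \notin M -> exists b, 1 - u * b \in M.
Proof.
move=> maxM nu; apply: contrapT => /forallNP hn.
have hJ : is_ideal (addI (fun a => a \in M) (principal u)).
  by apply: addI_ideal; [exact: prime_ideal|exact: principal_ideal].
have [|J hJE] := ideal_exists hJ.
  by move=> [a [_ [Ma [b ->] e]]]; apply: (hn b); rewrite e addrK.
have MJ : {subset M <= J}.
  move=> a Ma; apply/hJE; exists a, 0; split; rewrite ?addr0 //.
  by exists 0; rewrite mulr0.
case/negP: nu; apply: (maxM J MJ); apply/hJE; exists 0, u.
by split; rewrite ?add0r //; [exact: prime0|exists 1; rewrite mulr1].
Qed.

Lemma idgen_cons (A : comNzRingType) (s : seq A) w c b :
  idgen s b -> idgen (w :: s) (c * w + b).
Proof.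
move=> [d ->]; exists (fun i => if unlift ord0 i is Some j then d j else c).
rewrite big_ord_recl unlift_none /=; congr (_ + _).
by apply: eq_bigr => i _; rewrite liftK.
Qed.

(** * Finite algebras over a polynomial ring in one variable are noetherian *)

Section Noetherian.
Variables (K : fieldType) (A : comNzRingType) (ev : {rmorphism {poly K} -> A}).
Variables (m : nat) (e : nat -> A).
Hypothesis gen : forall f, exists P : nat -> {poly K}, f = \sum_(k < m) ev (P k) * e k.

(** Induction on the number of module generators: an element of J whose last coordinate has least
    degree reduces all others, by Euclidean division, to those with last coordinate zero. *)
Lemma poly_module_noetherian : noetherian A.
Proof.
move=> J hJ.
suff [s [sJ sg]] : exists s : seq A, (forall a, a \in s -> J a) /\
    forall P : nat -> {poly K}, J (\sum_(k < m) ev (P k) * e k) ->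
      idgen s (\sum_(k < m) ev (P k) * e k).
  exists s => a; split=> [Ja|[c ->]].
    by have [P aE] := gen a; rewrite aE; apply: sg; rewrite -aE.
  by apply: ideal_sum => // i _; apply: idealM => //; apply/sJ/mem_nth.
elim: m => [|k [s [sJ sg]]].
  exists [::]; split=> // P _; exists (fun=> 0).
  by rewrite !big_ord0.
(* The possible last coordinates of elements of J; representations need not be unique, so any one of
   them counts. *)
pose lead (Q : {poly K}) := exists P : nat -> {poly K},
  J (\sum_(i < k) ev (P i) * e i + ev Q * e k).
have [[Q [Q0 [P PJ]]]|no] := pselect (exists Q, Q != 0 /\ lead Q); last first.
  exists s; split=> // P; rewrite big_ord_recr /= => PJ.
  have Pk : P k = 0.
    by apply: contrapT => /eqP h; apply: no; exists (P k); split=> //; exists P.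
  by move: PJ; rewrite Pk rmorph0 mul0r addr0; apply: sg.
have ex : exists d, `[< exists Q, [/\ Q != 0, lead Q & size Q = d] >].
  by exists (size Q); apply/asboolP; exists Q; split=> //; exists P.
have [d /asboolP [Q1 [Q10 [P1 P1J] sQ1]] dmin] := ex_minnP ex.
set w := _ + _ in P1J; exists (w :: s); split.
  by move=> a; rewrite inE => /predU1P [->//|/sJ].
move=> P2; rewrite big_ord_recr /= => P2J.
pose q := P2 k %/ Q1.
pose P3 i := P2 i - q * P1 i.
have E : \sum_(i < k) ev (P2 i) * e i + ev (P2 k) * e k =
    ev q * w + (\sum_(i < k) ev (P3 i) * e i + ev (P2 k %% Q1) * e k).
  rewrite [P2 k in LHS](divp_eq _ Q1) -/q /w rmorphD rmorphM /=.
  rewrite (eq_bigr (fun i : 'I_k => ev q * (ev (P1 i) * e i) + ev (P3 i) * e i)).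
    by rewrite big_split -mulr_sumr /=; ring.
  by move=> i _; rewrite /P3 rmorphB rmorphM /=; ring.
have P3J : J (\sum_(i < k) ev (P3 i) * e i + ev (P2 k %% Q1) * e k).
  rewrite (_ : _ + _ = (\sum_(i < k) ev (P2 i) * e i + ev (P2 k) * e k) - ev q * w).
    by apply: idealB => //; apply: idealM.
  by rewrite E addrAC subrr add0r.
have r0 : P2 k %% Q1 = 0.
  apply: contrapT => /eqP nz.
  suff /dmin : `[< exists Q, [/\ Q != 0, lead Q & size Q = size (P2 k %% Q1)] >].
    by rewrite -sQ1 leqNgt ltn_modp Q10.
  by apply/asboolP; exists (P2 k %% Q1); split=> //; exists P3.
rewrite r0 rmorph0 mul0r addr0 in E P3J; rewrite E.
by apply: idgen_cons; apply: sg.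
Qed.

End Noetherian.

(** * The coordinate ring over K[x0] and its polynomial-valued trace form *)

Section Generated.
Variables (K : fieldType) (n : nat) (I : idealr {mpoly K[n.+1]}).
Local Notation R := (coord_ring I).
Local Notation x := (x0 I).
Variables (s : nat) (p : 'I_s -> prime_idealr R) (r : nat).
Hypothesis X : zero_dim_scheme p r.
Let homI : homogeneous_ideal I. Proof. by case: X. Qed.
Local Notation ev := (@evx0 K n I).

Lemma evx0_inj : injective ev.
Proof.
move=> P P' e; apply/polyP => k; apply: (@coordC_inj K n I).
apply: (x0n_inj X (k := k)); rewrite /= mulrC [RHS]mulrC -!component_evx0 //.
by rewrite e.
Qed.

(** Elements of degree at most r generate R over K[x0], as higher forms are powers of x0 times forms
    of degree r. *)
Lemma coord_ring_noetherian : noetherian R.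
Proof.
have [m [e se]] := low_fin I r.
pose e' k := if insub k is Some i then e i else 0.
have e'E (i : 'I_m) : e' i = e i by rewrite /e' valK.
pose S f := exists P : nat -> {poly K}, f = \sum_(k < m) ev (P k) * e' k.
have SD f f' : S f -> S f' -> S (f + f').
  move=> [P ->] [P' ->]; exists (fun k => P k + P' k); rewrite -big_split /=.
  by apply: eq_bigr => k _; rewrite rmorphD mulrDl.
have SM A f : S f -> S (ev A * f).
  move=> [P ->]; exists (fun k => A * P k); rewrite mulr_sumr.
  by apply: eq_bigr => k _; rewrite rmorphM mulrA.
have Slow f : low r f -> S f.
  move=> /se [c /esym/eqP]; rewrite subr_eq0 => /eqP ->.
  exists (fun k => if insub k is Some i then (c i)%:P else 0).
  by rewrite /comb; apply: eq_bigr => i _; rewrite valK evx0C e'E.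
apply: (poly_module_noetherian (ev := @evx0 K n I) (m := m) (e := e')) => f.
have [N /(_ N (leqnn N)) ->] := component_bound f.
apply: (big_ind S) => // [|i _].
  by exists (fun=> 0); rewrite big1 // => k _; rewrite rmorph0 mul0r.
have hi := component_deg i f; have [ir|ri] := leqP i r.
  by apply: Slow; apply: low_deg hi ir.
have [|f' hf' ->] := divide_x0 X (d := r) _ hi; first by rewrite leqnn ltnW.
by rewrite -evx0X -rmorphXn; apply/SM/Slow/(low_deg homI hf').
Qed.

(* If [x0] is invertible modulo [M] with inverse [u], then multiplication by [u]
   preserves a finite-dimensional space modulo [M], so [u] is algebraic. *)
Lemma maximal_poly (M : prime_idealr R) : maximal_ideal M ->
  exists2 P : {poly K}, P != 0 & ev P \in M.
Proof.
move=> maxM; have [xM|nx] := boolP (x \in M).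
  by exists 'X; rewrite ?polyX_eq0 // evx0X.
have [u uM] := maximal_unit maxM nx.
have [d hd] := low_exists homI u.
(* Multiplication by [u] takes degree at most r to degree at most E. A form x0 f' of degree above r
   is instead sent to f' modulo [M], so degrees at most E are preserved. *)
pose E := (r + d)%N.
pose J f := exists2 v, low E v & u * f - v \in M.
have lE := low_subspace homI E.
have JD f f' : J f -> J f' -> J (f + f').
  move=> [v hv Mv] [v' hv' Mv']; exists (v + v'); first exact: (subspaceD lE).
  have -> : u * (f + f') - (v + v') = (u * f - v) + (u * f' - v') by ring.
  by rewrite rpredD.
have lowJ f : low E f -> J f.
  move=> hf; rewrite (component_sum_le (N := E.+1) hf).
  apply: (big_ind J) => // [|i _].
    by exists 0; [exact: lE.1|rewrite mulr0 subr0 prime0].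
  have hi := component_deg i f; have [ir|ri] := leqP i r.
    exists (u * component i f); last by rewrite subrr prime0.
    move=> k Ek; apply: (lowM homI hd hi); apply: leq_ltn_trans Ek.
    by rewrite addnC leq_add2r.
  have [|f' hf' fE] := divide_x0 X (d := i.-1) _ hi.
    by rewrite leq_pred andbT -ltnS (leq_trans ri) // leqSpred.
  have i0 : (0 < i)%N by apply: leq_ltn_trans ri.
  rewrite (_ : (i - i.-1)%N = 1%N) ?expr1 in fE; last by lia.
  exists f'; first by apply: (low_deg homI hf'); have := ltn_ord i; lia.
  have -> : u * component i f - f' = - f' * (1 - x * u) by rewrite fE; ring.
  by rewrite primeMr.
have /choice [v hv] : forall k, exists v, low E v /\ u ^+ k - v \in M.
  elim=> [|k [v [hv Mv]]].
    exists 1; rewrite expr0 subrr prime0; split=> //.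
    exact: (low_deg homI (coord_deg1 I)).
  have [w hw Mw] := lowJ v hv; exists w; split=> //.
  rewrite exprS (_ : _ - _ = u * (u ^+ k - v) + (u * v - w)); last by ring.
  by rewrite rpredD ?primeMr.
have [m [c [k0 [k0m ck0 /esym rel]]]] := fin_span_dep (subspace0 _) (low_fin I E)
  (fun k => (hv k).1).
have relM : \sum_(k < m) coordC I (c k) * u ^+ k \in M.
  have -> : \sum_(k < m) coordC I (c k) * u ^+ k =
      \sum_(k < m) coordC I (c k) * (u ^+ k - v k).
    apply/eqP; rewrite -subr_eq0 -sumrB -[X in _ == X]rel; apply/eqP.
    by apply: eq_bigr => k _; ring.
  by apply: rpred_sum => k _; rewrite primeMr //; case: (hv k).
have xu k : 1 - (x * u) ^+ k \in M.
  elim: k => [|k ih]; first by rewrite expr0 subrr prime0.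
  rewrite exprS (_ : _ - _ = (1 - x * u) + x * u * (1 - (x * u) ^+ k)); last by ring.
  by rewrite rpredD // primeMr.
(* The relation among the powers of [u] multiplied by x0^m, where x0^m u^k is congruent to x0^(m -
   k). *)
exists (\sum_(k < m) (c k)%:P * 'X^(m - k)).
  apply/eqP => /polyP /(_ (m - k0)%N); rewrite coef0 coef_sum.
  rewrite (bigD1 (Ordinal k0m)) //= coefCM coefXn eqxx mulr1 big1 ?addr0.
    by move/eqP; rewrite (negPf ck0).
  move=> k; rewrite -val_eqE /= => kk0; rewrite coefCM coefXn.
  rewrite (_ : (_ == _) = false) ?mulr0 //; apply/eqP.
  by move/eqP: kk0; have := ltn_ord k; lia.
rewrite rmorph_sum /=.
have := primeMr (x ^+ m) relM; rewrite mulr_sumr.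
rewrite (eq_bigr (fun k : 'I_m => ev ((c k)%:P * 'X^(m - k)) -
    coordC I (c k) * x ^+ (m - k) * (1 - (x * u) ^+ k))).
  rewrite sumrB => h; rewrite -[X in X \in M](subrK (\sum_(k < m)
    coordC I (c k) * x ^+ (m - k) * (1 - (x * u) ^+ k))).
  by rewrite rpredD // rpred_sum // => k _; rewrite primeMr.
move=> k _; rewrite rmorphM rmorphXn /= evx0C evx0X exprMn.
by rewrite -{1}(subnK (ltnW (ltn_ord k))) exprD; ring.
Qed.

Local Notation Q := (Qh I).
Local Notation y := (Qx I).
Variable sigma : Q -> Q.
Hypothesis tr : trace_map sigma.
Variable g : Q.
Hypotheses (lg : lowest r sigma g) (ug : g \is a GRing.unit).
Hypothesis gen : generates sigma g.

(** Values are taken in [{poly K}] rather than in R to have division with remainder. *)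
Definition Tr f : {poly K} := projT1 (cid (lg.2 f)).

Lemma TrP f : sigma (g * toQ f) = toQ (ev (Tr f)).
Proof. exact: projT2 (cid (lg.2 f)). Qed.

Lemma Tr_uniq f P : sigma (g * toQ f) = toQ (ev P) -> Tr f = P.
Proof. by rewrite TrP => /(@toQ_inj K n I) /evx0_inj. Qed.

Lemma TrD f f' : Tr (f + f') = Tr f + Tr f'.
Proof. by apply: Tr_uniq; rewrite rmorphD mulrDr (sigmaD tr) !TrP !rmorphD. Qed.

Lemma Tr_ev A f : Tr (ev A * f) = A * Tr f.
Proof.
apply: Tr_uniq; rewrite rmorphM mulrCA (sigmaZ tr) ?TrP ?rmorphM //.
exact: L0_ev.
Qed.

Lemma Tr0 : Tr 0 = 0.
Proof. by apply: Tr_uniq; rewrite !rmorph0 mulr0 (sigma0 tr). Qed.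

Lemma TrN f : Tr (- f) = - Tr f.
Proof. by apply/eqP; rewrite -addr_eq0 -TrD addNr Tr0. Qed.

Lemma Tr_sum N (F : 'I_N -> R) : Tr (\sum_k F k) = \sum_k Tr (F k).
Proof. by elim/big_rec2: _ => [|k a b _ <-]; rewrite (Tr0, TrD). Qed.

Lemma Tr_component f k : Tr (component (k + r) f) = (Tr f)`_k *: 'X^k.
Proof.
have QE i h : Qcomponent X (Posz i) (toQ h) = toQ (component i h).
  by rewrite -[toQ h]divr1 -(expr0 y) QcomponentE expr0 divr1 addr0.
apply: Tr_uniq; have := trace_component X tr lg k (toQ f).
rewrite TrP !QE component_evx0 // => <-; congr toQ.
by rewrite -mul_polyC rmorphM rmorphXn /= evx0C evx0X.
Qed.

Lemma Tr_low (d : nat) f : coord_deg d f -> (d < r)%N -> Tr f = 0.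
Proof.
by move=> hf dr; apply: Tr_uniq; rewrite (trace_below X tr lg hf dr) !rmorph0.
Qed.

(** By the divisibility g f / x0^e has integral traces, so it lies in C = g R; cancelling [g] puts f
    / x0^e in R. *)
Lemma dual_principal_x0 (d : nat) e f : coord_deg d f ->
  (forall h, 'X^e %| Tr (h * f)) -> principal (x ^+ e) f.
Proof.
move=> hf dv; pose q := toQ f / y ^+ e.
have dq : Q_deg (d%:Z - e%:Z) q by apply: (Q_deg_frac X); rewrite subrK.
have [|b bE] := gen (c := g * q).
  have := integral_complementary X tr 1 (Q_degM X lg.1 dq).
  rewrite rmorph1 mul1r; apply => h.
  have [P PE] := dvdpP _ _ (dv h); exists P.
  have -> : g * q * toQ h = g * toQ (h * f) / y ^+ e.
    by rewrite /q rmorphM !mulrA mulrAC [g * toQ f * _]mulrAC.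
  rewrite (sigma_frac tr) TrP PE rmorphM rmorphXn /= evx0X.
  by rewrite rmorphM /= -QxE mulrK // (Qy_unit X).
exists b; apply: (@toQ_inj K n I).
rewrite rmorphM /= -QxE -(mulrI ug bE) /q mulrC mulrVK //.
exact: (Qy_unit X).
Qed.

(** Induction on a degree bound for [f]. The leading term of P(x0) is a multiple of x0^e, and the
    top component of [f] meets the condition of [dual_principal_x0] for x0^e; subtracting a multiple
    of P(x0) removes that component. *)
Lemma dual_principal (P : {poly K}) f : P != 0 -> (forall h, P %| Tr (h * f)) ->
  principal (ev P) f.
Proof.
move=> P0; have [N hN] := component_ge homI f.
elim: N f hN => [|N ih] f hN dv.
  rewrite (_ : f = 0); first by exists 0; rewrite mulr0.
  by apply: component_ext => i; rewrite component0 // hN.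
pose e := (size P).-1; pose fN := component N f; have hfN := component_deg N f.
have eP : (e < size P)%N by rewrite /e prednK // size_poly_gt0.
have pN : principal (x ^+ e) fN.
  apply: (dual_principal_x0 hfN) => h; have [M /(_ M (leqnn M)) ->] := component_bound h.
  rewrite mulr_suml Tr_sum.
  apply: (big_ind (fun A => 'X^e %| A)) => [|A B|i _]; [exact: dvdp0|exact: dvdp_add|].
  set u := component i h; have hu : coord_deg i u by apply: component_deg.
  have huf : coord_deg (i + N)%N (u * fN) by apply: coord_degM.
  have [low|rk] := ltnP (i + N) r; first by rewrite (Tr_low huf low) dvdp0.
  have cuf k : component (k + r) (u * f) =
      if (i <= k + r)%N then u * component (k + r - i) f else 0.
    exact: (componentMl homI _ _ hu).
  have Ak k : (i + N < k + r)%N -> (Tr (u * f))`_k = 0.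
    move=> kN; have := Tr_component (u * f) k; rewrite cuf.
    rewrite hN ?mulr0 ?if_same ?Tr0; last by lia.
    by move/(congr1 (fun A : {poly K} => A`_k)); rewrite coef0 coefZ coefXn eqxx mulr1.
  pose k := (i + N - r)%N.
  have E : Tr (u * fN) = (Tr (u * f))`_k *: 'X^k.
    rewrite -Tr_component cuf (_ : (k + r = i + N)%N); last by rewrite /k; lia.
    by rewrite leq_addr addKn.
  rewrite E; have [->|nz] := eqVneq (Tr (u * f))`_k 0; first by rewrite scale0r dvdp0.
  have [ek|ke] := leqP e k; first by rewrite dvdpZr // dvdp_exp2l.
  (* With k < e the trace of u f would be a non-zero multiple of P of degree at most k, less than
     the degree e of P. *)
  have sz : (size (Tr (u * f)%R) <= k.+1)%N.
    by apply/leq_sizeP => j kj; apply: Ak; rewrite /k in kj; lia.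
  have nz' : Tr (u * f) != 0 by apply: contraNneq nz => ->; rewrite coef0.
  have := dvdp_leq nz' (dv u); rewrite leqNgt => /negP; case.
  by apply: leq_ltn_trans sz _; apply: leq_ltn_trans eP.
have [f2 hf2 fNE] := principal_deg homI (coord_deg_x0n I e) hfN pN.
(* If N < e, divisibility by x0^e makes the component of degree N zero, and the bound drops at
   once. *)
have [eN|Ne] := leqP e N; last first.
  apply: ih => // i; rewrite leq_eqVlt => /predU1P [<-|]; last exact: hN.
  have := component_id homI N hfN; rewrite eqxx fNE.
  by rewrite (componentMl homI _ _ (coord_deg_x0n I e)) leqNgt Ne => <-.
(* Chosen so that the component of degree N of P(x0) b equals that of [f]. *)
pose b := coordC I (lead_coef P)^-1 * f2.
have hb : coord_deg (N - e)%N b by apply: coord_degCM.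
have [|h|k fE] := ih (f - ev P * b).
- move=> i Ni; rewrite componentB // (componentM homI _ _ hb) component_evx0 //.
  rewrite (_ : (N - e <= i)%N = true); last by lia.
  move: Ni; rewrite leq_eqVlt => /predU1P [<-|Ni].
    rewrite subKn // fNE /b.
    rewrite (_ : P`_e = lead_coef P) // [coordC I _ * _]mulrC -mulrA.
    rewrite [_ * (_ * f2)]mulrA -rmorphM mulfV ?lead_coef_eq0 //.
    by rewrite rmorph1 mul1r subrr.
  have iP : (size P <= i - (N - e))%N by rewrite /e in eN *; lia.
  by rewrite hN // nth_default // rmorph0 !mul0r subr0.
- by rewrite mulrBr TrD TrN mulrCA Tr_ev dvdp_sub // dvdp_mulr.
exists (k + b); rewrite mulrDr -fE subrK //.
Qed.

(* The top coefficient of the remainder of [Tr (h f)] modulo [P] is a [K]-bilinear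
   form on [R / P(x0)], nondegenerate by [dual_principal]. *)
Definition bform (P : {poly K}) f h := (Tr (h * f) %% P)`_(size P).-2.

Lemma bformD (P : {poly K}) f h h' : bform P f (h + h') = bform P f h + bform P f h'.
Proof. by rewrite /bform mulrDl TrD modpD coefD. Qed.

Lemma bformC (P : {poly K}) f c h : bform P f (coordC I c * h) = c * bform P f h.
Proof. by rewrite /bform -mulrA -evx0C Tr_ev mul_polyC modpZl coefZ. Qed.

(** A non-zero remainder A of some trace would be seen by the form: multiplying [h] by x0^j with j =
    deg P - 1 - deg A moves the leading coefficient of A to the position deg P - 1 that [bform]
    reads, without a new reduction modulo P. *)
Lemma bform_principal (P : {poly K}) f : (1 < size P)%N -> (forall h, bform P f h = 0) ->
  principal (ev P) f.
Proof.
move=> P1 hf; have P0 : P != 0 by rewrite -size_poly_gt0 ltnW.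
apply: dual_principal => // h; apply/modp_eq0P/eqP; apply: contrapT => /negP nz.
set A := Tr (h * f) %% P in nz; have sA : (size A < size P)%N by rewrite ltn_modp.
have A0 : (0 < size A)%N by rewrite size_poly_gt0.
pose j := (size P - (size A).+1)%N.
have := hf (ev 'X^j * h); rewrite /bform -mulrA Tr_ev -modp_mul -/A.
have sX : (size ('X^j * A)%R <= (size P).-1)%N.
  apply: leq_trans (size_polyMleq _ _) _; rewrite size_polyXn.
  by rewrite /j; lia.
rewrite modp_small; last by apply: leq_ltn_trans sX _; rewrite ltn_predL ltnW.
rewrite coefXnM (_ : ((size P).-2 < j)%N = false); last by rewrite /j; lia.
rewrite (_ : ((size P).-2 - j)%N = (size A).-1); last by rewrite /j; lia.
by move=> /eqP; rewrite -/(lead_coef A) lead_coef_eq0 (negPf nz).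
Qed.

(** The traces of all multiples of [f] are annihilated by P in the domain K[x0], hence vanish, and
    the trace form is nondegenerate. *)
Lemma evx0_nzd (P : {poly K}) f : P != 0 -> ev P * f = 0 -> f = 0.
Proof.
move=> P0 Pf; apply: (@toQ_inj K n I); rewrite rmorph0.
apply: (mulrI ug); rewrite mulr0; apply: (sigma_eq0_R X tr) => h.
rewrite -mulrA -rmorphM TrP.
have : P * Tr (f * h) = 0 by rewrite -Tr_ev mulrA Pf mul0r Tr0.
by move/eqP; rewrite mulf_eq0 (negPf P0) => /eqP ->; rewrite !rmorph0.
Qed.

(** A form of degree above r + deg P is x0^(deg P) times another form, so subtracting a multiple of
    P(x0) lowers its degree; degrees at most r + deg P span the quotient. *)
Lemma finite_mod_poly (P : {poly K}) : P != 0 ->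
  fin_span (@coordC K n I) (fun=> True) (principal (ev P)).
Proof.
move=> P0; pose e := (size P).-1; pose E := (r + e)%N.
have pI := principal_ideal (ev P).
have [m [b sb]] := low_fin I E.
exists m, b => f _.
suff [v lv pv] : exists2 v, low E v & principal (ev P) (f - v).
  have [c hc] := sb v lv; exists c; move/esym/eqP: hc; rewrite subr_eq0 => /eqP <-.
  by [].
pose J f := exists2 v, low E v & principal (ev P) (f - v).
have lE := low_subspace homI E.
have JD f1 f2 : J f1 -> J f2 -> J (f1 + f2).
  move=> [v hv pv] [w hw pw]; exists (v + w); first exact: (subspaceD lE).
  by rewrite (_ : _ - _ = (f1 - v) + (f2 - w)); [apply: idealD|ring].
have J0 : J 0 by exists 0; [exact: lE.1|rewrite subrr; exact: pI.1].
have Jbig N (F : 'I_N -> R) : (forall i, J (F i)) -> J (\sum_i F i).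
  by move=> hF; apply: (big_ind J).
rewrite -/(J f); have [N /(_ N (leqnn N)) ->] := component_bound f.
apply: (Jbig) => i; move: (nat_of_ord i) (component_deg i f) => d.
move: (component d f) => {}f {i N}.
elim/ltn_ind: d f => d ih f hf; have [dE|Ed] := leqP d E.
  exists f; first exact: (low_deg homI hf).
  by rewrite subrr; apply: pI.1.
have [|f' hf' fE] := divide_x0 X (d := (d - e)%N) _ hf; first by rewrite /E in Ed; lia.
rewrite subKn in fE; last by rewrite /E in Ed; lia.
pose k := coordC I (lead_coef P)^-1 * f'.
have hk : coord_deg (d - e)%N k by apply: coord_degCM.
rewrite (_ : f = ev P * k + (f - ev P * k)); last by ring.
apply: JD; first by exists 0; [exact: lE.1|rewrite subr0; exists k].
rewrite (component_sum_le (N := d) (f := f - ev P * k)).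
  by apply: Jbig => i; apply: ih => //; apply: component_deg.
move=> i di; rewrite componentB // (componentM homI _ _ hk) component_evx0 //.
rewrite (component_id homI _ hf) (_ : (d - e <= i)%N = true); last by lia.
have [->|ne] := eqVneq i d.
  rewrite subKn; last by rewrite /E in Ed; lia.
  rewrite (_ : P`_e = lead_coef P) // /k fE [coordC I _ * _]mulrC -mulrA.
  rewrite [_ * (_ * f')]mulrA -rmorphM mulfV ?lead_coef_eq0 //.
  by rewrite rmorph1 mul1r subrr.
have iP : (size P <= i - (d - e))%N by move/eqP: ne; rewrite /E /e in Ed *; lia.
by rewrite nth_default // rmorph0 !mul0r subr0.
Qed.

(** * The localization at a prime containing P(x0) *)

Section AtMaximal.
Variables (M : prime_idealr R) (P : {poly K}).
Hypotheses (P0 : P != 0) (PM : ev P \in M).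
Local Notation a := (ev P).
Local Notation tl := (toloc (prime_mulset M)).
Let aI : is_ideal (principal a) := principal_ideal a.
Let MI : is_ideal (fun f => f \in M) := prime_ideal M.

Lemma poly_size : (1 < size P)%N.
Proof.
rewrite ltnNge; apply/negP => /size1_polyC PE; move: P0 PM; rewrite PE evx0C.
rewrite polyC_eq0 => c0 /(primeMr (coordC I (P`_0)^-1)).
by rewrite -rmorphM mulVf // rmorph1 (negPf (prime1 M)).
Qed.

Lemma principal_sub f : principal a f -> f \in M.
Proof. by move=> [k ->]; rewrite mulrC primeMr. Qed.

Definition socle_at f := forall h, h \in M -> principal a (h * f).

Lemma bform_socle f h : socle_at f -> h \in M -> bform P f h = 0.
Proof.
move=> sf /sf [k E]; rewrite /bform E Tr_ev modp_mulr coef0.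
by [].
Qed.

(* Nondegeneracy of [bform] embeds the socle into the dual of the finite
   extension [R / M] of [K], of the same dimension as the submodule spanned by
   a single [f1]: the Gram matrix of the form given by [f1] is invertible. *)
Lemma socle_at_unique f1 f2 : socle_at f1 -> socle_at f2 ->
  (forall v, v \notin M -> ~ principal a (v * f1)) ->
  exists b, principal a (f2 - b * f1).
Proof.
move=> s1 s2 n1.
have sM : subspace (@coordC K n I) (fun f => f \in M) by apply: ideal_subspace.
have fM : fin_span (@coordC K n I) (fun=> True) (fun f => f \in M).
  have [m [e se]] := finite_mod_poly P0; exists m, e => v _.
  by have [c hc] := se v Logic.I; exists c; apply: principal_sub.
have [l [e be]] := fin_span_basis (V := fun=> True) Logic.I sM fM.
have [_ Ie Se] := (basis_modP e (V := fun=> True) Logic.I sM).1 be.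
have bM b f h : bform P (b * f) h = bform P f (h * b).
  by rewrite /bform mulrA.
have zero_on f : socle_at f -> (forall j, bform P f (e j) = 0) -> principal a f.
  move=> sf he; apply: bform_principal; first exact: poly_size.
  move=> h; have [c hc] := Se h Logic.I.
  rewrite -[h](subrK (comb (@coordC K n I) e c)) bformD bform_socle // add0r.
  rewrite /comb; elim/big_ind: _ => [|u v hu hv|j _].
  - by apply: bform_socle => //; apply: prime0.
  - by rewrite bformD hu hv addr0.
  - by rewrite bformC he mulr0.
have smul b f : socle_at f -> socle_at (b * f).
  by move=> sf h /sf pf; rewrite mulrCA; apply: idealM.
have bcomb c j : bform P (comb (@coordC K n I) e c * f1) (e j) =
    \sum_i c i * bform P f1 (e i * e j).
  rewrite bM mulrC /comb mulr_suml.
  elim/big_rec2: _ => [|i u v _ <-].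
    by apply: bform_socle => //; apply: prime0.
  by rewrite bformD -mulrA bformC.
pose G := \matrix_(i < l, j < l) bform P f1 (e i * e j).
(* A vector in the left kernel of [G] gives an element b with b f1 orthogonal to the basis, so b f1
   is a multiple of P(x0). Then b lies in [M] by [n1], and its coordinates vanish by independence
   modulo [M]. *)
have uG : G \in unitmx.
  rewrite -row_free_unit -kermx_eq0; apply/negPn/negP => /rowV0Pn [c /sub_kermxP cG c0].
  have : principal a (comb (@coordC K n I) e (fun i => c 0 i) * f1).
    apply: zero_on; first exact: smul.
    move=> j; have := congr1 (fun A : 'rV_l => A 0 j) cG.
    rewrite bcomb [LHS]mxE [RHS]mxE => cGj; rewrite -[RHS]cGj.
    by apply: eq_bigr => i _; rewrite [G _ _]mxE.
  have [bM'|nb /(n1 _ nb)//] := boolP (comb (@coordC K n I) e (fun i => c 0 i) \in M).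
  case/eqP: c0; apply/rowP => i; rewrite mxE.
  exact: (Ie (fun i => c 0 i)).
(* The solution of c G = v makes f2 - b f1 orthogonal to the basis. *)
pose v := \row_j bform P f2 (e j); pose c := v *m invmx G.
exists (comb (@coordC K n I) e (fun i => c 0 i)); apply: zero_on.
  move=> h hM; rewrite mulrBr; apply: idealB => //; first exact: s2.
  exact: smul.
move=> j; have bB f f' h : bform P (f - f') h = bform P f h - bform P f' h.
  by rewrite /bform mulrBr TrD TrN modpD modpN coefB.
rewrite bB bcomb; apply/eqP; rewrite subr_eq0; apply/eqP.
have := congr1 (fun A : 'rV_l => A 0 j) (mulmxKV uG v).
rewrite [RHS]mxE => <-; rewrite mxE; apply: eq_bigr => i _.
by rewrite [G _ _]mxE.
Qed.

(** The regular sequence is the single element P(x0), and the socle generator comes from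
    [socle_exists]. A socle element of the localization becomes one of R modulo P(x0) after
    multiplication by an element outside [M], where [socle_at_unique] applies. *)
Lemma gorenstein_at : gorenstein_local (loc (prime_mulset M)).
Proof.
have M1 : ~ (1 : R) \in M by apply/negP/prime1.
have pM (f h : R) : f * h \in M -> f \in M \/ h \in M.
  by rewrite primeM => /orP.
have fin := finite_mod_poly P0.
have na : nonunit (tl a).
  by have := loc_nonunit a (prime1 M); rewrite rmorph1 divr1 => -[_]; apply.
have [z [zM zn]] := socle_exists aI MI M1 pM principal_sub fin.
have nuM (b : loc (prime_mulset M)) : nonunit b ->
    exists f u, [/\ u \notin M, b = tl f / tl u & f \in M].
  have [f [u [nu ->]]] := loc_frac b => nb; exists f, u; split=> //.
  exact/(loc_nonunit f nu).
exists [:: tl a]; split.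
- split=> [b|[|//] b _]; first by rewrite inE => /eqP ->.
  rewrite take0 /= => /idgen0; have [f [u [nu ->]]] := loc_frac b => e.
  apply/idgen0; have : tl (a * f) = 0.
    apply: (mulIr (x := (tl u)^-1)); first by rewrite unitrV loc_unit_notin.
    by rewrite mul0r rmorphM /= -mulrA.
  move=> /toloc_eq0 [v hv]; rewrite mulrCA => /(evx0_nzd P0) vf.
  suff -> : tl f = 0 by rewrite mul0r.
  by apply/toloc_eq0; exists v.
- move=> b /nuM [f [u [nu -> fM]]].
  have [k [v [nv hv]]] := finite_nilpotent aI MI M1 fin fM.
  exists k; apply/idgen1; rewrite expr_div_n -!rmorphXn.
  apply/principal_divr; first by apply: loc_unit_notin; apply: primeX.
  by apply/loc_principal; exists v => //; apply/negP.
exists (tl z); split.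
- move=> b /nuM [f [u [nu -> fM]]]; apply/idgen1; rewrite mulrAC -rmorphM.
  apply/principal_divr; first exact: loc_unit_notin.
  by apply/loc_principal; exists 1; rewrite ?prime1 // mul1r; apply: zM.
- by move=> /idgen1 /loc_principal [v /negP nv]; apply: zn.
move=> w sw; have [f [u [nu wE]]] := loc_frac w.
have [|v [nv hv]] := @uniform_annihilator K R (@coordC K n I) (principal a)
    (fun f => f \in M) aI MI M1 pM fin f.
  move=> h hM; have /sw/idgen1 : nonunit (tl h).
    by have := loc_nonunit h (prime1 M); rewrite rmorph1 divr1 => -[_]; apply.
  rewrite wE mulrA -rmorphM => /(principal_divr _ _ (loc_unit_notin nu)).
  by move=> /loc_principal [v /negP nv hv]; exists v.
have [|b hb] := socle_at_unique zM hv; first by move=> v' /negP; apply: zn.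
have nuv : u * v \notin M by rewrite primeM negb_or nu; apply/negP.
exists (tl b / tl (u * v)); apply/idgen1.
rewrite (_ : _ - _ = tl (v * f - b * z) / tl (u * v)).
  apply/principal_divr; first exact: loc_unit_notin.
  by apply/loc_principal; exists 1; rewrite ?prime1 // mul1r.
rewrite wE rmorphB !rmorphM mulrBl; congr (_ - _); last by rewrite mulrAC.
rewrite invrM ?loc_unit_notin //; last exact/negP.
by rewrite [tl v * _]mulrC mulrA mulrK // loc_unit_notin //; apply/negP.
Qed.

End AtMaximal.

Lemma generates_gorenstein : gorenstein R.
Proof.
split; first exact: coord_ring_noetherian.
move=> M maxM; have [P P0 PM] := maximal_poly maxM.
exact: gorenstein_at P0 PM.
Qed.

End Generated.

Lemma HF_different_gorenstein (K : fieldType) (n : nat)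
    (I : idealr {mpoly K[n.+1]}) (s : nat)
    (p : 'I_s -> prime_idealr (coord_ring I)) (r : nat) (sigma : Qh I -> Qh I)
    (g : Qh I) :
  zero_dim_scheme p r -> trace_map sigma -> lowest r sigma g ->
  g \is a GRing.unit ->
  gorenstein (coord_ring I) <->
  forall i : int, HF_different sigma i = HF I (i - r%:Z).
Proof.
move=> X tr lg ug; split=> [gor i|e].
  apply: (HF_different_ge X tr lg ug ug lg.1) => b _ c.
  move=> /(gorenstein_generates X tr lg ug gor) [b' ->].
  by exists (b * b'); rewrite mulrCA -!mulrA mulVKr // rmorphM mulrC.
apply: (generates_gorenstein X tr lg ug) => c cc.
(* Equality in degree r, applied to 1 in R_0, puts g^-1 into the different, which says that C is
   contained in g R. *)
have : different sigma (g^-1 * toQ 1).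
  by apply: (HF_different_eq X tr lg ug (e r)); rewrite subrr; apply: coord_deg1.
move=> /(_ c cc) [b bE]; exists b.
by rewrite -bE rmorph1 mulr1 mulVKr.
Qed.

Theorem proposition6p10 (K : fieldType) (n : nat)
    (I : idealr {mpoly K[n.+1]}) (s : nat)
    (p : 'I_s -> prime_idealr (coord_ring I)) (r : int) (sigma : Qh I -> Qh I)
    (K_infinite : forall l : seq K, exists x, x \notin l)
    (I_homogeneous : homogeneous_ideal I)
    (I_saturated : saturated I)
    (X_zero_dimensional : zero_dimensional I)
    (Supp_X : enumerates_support p)
    (X_off_hyperplane : forall j, x0 I \notin p j)
    (X_locally_gorenstein : locally_gorenstein p)
    (r_X : regularity_index p r)
    (sigma_trace : trace_map sigma)
    (X_cayley_bacharach : cayley_bacharach p r) :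
  ((forall i : int, (HF_different sigma i <= HF I (i - r))%N) /\
   (gorenstein (coord_ring I) <->
    forall i : int, HF_different sigma i = HF I (i - r))) /\
  (almost_gorenstein sigma r <-> HF_different sigma (r + 1) = HF I 1).
Proof.
(* X has a closed point, and by the Cayley-Bacharach property r equals the degree of that point, a
   natural number. *)
have [m rE] : exists m : nat, r = m%:Z.
  have [[q pq] qmax] := X_zero_dimensional.
  have [_ _ /(_ q) [|j _]] := Supp_X.
    by split=> // q' pq' qq'; apply: qmax qq'.
  by exists (deg_point p j).
subst r; have [HFm m_min] := r_X.
have X : zero_dim_scheme p m.
  split=> // [i mi|e]; first by rewrite !HFm.
  (* If HF took its final value already at m - 1, then m - 1 would satisfy the condition for which m
     is minimal. *)
  suff : m%:Z <= m%:Z - 1 by lia.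
  apply: m_min => i.
  have [->|ne] := eqVneq i (m%:Z - 1); first by rewrite e HFm.
  by move=> mi; apply: HFm; lia.
have [g lg ug] := lowest_exists_unit X sigma_trace K_infinite X_cayley_bacharach.
split; first split.
- by move=> i; apply: (HF_different_le X sigma_trace lg ug).
- exact: (HF_different_gorenstein X sigma_trace lg ug).
- exact: (almost_gorensteinP X sigma_trace lg ug).
Qed.
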